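(* Let $b\in\mathbb{R}$ be a constant and let $g:[0,\infty)\to[0,1]$ be a non-increasing function with $0<C:=\int_{\mathbb{R}^2}g(\|\boldsymbol{x}\|)\,d\boldsymbol{x}<\infty$ and $g(x)=o\left(\frac{1}{x^2\log^2 x}\right)$ as $x\to\infty$. Put $r_\rho=\sqrt{\frac{\log\rho+b}{C\rho}}$ and let $\mathcal{G}^{T}(\mathcal{X}_\rho,g_\rho)$ be the random connection network on the unit torus with density $\rho$ in which two nodes at toroidal distance $x$ are directly connected with probability $g(x/r_\rho)$. Then, as $\rho\to\infty$, the distribution of the number of isolated nodes in $\mathcal{G}^{T}(\mathcal{X}_\rho,g_\rho)$ converges to the Poisson distribution with mean $e^{-b}$.
   Context: The network $\mathcal{G}^{T}(\mathcal{X}_\rho,g_\rho)$: the nodes form a homogeneous Poisson point process $\mathcal{X}_\rho$ of density $\rho$ on the unit torus $A=\left[-\frac12,\frac12\right)^2$. The toroidal distance is $\|\boldsymbol{x}_1-\boldsymbol{x}_2\|^{T}=\min\{\|\boldsymbol{x}_1+\boldsymbol{z}-\boldsymbol{x}_2\|:\boldsymbol{z}\in\mathbb{Z}^2\}$, where $\|\cdot\|$ is the Euclidean norm. Given the node positions, each pair of nodes at $\boldsymbol{x}_1,\boldsymbol{x}_2$ is directly connected (joined by an edge) with probability $g\left(\|\boldsymbol{x}_1-\boldsymbol{x}_2\|^{T}/r_\rho\right)$, independently of all other pairs. A node is isolated if it is not directly connected to any other node. Throughout, $\rho$ is large enough that $\log\rho+b>0$. *)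

(* Defs.v *)
From HB Require Import structures.
From mathcomp Require Import all_boot all_order all_algebra.
From mathcomp Require Import all_classical all_reals all_analysis.

Set Implicit Arguments.
Unset Strict Implicit.
Unset Printing Implicit Defensive.

Import Order.TTheory GRing.Theory Num.Theory.
Import numFieldNormedType.Exports.

Local Open Scope classical_set_scope.
Local Open Scope ring_scope.

Section geometry.
Context {R : realType}.
Implicit Types x y : R * R.

(* The canonical norm of [R * R] is the max norm. *)
Definition enorm x : R := Num.sqrt (x.1 ^+ 2 + x.2 ^+ 2).

(* [measurableTypeR R] is [R] with the sigma-algebra carrying the library's
   Lebesgue measure. *)
Definition leb2 :
    {measure set (measurableTypeR R * measurableTypeR R) -> \bar R} :=
  (@lebesgue_measure R \x @lebesgue_measure R)%E.

Definition torus : set (R * R) :=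
  `[- 2^-1, 2^-1[%classic `*` `[- 2^-1, 2^-1[%classic.

(* The infimum is a minimum: only finitely many translates of [x] lie within a
   given distance of [y]. *)
Definition tdist x y : R :=
  inf [set enorm (x + (z.1%:~R, z.2%:~R) - y) | z in [set: int * int]].

End geometry.

(* A random graph with finitely many nodes in the plane: in the outcome [w], the
   nodes are the entries of the list [nodes w], in an arbitrary (possibly
   random) order, and [edge w i j] tells whether the i-th and the j-th node are
   directly connected.  The values of [edge w] at indices outside
   [0, size (nodes w)) are irrelevant. *)
Record random_graph (R : realType) (T : Type) := RandomGraph {
  nodes : T -> seq (R * R);
  edge : T -> rel nat
}.

Section random_connection_network.
Context {R : realType} {d : measure_display} {T : measurableType d}.
Variable P : probability T R.
Local Notation plane := (measurableTypeR R * measurableTypeR R)%type.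
Implicit Types (X : T -> seq (R * R)) (B : set plane) (G : random_graph R T).

Definition node_event X (i : nat) B : set T :=
  [set w | (i < size (X w))%N /\ B (nth 0 (X w) i)].

Definition sigma_nodes X : set (set T) :=
  <<s [set E | exists i B, measurable B /\ E = node_event X i B] >>.

Definition nb_nodes X B (w : T) : nat :=
  count (fun x => `[< B x >]) (X w).

(* [poisson_prob] has a dummy natural-number argument; at rate 0 it is the Dirac
   mass at 0. *)
Definition is_poisson_process (rho : R) X :=
  [/\ forall i B, measurable B -> measurable (node_event X i B),
      forall w x, x \in X w -> torus x,
      forall B, measurable B -> B `<=` torus -> forall S : set nat,
        P (nb_nodes X B @^-1` S) = poisson_prob (rho * fine (leb2 B)) 0%N S
    & forall m (B : 'I_m -> set plane),
        (forall k, measurable (B k) /\ B k `<=` torus) -> trivIset setT B ->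
        forall S : 'I_m -> set nat,
        P (\bigcap_k (nb_nodes X (B k) @^-1` S k)) =
        (\prod_k P (nb_nodes X (B k) @^-1` S k))%E].

(* Conditionally on the node positions, the pairs are connected independently of
   each other, two nodes at toroidal distance [x] with probability [h x]: the
   conditional probability, given [sigma_nodes], that the edges among the [n]
   nodes are exactly those prescribed by [e] is a product over the pairs of
   indices [i < j < n]. *)
Definition independent_connections (h : R -> R) G :=
  [/\ forall w, symmetric (edge G w),
      forall i j, measurable
        [set w | [&& i < size (nodes G w), j < size (nodes G w)
                   & edge G w i j]%N]
    & forall (n : nat) (e : rel nat) (F : set T),
        sigma_nodes (nodes G) F -> F `<=` [set w | size (nodes G w) = n] ->
        P (F `&` [set w | forall i j, (i < j < n)%N -> edge G w i j = e i j]) =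
        (\int[P]_(w in F)
          (\prod_(j < n) \prod_(i < j)
             bernoulli_pmf (h (tdist (nth 0%R (nodes G w) i)
                                     (nth 0%R (nodes G w) j))) (e i j))%:E)%E].

Definition is_random_connection_network (rho : R) (h : R -> R) G :=
  is_poisson_process rho (nodes G) /\ independent_connections h G.

Definition isolated (s : nat) (e : rel nat) (i : nat) : bool :=
  [forall j : 'I_s, (val j != i) ==> ~~ e i j].

Definition nb_isolated G (w : T) : nat :=
  #|[set i : 'I_(size (nodes G w)) | isolated (size (nodes G w)) (edge G w) i]%SET|.

End random_connection_network.

(* Lets the Landau notations accept the filter of neighborhoods of [+oo]. *)
Canonical pinfty_filter (R : numFieldType) : filter_on R :=
  FilterType (pinfty_nbhs R) _.

(* Convergence in distribution of laws on the real line: convergence of the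
   cumulative distribution functions at the continuity points of the limit. *)
Definition cvg_in_distribution (R : realType) (I : Type) (F : set_system I)
    (mu_ : I -> set R -> \bar R) (mu : set R -> \bar R) :=
  forall x : R, {for x, continuous (fun y : R => mu `]-oo, y]%classic)} ->
    mu_ i `]-oo, x]%classic @[i --> F] --> mu `]-oo, x]%classic.

(* Main.v *)
Require Import Defs.
From HB Require Import structures.
From mathcomp Require Import all_boot all_order all_fingroup all_algebra.
From mathcomp Require Import all_classical all_reals all_analysis.
From mathcomp Require Import measurable_realfun ring lra.

Set Implicit Arguments.
Unset Strict Implicit.
Unset Printing Implicit Defensive.

Import Order.TTheory GRing.Theory Num.Theory.
Import numFieldNormedType.Exports.

Local Open Scope classical_set_scope.
Local Open Scope ring_scope.

(* The order in which the nodes are listed is arbitrary: the counts of the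
   process only determine the means of symmetric functions of the list, and
   polarization (Ryser's formula for the permanent) identifies these means with
   those for independent uniform points.

   Let [p_k] be the probability that [k] nodes are isolated, and [Z] the product
   of [rho] and the conditional probability, given the nodes, that an additional
   uniform point is not connected to any of them.  By Mecke's formula,
   [(k + 1) p_(k + 1)] is the mean of [Z] on the event that [k] nodes are isolated.
   Hence [(k + 1) p_(k + 1) - lambda p_k] is small, where [lambda] is the mean of
   [Z], as soon as the variance of [Z] is small, and a sequence with [p_(k + 1)]
   asymptotic to [lambda p_k / (k + 1)] that does not lose mass is asymptotically
   Poisson.

   We have [lambda = rho exp (- rho c)], where [c] is the integral of the
   connection function over the torus, and the decay of [g] is exactly what makes
   [rho c - ln rho - b] vanish in the limit.  For the variance, the monotonicity of
   [g] in each coordinate gives a lower bound, proportional to the distance, for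
   the area reached from only one of two given points. *)

(** * Inhomogeneous random graphs *)

Section random_graphs.
Context {R : realType}.

(** The edges are conditioned on the ordered list of nodes, while only the counts of the nodes have
    a known law. Given the positions, the probability of [k] isolated nodes is a symmetric function
    of them; this symmetry is the bridge to independent points, so finite graphs and their
    relabellings come before any probability on positions.

    Concentration of [Z] suffices because that conditional probability lies in [0, 1]: the Stein
    error is at most the mean of [|Z - lambda|]. Let [J] be the probability that a uniform point is
    connected to both of two independent uniform points. The variance of [Z] is [lambda ^+ 2] times
    the mean of [expR (rho * J) - 1], and the obstacle is that [rho * J] can be as large as
    [rho * c], which is about [ln rho]. Two identities defeat it: [lambda * expR (rho * c) = rho],
    and [J] has mean exactly [c ^+ 2]. Pairs with [J <= c - kappa] then contribute at most [lambda *
    (rho * c) ^+ 2 * expR (- rho * kappa)]. It is enough that [rho * kappa] outgrows [ln (ln rho)];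
    this is why a bound on [kappa] linear in the distance is sufficient for an arbitrary monotone
    [g]. *)

Definition simple_graph n (e : {ffun 'I_n * 'I_n -> bool}) : bool :=
  [forall i, forall j, e (i, j) == e (j, i)] && [forall i, ~~ e (i, i)].

(** Only the entries with [i < j] are read. A simple graph is determined by them, so on simple
    graphs this is the probability of the graph. *)
Definition graph_weight n (q : 'I_n -> 'I_n -> R)
    (e : {ffun 'I_n * 'I_n -> bool}) : R :=
  \prod_(j < n) \prod_(i < n | (i < j)%N) bernoulli_pmf (q i j) (e (i, j)).

Definition isolated_vertex n (e : {ffun 'I_n * 'I_n -> bool}) (i : 'I_n) :=
  [forall j, (j != i) ==> ~~ e (i, j)].

Definition nb_isolated_vertices n (e : {ffun 'I_n * 'I_n -> bool}) : nat :=
  #|[set i | isolated_vertex e i]%SET|.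

Definition isolated_prob n (q : 'I_n -> 'I_n -> R) (k : nat) : R :=
  \sum_(e | simple_graph e && (nb_isolated_vertices e == k)) graph_weight q e.

Definition isolated_prob_at n (q : 'I_n -> 'I_n -> R) (k : nat) (i : 'I_n) : R :=
  \sum_(e | [&& simple_graph e, nb_isolated_vertices e == k
              & isolated_vertex e i]) graph_weight q e.

Lemma simple_graphP n (e : {ffun 'I_n * 'I_n -> bool}) :
  reflect ((forall i j, e (i, j) = e (j, i)) /\ (forall i, e (i, i) = false))
          (simple_graph e).
Proof.
apply: (iffP andP) => [[/forallP es /forallP ei]|[es ei]]; split.
- by move=> i j; have /forallP/(_ j)/eqP := es i.
- by move=> i; apply/negbTE/ei.
- by apply/forallP => i; apply/forallP => j; rewrite es.
- by apply/forallP => i; rewrite ei.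
Qed.

Lemma graph_weight_ge0 n (q : 'I_n -> 'I_n -> R) e :
  (forall i j, 0 <= q i j <= 1) -> 0 <= graph_weight q e.
Proof.
by move=> q01; do 2 (apply: prodr_ge0 => ? _); apply: bernoulli_pmf_ge0.
Qed.

Lemma isolated_prob_ge0 n (q : 'I_n -> 'I_n -> R) k :
  (forall i j, 0 <= q i j <= 1) -> 0 <= isolated_prob q k.
Proof. by move=> q01; apply: sumr_ge0 => e _; exact: graph_weight_ge0. Qed.

(** A simple graph is determined by its entries above the diagonal. With the Dirac mass at [false]
    on the other entries, the weight becomes a product over all pairs, defined for every Boolean
    function and of total mass 1. *)
Lemma sum_graph_weight_le1 n (q : 'I_n -> 'I_n -> R) :
  (forall i j, 0 <= q i j <= 1) -> \sum_(e | simple_graph e) graph_weight q e <= 1.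
Proof.
move=> q01.
pose up (e : {ffun 'I_n * 'I_n -> bool}) :=
  [ffun p : 'I_n * 'I_n => (p.1 < p.2)%N && e p].
pose F (p : 'I_n * 'I_n) (b : bool) : R :=
  if (p.1 < p.2)%N then bernoulli_pmf (q p.1 p.2) b else (~~ b)%:R.
have F0 p b : 0 <= F p b.
  by rewrite /F; case: ifP => // _; exact: bernoulli_pmf_ge0.
have wE e : graph_weight q e = \prod_p F p (up e p).
  rewrite /graph_weight (exchange_big_dep xpredT)//= pair_big_dep/=.
  rewrite [LHS]big_mkcond/=; apply: eq_bigr => -[i j] _ /=.
  by rewrite /F /up ffunE /=; case: ifP => // ->.
under eq_bigr do rewrite wE.
rewrite -(big_imset (fun e : {ffun _ -> bool} => \prod_p F p (e p))) /=; last first.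
  move=> e f /simple_graphP[es ei] /simple_graphP[fs fi] /ffunP ef.
  apply/ffunP => -[i j].
  have [ij|ji|/val_inj ->] := ltngtP i j; last by rewrite ei fi.
  - by have := ef (i, j); rewrite !ffunE /= ij.
  - by have := ef (j, i); rewrite !ffunE /= ji es fs.
apply: (@le_trans _ _ (\sum_(e : {ffun 'I_n * 'I_n -> bool}) \prod_p F p (e p))).
  rewrite [leLHS]big_mkcond; apply: ler_sum => e _.
  by case: ifP => // _; exact: prodr_ge0.
rewrite -(bigA_distr_bigA F) big1// => p _.
rewrite big_bool /F /=; case: ifP => _; first by rewrite addrC subrK.
by rewrite add0r.
Qed.

(** A relabelling does not respect [i < j]. The square of the product runs over all ordered pairs of
    distinct indices, which are permuted, and nonnegativity then allows taking the root. *)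
Lemma prod_pair_sqr n (K : 'I_n -> 'I_n -> R) : (forall i j, K i j = K j i) ->
  (\prod_(j < n) \prod_(i < n | (i < j)%N) K i j) ^+ 2 =
  \prod_(j < n) \prod_(i < n | i != j) K i j.
Proof.
move=> Ks; rewrite expr2 {2}(exchange_big_dep xpredT)//= -big_split/=.
apply: eq_bigr => j _; rewrite (bigID (fun i : 'I_n => (i < j)%N) (fun i => i != j))/=.
congr (_ * _).
  by apply: eq_bigl => i; rewrite -val_eqE /=; case: ltngtP.
rewrite (eq_bigr (fun i => K i j)); last by move=> i _; rewrite Ks.
by apply: eq_bigl => i; rewrite -val_eqE /=; case: ltngtP.
Qed.

Lemma prod_pair_perm n (K : 'I_n -> 'I_n -> R) (s : {perm 'I_n}) :
  (forall i j, 0 <= K i j) -> (forall i j, K i j = K j i) ->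
  \prod_(j < n) \prod_(i < n | (i < j)%N) K (s i) (s j) =
  \prod_(j < n) \prod_(i < n | (i < j)%N) K i j.
Proof.
move=> K0 Ks; apply: (@pexpIrn _ 2) => //; rewrite ?nnegrE.
- by do 2 (apply: prodr_ge0 => ? _).
- by do 2 (apply: prodr_ge0 => ? _).
- rewrite !prod_pair_sqr// [RHS](reindex_inj (@perm_inj _ s))/=.
  apply: eq_bigr => j _; rewrite [RHS](reindex_inj (@perm_inj _ s))/=.
  by apply: eq_bigl => i; rewrite (inj_eq perm_inj).
Qed.

Definition relabel n (s : {perm 'I_n}) (e : {ffun 'I_n * 'I_n -> bool}) :=
  [ffun p : 'I_n * 'I_n => e (s p.1, s p.2)].

Lemma relabel_inj n (s : {perm 'I_n}) : injective (relabel s).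
Proof.
move=> e f /ffunP ef; apply/ffunP => -[i j].
by have := ef (s^-1 i, s^-1 j)%g; rewrite !ffunE /= !permKV.
Qed.

Lemma simple_graph_relabel n (s : {perm 'I_n}) e :
  simple_graph (relabel s e) = simple_graph e.
Proof.
apply/simple_graphP/simple_graphP => -[es ei]; split=> [i j|i].
- by have := es (s^-1 i)%g (s^-1 j)%g; rewrite !ffunE /= !permKV.
- by have := ei (s^-1 i)%g; rewrite !ffunE /= !permKV.
- by rewrite !ffunE es.
- by rewrite !ffunE ei.
Qed.

Lemma isolated_vertex_relabel n (s : {perm 'I_n}) e i :
  isolated_vertex (relabel s e) i = isolated_vertex e (s i).
Proof.
apply/forallP/forallP => He j.
- by have := He (s^-1 j)%g; rewrite ffunE /= permKV -(inj_eq (@perm_inj _ s)) permKV.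
- by have := He (s j); rewrite ffunE /= (inj_eq perm_inj).
Qed.

Lemma nb_isolated_vertices_relabel n (s : {perm 'I_n}) e :
  nb_isolated_vertices (relabel s e) = nb_isolated_vertices e.
Proof.
rewrite /nb_isolated_vertices -!sum1_card [RHS](reindex_inj (@perm_inj _ s))/=.
by apply: eq_bigl => i; rewrite !inE isolated_vertex_relabel.
Qed.

Lemma graph_weight_relabel n (s : {perm 'I_n}) (q : 'I_n -> 'I_n -> R) e :
  (forall i j, 0 <= q i j <= 1) -> (forall i j, q i j = q j i) ->
  simple_graph e ->
  graph_weight (fun i j => q (s i) (s j)) (relabel s e) = graph_weight q e.
Proof.
move=> q01 qs /simple_graphP[es _].
pose K i j := bernoulli_pmf (q i j) (e (i, j)).
rewrite /graph_weight -(@prod_pair_perm n K s).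
- by apply: eq_bigr => j _; apply: eq_bigr => i _; rewrite ffunE.
- by move=> i j; exact: bernoulli_pmf_ge0.
- by move=> i j; rewrite /K qs es.
Qed.

Lemma isolated_prob_perm n (s : {perm 'I_n}) (q : 'I_n -> 'I_n -> R) k :
  (forall i j, 0 <= q i j <= 1) -> (forall i j, q i j = q j i) ->
  isolated_prob (fun i j => q (s i) (s j)) k = isolated_prob q k.
Proof.
move=> q01 qs; rewrite /isolated_prob (reindex_inj (@relabel_inj _ s))/=.
apply: eq_big => e; rewrite simple_graph_relabel nb_isolated_vertices_relabel//.
by move=> /andP[? _]; exact: graph_weight_relabel.
Qed.

Lemma isolated_prob_at_perm n (s : {perm 'I_n}) (q : 'I_n -> 'I_n -> R) k i :
  (forall i j, 0 <= q i j <= 1) -> (forall i j, q i j = q j i) ->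
  isolated_prob_at (fun i j => q (s i) (s j)) k i = isolated_prob_at q k (s i).
Proof.
move=> q01 qs; rewrite /isolated_prob_at (reindex_inj (@relabel_inj _ s))/=.
apply: eq_big => e; rewrite simple_graph_relabel nb_isolated_vertices_relabel
  isolated_vertex_relabel//.
by move=> /and3P[? _ _]; exact: graph_weight_relabel.
Qed.

(** Double counting of the pairs formed by a graph with [k] isolated vertices and one of these
    vertices. *)
Lemma sum_isolated_prob_at n (q : 'I_n -> 'I_n -> R) k :
  \sum_i isolated_prob_at q k i = isolated_prob q k *+ k.
Proof.
rewrite /isolated_prob_at /isolated_prob.
under eq_bigr do rewrite (eq_bigl _ _ (fun e => andbA _ _ _)) big_mkcondr/=.
rewrite exchange_big /= -sumrMnl.
apply: eq_bigr => e /andP[_ /eqP <-].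
rewrite -big_mkcond/= sumr_const /nb_isolated_vertices; congr (_ *+ _).
by apply: eq_card => i; rewrite inE.
Qed.

Lemma sum_isolated_prob_le1 n (q : 'I_n -> 'I_n -> R) N :
  (forall i j, 0 <= q i j <= 1) -> \sum_(k < N) isolated_prob q k <= 1.
Proof.
move=> q01; apply: le_trans (sum_graph_weight_le1 q01).
rewrite /isolated_prob.
under eq_bigr do rewrite big_mkcondr/=.
rewrite exchange_big /=; apply: ler_sum => e _.
have [eN|eN] := ltnP (nb_isolated_vertices e) N.
  rewrite (bigD1 (Ordinal eN))//= eqxx big1 ?addr0// => i.
  by rewrite -val_eqE /= eq_sym => /negbTE ->.
rewrite big1 ?graph_weight_ge0// => i _.
by rewrite (gtn_eqF (leq_trans (ltn_ord i) eN)).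
Qed.

Definition add_isolated n (e : {ffun 'I_n * 'I_n -> bool})
    : {ffun 'I_n.+1 * 'I_n.+1 -> bool} :=
  [ffun p : 'I_n.+1 * 'I_n.+1 =>
    if unlift ord0 p.1 is Some i then
      if unlift ord0 p.2 is Some j then e (i, j) else false
    else false : bool].

Definition drop_vertex0 n (e : {ffun 'I_n.+1 * 'I_n.+1 -> bool}) :=
  [ffun p : 'I_n * 'I_n => e (lift ord0 p.1, lift ord0 p.2)].

Lemma add_isolatedK n : cancel (@add_isolated n) (@drop_vertex0 n).
Proof. by move=> e; apply/ffunP => -[i j]; rewrite !ffunE /= !liftK. Qed.

Lemma drop_vertex0K n (e : {ffun 'I_n.+1 * 'I_n.+1 -> bool}) :
  simple_graph e -> isolated_vertex e ord0 -> add_isolated (drop_vertex0 e) = e.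
Proof.
move=> /simple_graphP[es ei] /forallP e0; apply/ffunP => -[i j]; rewrite ffunE /=.
have e0F k : e (ord0, k) = false.
  by have [->|k0] := eqVneq k ord0; rewrite ?ei//; have := e0 k; rewrite k0 => /negbTE.
case: unliftP => [i' ->|->]; last by rewrite e0F.
by case: unliftP => [j' ->|->]; rewrite ?ffunE// es e0F.
Qed.

Lemma simple_graph_add_isolated n (e : {ffun 'I_n * 'I_n -> bool}) :
  simple_graph (add_isolated e) = simple_graph e.
Proof.
apply/simple_graphP/simple_graphP => -[es ei]; split=> [i j|i].
- by have := es (lift ord0 i) (lift ord0 j); rewrite !ffunE /= !liftK.
- by have := ei (lift ord0 i); rewrite !ffunE /= !liftK.
- by rewrite !ffunE /=; do 2 case: unliftP => //= *; rewrite es.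
- by rewrite !ffunE /=; case: unliftP => //= *; rewrite ei.
Qed.

Lemma isolated_vertex_add0 n (e : {ffun 'I_n * 'I_n -> bool}) :
  isolated_vertex (add_isolated e) ord0.
Proof. by apply/forallP => j; rewrite ffunE /= unlift_none implybT. Qed.

Lemma isolated_vertex_add n (e : {ffun 'I_n * 'I_n -> bool}) i :
  isolated_vertex (add_isolated e) (lift ord0 i) = isolated_vertex e i.
Proof.
apply/forallP/forallP => He j.
- by have := He (lift ord0 j); rewrite ffunE /= !liftK (inj_eq lift_inj).
- rewrite ffunE /= liftK; case: unliftP => [j' ->|->]; last by rewrite implybT.
  by have := He j'; rewrite (inj_eq lift_inj).
Qed.

Lemma nb_isolated_vertices_add n (e : {ffun 'I_n * 'I_n -> bool}) :
  nb_isolated_vertices (add_isolated e) = (nb_isolated_vertices e).+1.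
Proof.
rewrite /nb_isolated_vertices -!sum1_card big_mkcond big_ord_recl /= [in RHS]big_mkcond /=.
rewrite inE isolated_vertex_add0 add1n; congr _.+1.
by apply: eq_bigr => i _; rewrite !inE isolated_vertex_add.
Qed.

Lemma graph_weight_add n (q : 'I_n.+1 -> 'I_n.+1 -> R) e :
  graph_weight q (add_isolated e) =
  (\prod_(i < n) (1 - q ord0 (lift ord0 i))) *
  graph_weight (fun i j => q (lift ord0 i) (lift ord0 j)) e.
Proof.
rewrite /graph_weight big_ord_recl big1 ?mul1r//.
rewrite -big_split /=; apply: eq_bigr => j _.
rewrite big_mkcond big_ord_recl /= ffunE /= unlift_none; congr (_ * _).
rewrite -big_mkcond /=; apply: eq_big => [i|i _]; rewrite ?ltnS//.
by rewrite ffunE /= !liftK.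
Qed.

(** Deleting an isolated vertex 0 is a bijection onto the graphs on the other vertices and leaves
    their isolation unchanged; the product is the probability that vertex 0 has no edge. *)
Lemma isolated_prob_at0 n (q : 'I_n.+1 -> 'I_n.+1 -> R) k :
  isolated_prob_at q k.+1 ord0 =
  (\prod_(i < n) (1 - q ord0 (lift ord0 i))) *
  isolated_prob (fun i j => q (lift ord0 i) (lift ord0 j)) k.
Proof.
rewrite /isolated_prob_at /isolated_prob.
rewrite (reindex_onto (@add_isolated n) (@drop_vertex0 n)) /=; last first.
  by move=> e /and3P[? _ ?]; exact: drop_vertex0K.
rewrite mulr_sumr; apply: eq_big => [e|e _]; last exact: graph_weight_add.
by rewrite simple_graph_add_isolated nb_isolated_vertices_add eqSS
  isolated_vertex_add0 andbT add_isolatedK eqxx andbT.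
Qed.

Lemma isolated_prob_large n (q : 'I_n -> 'I_n -> R) k :
  (n < k)%N -> isolated_prob q k = 0.
Proof.
move=> nk; apply: big_pred0 => e; rewrite (_ : (_ == k) = false) ?andbF//.
apply/negbTE; rewrite neq_ltn (leq_ltn_trans _ nk)//.
by rewrite /nb_isolated_vertices (leq_trans (max_card _))// card_ord.
Qed.

End random_graphs.

(** * Symmetric functions of a Poisson process *)

Section power_probability.
Context d (A : measurableType d) (R : realType) (U : probability A R).
Local Open Scope ereal_scope.

Definition tcons n (p : A * n.-tuple A) : n.+1.-tuple A :=
  [tuple of p.1 :: p.2].

Lemma measurable_tcons n : measurable_fun setT (@tcons n).
Proof. exact: measurable_cons. Qed.

HB.instance Definition _ n :=
  isMeasurableFun.Build _ _ _ _ (@tcons n) (@measurable_tcons n).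

(** The law of [n] independent points, built as an image of binary products so that Tonelli's
    theorem peels off the first point. *)
Fixpoint power_prob n : probability (n.-tuple A) R :=
  match n with
  | 0%N => \d_([tuple] : 0.-tuple A)
  | n'.+1 => distribution (U \x power_prob n') (@tcons n')
  end.

Definition box n (B : 'I_n -> set A) : set (n.-tuple A) :=
  [set t | forall i, B i (tnth t i)].

Lemma measurable_box n (B : 'I_n -> set A) :
  (forall i, measurable (B i)) -> measurable (box B).
Proof.
move=> mB; rewrite (_ : box B = \bigcap_(i in setT) ((@tnth _ A)^~ i @^-1` B i)).
  apply: fin_bigcap_measurable => // i _.
  by rewrite -[X in measurable X]setTI; exact: measurable_tnth.
by apply/seteqP; split => [t tB i _|t tB i]; [exact: tB|exact: (tB i I)].
Qed.

(** Boxes are stable under intersection and contain the whole space. They generate the sigma-algebra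
    of tuples, since a cylinder over one coordinate is a box whose other sides are full. *)
Lemma box_measure_unique n (m1 m2 : {measure set (n.-tuple A) -> \bar R}) :
  m1 setT < +oo ->
  (forall B : 'I_n -> set A, (forall i, measurable (B i)) -> m1 (box B) = m2 (box B)) ->
  forall E, measurable E -> m1 E = m2 E.
Proof.
move=> m1oo m12 E mE.
pose G : set (set (n.-tuple A)) :=
  [set X | exists2 B : 'I_n -> set A, (forall i, measurable (B i)) & X = box B].
have boxT : box (fun _ : 'I_n => setT) = setT by apply/seteqP.
apply: (measure_unique G (fun=> setT)) => //.
- apply/seteqP; split.
  + apply: smallest_sub; first exact: smallest_sigma_algebra.
    apply: (big_ind (fun X => X `<=` <<s G >>)) => //.
      by move=> X Y XG YG; rewrite subUset.
    move=> i _ _ [B mB <-]; rewrite setTI; apply: sub_sigma_algebra.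
    exists (fun j => if j == i then B else setT); first by move=> j; case: ifP.
    apply/seteqP; split => t /=; first by move=> tB j; case: eqP => // ->.
    by move/(_ i); rewrite eqxx.
  + apply: smallest_sub; first exact: sigma_algebra_measurable.
    by move=> _ [B mB ->]; exact: measurable_box.
- move=> _ _ [B mB ->] [C mC ->]; exists (fun i => B i `&` C i).
    by move=> i; exact: measurableI.
  apply/seteqP; split => t.
    by move=> [tB tC] i; split; [exact: tB|exact: tC].
  by move=> tBC; split => i; have [] := tBC i.
- by move=> _; exists (fun=> setT).
- by rewrite bigcup_const.
- by move=> _ [B mB ->]; exact: m12.
Qed.

Lemma integral_power0 (F : 0.-tuple A -> \bar R) :
  measurable_fun [set: 0.-tuple A] F ->
  \int[power_prob 0]_t F t = F [tuple].
Proof. by move=> mF /=; rewrite integral_dirac// diracT mul1e. Qed.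

Lemma integral_powerS n (F : n.+1.-tuple A -> \bar R) :
  measurable_fun [set: n.+1.-tuple A] F -> (forall t, 0 <= F t) ->
  \int[power_prob n.+1]_t F t =
  \int[U]_x \int[power_prob n]_t F (tcons (x, t)).
Proof.
move=> mF F0; rewrite /= ge0_integral_distribution//.
rewrite fubini_tonelli1//; last by move=> x; exact: F0.
exact: measurableT_comp.
Qed.

Lemma integral_powerS_swap n (F : n.+1.-tuple A -> \bar R) :
  measurable_fun [set: n.+1.-tuple A] F -> (forall t, 0 <= F t) ->
  \int[power_prob n.+1]_t F t =
  \int[power_prob n]_t \int[U]_x F (tcons (x, t)).
Proof.
move=> mF F0; rewrite /= ge0_integral_distribution//.
rewrite fubini_tonelli2//; last by move=> x; exact: F0.
exact: measurableT_comp.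
Qed.

Lemma power_prob_box n (B : 'I_n -> set A) : (forall i, measurable (B i)) ->
  power_prob n (box B) = \prod_(i < n) U (B i).
Proof.
elim: n B => [|n IH] B mB.
  rewrite big_ord0 /= (_ : box B = setT) ?diracT//.
  by apply/seteqP; split => // t _ [].
rewrite /= /distribution /pushforward /= big_ord_recl -IH//.
rewrite -product_measure1E//; last exact: measurable_box.
congr (_ _); apply/seteqP; split => -[x t] /=.
  move=> tB; split => [|i]; first by have := tB ord0.
  by have := tB (lift ord0 i); rewrite tnthS.
move=> [xB tB] i; case: (unliftP ord0 i) => [j ->|->]; last exact: xB.
by rewrite tnthS; exact: tB.
Qed.

Lemma integral_power_prod n (u : A -> R) : measurable_fun setT u ->
  (forall x, 0 <= u x <= 1)%R ->
  \int[power_prob n]_t (\prod_(i < n) u (tnth t i))%:E =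
  (\int[U]_x (u x)%:E) ^+ n.
Proof.
move=> mu u01; have u0 x : (0 <= u x)%R by have /andP[] := u01 x.
have mprod k : measurable_fun [set: k.-tuple A]
    (fun t => (\prod_(i < k) u (tnth t i))%:E).
  apply/measurable_EFinP; apply: measurable_prod => i _.
  exact: (measurableT_comp mu (measurable_tnth i)).
have prod0 k (t : k.-tuple A) : 0 <= (\prod_(i < k) u (tnth t i))%:E.
  by rewrite lee_fin prodr_ge0.
elim: n => [|n IH]; first by rewrite integral_power0// big_ord0 expe0.
rewrite integral_powerS// expeS -IH.
transitivity (\int[U]_x ((u x)%:E *
    \int[power_prob n]_t (\prod_(i < n) u (tnth t i))%:E)).
  apply: eq_integral => x xU.
  rewrite -(@ge0_integralZl _ _ _ (power_prob n) _ measurableT _ (mprod n)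
    (u x)%:E (fun t _ => prod0 n t)) ?lee_fin//.
  apply: eq_integral => t tU; rewrite big_ord_recl EFinM; congr (_ * _%:E).
  by apply: eq_bigr => i _; rewrite tnthS.
rewrite ge0_integralZr//.
- exact/measurable_EFinP.
- by move=> x _; rewrite lee_fin.
- exact: integral_ge0.
Qed.

Definition permute_tuple n (s : {perm 'I_n}) (t : n.-tuple A) : n.-tuple A :=
  [tuple tnth t (s i) | i < n].

Lemma measurable_permute_tuple n s : measurable_fun setT (@permute_tuple n s).
Proof.
apply/measurable_fun_tnthP => i.
rewrite (_ : _ \o _ = (@tnth n A)^~ (s i)); first exact: measurable_tnth.
by apply/funext => t /=; rewrite tnth_mktuple.
Qed.

HB.instance Definition _ n s :=
  isMeasurableFun.Build _ _ _ _ (@permute_tuple n s) (@measurable_permute_tuple n s).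

Lemma integral_power_permute n (s : {perm 'I_n}) (F : n.-tuple A -> \bar R) :
  measurable_fun [set: n.-tuple A] F -> (forall t, 0 <= F t) ->
  \int[power_prob n]_t F (permute_tuple s t) = \int[power_prob n]_t F t.
Proof.
move=> mF F0.
have : \int[distribution (power_prob n) (@permute_tuple n s)]_t F t =
       \int[power_prob n]_t F t.
  apply: eq_measure_integral => E mE _; apply: box_measure_unique => //.
    by rewrite /= /distribution /pushforward preimage_setT probability_setT ltry.
  move=> B mB; rewrite /= /distribution /pushforward.
  rewrite (_ : _ @^-1` _ = box (fun i => B (s^-1 i)%g)).
    rewrite !power_prob_box// [RHS](reindex_inj (@perm_inj _ s^-1%g))//.
  apply/seteqP; split => t /= tB i.
    by have := tB (s^-1 i)%g; rewrite tnth_mktuple permKV.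
  by rewrite tnth_mktuple; have := tB (s i); rewrite permK.
by rewrite ge0_integral_distribution.
Qed.

End power_probability.

(** * Polarization of sums over permutations *)

Section permanents.
Context {K : comNzRingType}.

(** Inclusion-exclusion, read off the expansion of a product whose factors are 1 on [D] and [1 - 1]
    outside [D]. *)
Lemma sum_superset_sign n (D : {set 'I_n}) :
  \sum_(S : {set 'I_n} | D \subset S) (-1) ^+ #|~: S| = (D == [set: 'I_n]%SET)%:R :> K.
Proof.
transitivity (\prod_i (1 + (if i \in D then 0 else -1)) : K).
  rewrite bigA_distr big_mkcond /=; apply: eq_bigr => S _.
  case: ifPn => [DS|].
    rewrite (bigID (mem S))/= big1 ?mul1r; last by move=> i ->.
    rewrite (eq_bigr (fun=> -1)) => [|i /negbTE iS].
      by rewrite prodr_const; congr (_ ^+ _); apply: eq_card => i; rewrite !inE.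
    by rewrite iS; case: ifPn => // /(fintype.subsetP DS); rewrite iS.
  move=> /fintype.subsetPn[i iD iS]; rewrite (bigD1 i)//= (negbTE iS) iD.
  by rewrite mul0r.
have [->|/eqP/setP Dn] := eqVneq D [set: 'I_n]%SET.
  by rewrite big1// => i _; rewrite inE addr0.
have [i iD] : exists i, i \notin D.
  apply/existsP; apply: contra_notT Dn; rewrite negb_exists => /forallP Dall i.
  by rewrite inE; apply: negbNE.
by rewrite (bigD1 i)//= (negbTE iD) subrr mul0r.
Qed.

(* Ryser's formula for the permanent of [a]. *)
Lemma permanent_polarization n (a : 'I_n -> 'I_n -> K) :
  \sum_(s : {perm 'I_n}) \prod_j a (s j) j =
  \sum_(S : {set 'I_n}) (-1) ^+ #|~: S| * \prod_j \sum_(i in S) a i j.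
Proof.
under [RHS]eq_bigr do rewrite bigA_distr_big mulr_sumr.
rewrite (exchange_big_dep xpredT)//=.
transitivity (\sum_(f : {ffun 'I_n -> 'I_n})
    ([set f i | i in 'I_n]%SET == [set: 'I_n]%SET)%:R * \prod_j a (f j) j); last first.
  apply: eq_bigr => f _; rewrite -mulr_suml -sum_superset_sign; congr (_ * _).
  apply: eq_bigl => S; apply/fintype.subsetP/ffun_onP => [fS i|fS _ /imsetP[i _ ->]].
    by apply: fS; exact: imset_f.
  exact: fS.
have surjE (f : {ffun 'I_n -> 'I_n}) :
    ([set f i | i in 'I_n]%SET == [set: 'I_n]%SET) = injectiveb f.
  rewrite eqEcard finset.subsetT /= cardsT card_ord; apply/idP/injectiveP => [fn|fi].
    suff /imset_injP fi : #|[set f i | i in 'I_n]%SET| == #|'I_n|.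
      by move=> i j; exact: fi.
    by rewrite eqn_leq leq_imset_card card_ord.
  by rewrite card_imset// card_ord.
under [RHS]eq_bigr do rewrite surjE.
rewrite (bigID (fun f : {ffun 'I_n -> 'I_n} => injectiveb f))/= [X in _ + X]big1.
  rewrite addr0 [RHS](reindex (@pval _))/=; last first.
    pose in_Sn := insubd (1%g : {perm 'I_n}).
    by exists in_Sn => /= f Uf; first apply: val_inj; apply: insubdK.
  apply: eq_big => s; first by rewrite (valP s).
  by move=> _; rewrite (valP s) mul1r; apply: eq_bigr => i _; rewrite pvalE.
by move=> f /negbTE ->; rewrite mul0r.
Qed.
End permanents.

(** * The multinomial theorem, divided by a factorial *)

Section multinomial.
Context {K : numFieldType}.

(** Both sides are the coefficient of degree [n] in the product of the exponential series of the
    [c i * 'X]. Truncating the series after degree [n] does not affect this coefficient and keeps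
    the multi-indices in a finite type. *)
Lemma sum_multinomial (I : finType) (c : I -> K) n :
  \sum_(m : {ffun I -> 'I_n.+1} | (\sum_i m i)%N == n)
     \prod_i (c i ^+ m i / (m i)`!%:R) = (\sum_i c i) ^+ n / n`!%:R.
Proof.
pose E x : {poly K} := \poly_(i < n.+1) (x ^+ i / i`!%:R).
have coefE i : (i <= n)%N ->
    (\prod_k E (c k))`_i = (\sum_k c k) ^+ i / i`!%:R.
  apply: (big_ind2 (fun (p : {poly K}) x => forall j, (j <= n)%N ->
     p`_j = x ^+ j / j`!%:R)).
  - by move=> [_|j _]; rewrite coef1 ?expr0 ?divr1// expr0n mul0r.
  - move=> p x q y px qy j jn; rewrite coefM exprDn mulr_suml.
    rewrite (reindex_inj rev_ord_inj)/=; apply: eq_bigr => k _.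
    have kj : (k <= j)%N by rewrite -ltnS.
    rewrite subSS subKn// px ?(leq_trans (leq_subr _ _))// qy ?(leq_trans kj)//.
    rewrite -mulr_natr -(bin_fact kj) !natrM.
    have f0 l : l`!%:R != 0 :> K by rewrite pnatr_eq0 -lt0n fact_gt0.
    have b0 : 'C(j, k)%:R != 0 :> K by rewrite pnatr_eq0 -lt0n bin_gt0.
    have := f0 k; have := f0 (j - k)%N; move: b0; set u := _%:R; set v := _%:R; set w := _%:R.
    by move=> u0 v0 w0; field; rewrite u0 v0 w0.
  - by move=> k _ j jn; rewrite coef_poly ltnS jn.
rewrite -coefE//.
under eq_bigr do rewrite /E poly_def.
rewrite bigA_distr_bigA coef_sum big_mkcond /=; apply: eq_bigr => m _.
rewrite (_ : \prod_k _ = (\prod_k (c k ^+ m k / (m k)`!%:R)) *: 'X^(\sum_k m k)).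
  by rewrite coefZ coefXn eq_sym; case: eqP; rewrite ?mulr1 ?mulr0.
rewrite (eq_bigr (fun k => (c k ^+ m k / (m k)`!%:R)%:P * 'X^(m k))); last first.
  by move=> k _; rewrite mul_polyC.
by rewrite big_split/= -rmorph_prod prodrXr mul_polyC.
Qed.
End multinomial.

Section integral_mrestr.
Context d (T : measurableType d) (R : realType) (mu : {measure set T -> \bar R})
  (D : set T) (mD : measurable D).

Lemma ge0_integral_mrestr (f : T -> \bar R) : measurable_fun setT f ->
  (forall x, 0 <= f x)%E ->
  (\int[mrestr mu mD]_x f x = \int[mu]_(x in D) f x)%E.
Proof.
move=> mf f0.
rewrite (@ge0_negligible_integral _ _ _ _ setT (~` D))//; last 2 first.
- exact: measurableC.
- by rewrite /= /mrestr setICl measure0.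
rewrite setTD setCK; apply: eq_measure_integral => A mA AD.
by rewrite /= /mrestr setIidl.
Qed.
End integral_mrestr.

Section finite_partition.
Context d (T : measurableType d) (R : realType) (mu : {measure set T -> \bar R}).

Lemma measure_fin_partition (I : finType) (Q : pred I) (A : I -> set T) :
  (forall i, measurable (A i)) -> (forall i j w, A i w -> A j w -> i = j) ->
  mu [set w | exists2 i, Q i & A i w] = (\sum_(i | Q i) mu (A i))%E.
Proof.
move=> mA Adisj; rewrite (_ : mkset _ = \bigcup_(i in [set` Q]) A i); last first.
  by apply/seteqP; split => w /= [i Qi Aiw]; exists i.
rewrite measure_fin_bigcup//.
- rewrite -(@bigfs _ _ _ _ (index_enum I))//; first exact: index_enum_uniq.
  by move=> i _; rewrite mem_index_enum.
- move=> i j _ _ [w []]; exact: Adisj.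
Qed.
End finite_partition.

(** * The uniform law on the torus *)

Section uniform_torus.
Context {R : realType}.
Local Notation plane := (measurableTypeR R * measurableTypeR R)%type.

Definition period : set (measurableTypeR R) := `[- 2^-1, 2^-1[%classic.

Lemma measurable_period : measurable period.
Proof. exact: measurable_itv. Qed.

Definition unif1 : set (measurableTypeR R) -> \bar R :=
  mrestr lebesgue_measure measurable_period.

HB.instance Definition _ := Measure.on unif1.

Let unif1_setT : unif1 setT = 1%E.
Proof.
rewrite /unif1 /mrestr setTI /period lebesgue_measure_itv/= lte_fin.
by rewrite -EFinD ifT; [congr EFin|]; lra.
Qed.

HB.instance Definition _ := Measure_isProbability.Build _ _ _ unif1 unif1_setT.

Definition unif : probability plane R := (unif1 \x unif1)%E.

Lemma measurable_torus : measurable (@torus R : set plane).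
Proof. by apply: measurableX; exact: measurable_itv. Qed.

Lemma unifE (B : set plane) : measurable B -> unif B = leb2 (B `&` torus).
Proof.
move=> mB; rewrite /unif.
apply: (@product_measure_unique _ _ _ _ R unif1 unif1
  (mrestr leb2 measurable_torus) _ B mB) => A1 A2 mA1 mA2.
rewrite /= /mrestr /torus -setXI /leb2 product_measure1E//;
  exact: measurableI.
Qed.

Lemma unif_sub_torus (B : set plane) : measurable B -> B `<=` torus ->
  unif B = leb2 B.
Proof. by move=> mB Bt; rewrite unifE// setIidl. Qed.

Lemma integral_unif1 (f : plane -> \bar R) : measurable_fun setT f ->
  (forall x, 0 <= f x)%E ->
  (\int[unif]_x f x = \int[unif1]_u \int[unif1]_v f (u, v))%E.
Proof. by move=> mf f0; rewrite /unif fubini_tonelli1. Qed.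

Lemma integral_unif2 (f : plane -> \bar R) : measurable_fun setT f ->
  (forall x, 0 <= f x)%E ->
  (\int[unif]_x f x = \int[unif1]_v \int[unif1]_u f (u, v))%E.
Proof. by move=> mf f0; rewrite /unif fubini_tonelli2. Qed.
End uniform_torus.
Global Opaque unif.

(** * From the counts of the process to the symmetrized law of its nodes *)

Section poisson_process.
Context {R : realType} d (T : measurableType d) (P : probability T R).
Local Notation plane := (measurableTypeR R * measurableTypeR R)%type.
Variables (rho : R) (X : T -> seq (R * R)).
Hypotheses (rho_gt0 : 0 < rho) (PX : is_poisson_process P rho X).

Definition size_event n : set T := [set w | size (X w) = n].

Lemma measurable_node_event i (B : set plane) :
  measurable B -> measurable (node_event X i B).
Proof. by have [+ _ _ _] := PX; exact. Qed.

Lemma size_gtE i : [set w | (i < size (X w))%N] = node_event X i setT.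
Proof. by apply/seteqP; split => w /=; rewrite /node_event /=; tauto. Qed.

Lemma measurable_size_event n : measurable (size_event n).
Proof.
have mgt i : measurable [set w | (i < size (X w))%N].
  by rewrite size_gtE; exact: measurable_node_event.
rewrite (_ : size_event n = [set w | (n <= size (X w))%N] `\` [set w | (n < size (X w))%N]).
  apply: measurableD => //; case: n => [|n]; last exact: mgt.
  by rewrite (_ : mkset _ = setT)//; apply/seteqP.
apply/seteqP; split => w; rewrite /size_event /=; first by move=> ->; rewrite ltnn.
by move=> [nX /negP]; rewrite -leqNgt => Xn; apply/eqP; rewrite eqn_leq Xn.
Qed.

Definition node_tuple n (w : T) : n.-tuple plane :=
  [tuple nth (0 : R * R) (X w) i | i < n].

Lemma measurable_node i : measurable_fun setT (fun w => nth (0 : R * R) (X w) i : plane).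
Proof.
move=> _ B mB; rewrite setTI.
rewrite (_ : _ @^-1` B = node_event X i B `|`
    ([set w | B (0 : R * R)] `\` [set w | (i < size (X w))%N])).
  apply: measurableU; first exact: measurable_node_event.
  apply: measurableD; last by rewrite size_gtE; exact: measurable_node_event.
  by have [B0|B0] := pselect (B (0 : R * R)); [rewrite (_ : mkset _ = setT)|
    rewrite (_ : mkset _ = set0)] => //; apply/seteqP; split.
apply/seteqP; split => w /=.
  have [Xi|Xi] := ltnP i (size (X w)); first by left.
  by rewrite nth_default// => B0; right; split=> //; rewrite ltnNge Xi.
by move=> [[]//|[B0 /negP]]; rewrite -leqNgt => Xi; rewrite nth_default.
Qed.

Lemma measurable_node_tuple n : measurable_fun setT (node_tuple n).
Proof.
apply/measurable_fun_tnthP => i.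
rewrite (_ : _ \o _ = fun w => nth (0 : R * R) (X w) i : plane); last first.
  by apply/funext => w /=; rewrite tnth_mktuple.
exact: measurable_node.
Qed.

Section patterns.
Variables (K : finType) (pat : plane -> K).
Hypothesis mpat : forall k, measurable (pat @^-1` [set k]).

(** The law of the counts is given for subsets of the torus. The intersection loses no node, since
    all nodes lie there. *)
Definition cell k : set plane := (pat @^-1` [set k]) `&` torus.

Let mcell k : measurable (cell k).
Proof. exact: measurableI (mpat k) measurable_torus. Qed.

Let cell_torus k : cell k `<=` torus.
Proof. by move=> x []. Qed.

Let nb_cellE w k : nb_nodes X (cell k) w = count (fun x => pat x == k) (X w).
Proof.
have [_ Xt _ _] := PX.
apply: eq_in_count => x xX; apply/idP/idP => [/asboolP[/= -> _]//|/eqP xk].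
by apply/asboolP; split => //; exact: (Xt w).
Qed.

Lemma sum_nb_cell w : (\sum_k nb_nodes X (cell k) w)%N = size (X w).
Proof.
under eq_bigr do rewrite nb_cellE -sum1_count.
rewrite (exchange_big_dep xpredT)//= -[RHS]sum1_size; apply: eq_bigr => x _.
by rewrite (big_pred1 (pat x))// => k; rewrite eq_sym.
Qed.

Lemma prob_cell_counts (m : K -> nat) :
  P [set w | forall k, nb_nodes X (cell k) w = m k] =
  (\prod_k (expR (- (rho * fine (unif (cell k)))) *
           ((rho * fine (unif (cell k))) ^+ m k / (m k)`!%:R)))%:E.
Proof.
have [_ _ Xpois Xind] := PX.
have trivcell : trivIset setT (fun i : 'I_#|K| => cell (enum_val i)).
  apply/trivIsetP => i j _ _ ij; rewrite -subset0 => x [[/= xi _] [/= xj _]].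
  by move: ij; rewrite (enum_val_inj (etrans (esym xi) xj)) eqxx.
have := Xind #|K| (fun i => cell (enum_val i))
  (fun i => conj (mcell _) (@cell_torus _)) trivcell (fun i => [set m (enum_val i)]).
rewrite (_ : \bigcap_k _ = [set w | forall k, nb_nodes X (cell k) w = m k]); last first.
  apply/seteqP; split => w /= Hw; last by move=> i _; exact: Hw.
  by move=> k; have := Hw (enum_rank k) I; rewrite /= enum_rankK.
move=> ->; rewrite -(big_enum_val (fun k => P (nb_nodes X (cell k) @^-1` [set m k])))/=.
rewrite -prodEFin; apply: eq_big => // k _.
rewrite Xpois//= /poisson_prob -unif_sub_torus//.
have u0 : 0 <= fine (unif (cell k)) by exact: fine_ge0.
(* At rate 0, [poisson_prob] is the Dirac mass at 0; the formula agrees with it because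
   [0 ^+ 0 = 1]. *)
case: ifPn => [l0|].
  rewrite esum_set1 ?lee_fin ?poisson_pmf_ge0// /poisson_pmf l0.
  by congr EFin; rewrite mulrC.
rewrite -leNgt pmulr_rle0// => ule0.
have -> : fine (unif (cell k)) = 0 by apply/eqP; rewrite eq_le ule0.
rewrite mulr0 oppr0 expR0 mul1r diracE.
case: (m k) => [|j]; first by rewrite mem_set// expr0 divr1.
by rewrite memNset// expr0n mul0r.
Qed.

Definition pattern_event n (f : {ffun 'I_n -> K}) : set T :=
  size_event n `&` [set w | forall i : 'I_n, pat (nth 0 (X w) i) = f i].

Lemma measurable_pattern_event n (f : {ffun 'I_n -> K}) :
  measurable (pattern_event f).
Proof.
apply: measurableI; first exact: measurable_size_event.
rewrite (_ : mkset _ = \bigcap_(i in [set: 'I_n])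
    ((fun w => nth (0 : R * R) (X w) i : plane) @^-1` (pat @^-1` [set f i]))).
  apply: fin_bigcap_measurable => // i _.
  by rewrite -[X in measurable X]setTI; exact: measurable_node.
by apply/seteqP; split => w /= Hw i => [_|]; exact: Hw.
Qed.

Lemma pattern_event_disjoint n (f g : {ffun 'I_n -> K}) w :
  pattern_event f w -> pattern_event g w -> f = g.
Proof. by move=> [_ fw] [_ gw]; apply/ffunP => i; rewrite -fw -gw. Qed.

Lemma nb_cell_pattern n (f : {ffun 'I_n -> K}) w k : pattern_event f w ->
  nb_nodes X (cell k) w = #|[set i | f i == k]%SET|.
Proof.
move=> [sX fw]; rewrite nb_cellE -sum1_count -sum1_card.
rewrite (big_nth 0) big_mkord (sX : size _ = n) big_mkcond [RHS]big_mkcond/=.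
by apply: eq_bigr => i _; rewrite inE fw.
Qed.

Lemma sum_fine_unif_cell : \sum_k fine (unif (cell k)) = 1.
Proof.
rewrite -[RHS]/(fine 1%E) -(@probability_setT _ _ _ (@unif R)).
have -> : unif setT = unif (@torus R) :> \bar R.
  by rewrite unifE// setTI unif_sub_torus//; exact: measurable_torus.
have -> : @torus R = [set x | exists2 k, xpredT k & cell k x].
  by apply/seteqP; split => [x tx|x [k _ []]//]; exists (pat x).
rewrite measure_fin_partition//; last first.
  by move=> k l x [/= <- _] [/= <- _].
by rewrite -sum_fine// => k _; rewrite fin_num_measure.
Qed.

(** The probability of a single pattern depends on the arbitrary order of the list, but its weight
    [\prod_j c (f j)] depends only on how often each type occurs. Grouping the patterns by these
    multiplicities leaves events about the counts, and the multinomial theorem sums them. *)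
Lemma pattern_moment (c : K -> R) n :
  \sum_(f : {ffun 'I_n -> K}) fine (P (pattern_event f)) * \prod_j c (f j) =
  expR (- rho) * ((rho * \sum_k c k * fine (unif (cell k))) ^+ n / n`!%:R).
Proof.
pose mult (f : {ffun 'I_n -> K}) : {ffun K -> 'I_n.+1} :=
  [ffun k => inord #|[set i | f i == k]%SET|].
have multE f k : mult f k = #|[set i | f i == k]%SET| :> nat.
  by rewrite ffunE inordK// ltnS (leq_trans (max_card _))// card_ord.
have sum_mult f : (\sum_k mult f k)%N == n.
  under eq_bigr do rewrite multE -sum1_card.
  rewrite (exchange_big_dep xpredT)//= -[X in _ == X]card_ord -sum1_card; apply/eqP.
  by apply: eq_bigr => i _; rewrite (big_pred1 (f i))// => k; rewrite inE eq_sym.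
rewrite (partition_big mult (fun m : {ffun K -> 'I_n.+1} => \sum_k m k == n)%N)//=.
rewrite mulr_sumr -sum_multinomial mulr_sumr; apply: eq_bigr => m /eqP mn.
transitivity (\sum_(f | mult f == m) fine (P (pattern_event f)) * \prod_k c k ^+ m k).
  apply: eq_bigr => f /eqP <-; congr (_ * _).
  rewrite (partition_big f xpredT)//=; apply: eq_bigr => k _.
  rewrite (eq_bigr (fun=> c k)) => [|i /eqP ->//].
  by rewrite prodr_const multE; congr (_ ^+ _); apply: eq_card => i; rewrite inE.
rewrite -mulr_suml sum_fine => [|f _]; last first.
  by rewrite fin_num_measure//; exact: measurable_pattern_event.
rewrite -measure_fin_partition; last 2 first.
- exact: measurable_pattern_event.
- exact: pattern_event_disjoint.
rewrite [X in fine X](_ : _ =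
    P [set w | forall k, nb_nodes X (cell k) w = m k]); last first.
  apply: (congr1 P); apply/seteqP; split => w /=.
    by move=> [f /eqP <- fw k]; rewrite (nb_cell_pattern k fw) multE.
  move=> wm; have sX : size (X w) = n.
    by rewrite -sum_nb_cell -[RHS]mn; apply: eq_bigr => k _; rewrite wm.
  have fw : pattern_event [ffun i : 'I_n => pat (nth 0 (X w) i)] w.
    by split => // i; rewrite ffunE.
  exists [ffun i : 'I_n => pat (nth 0 (X w) i)] => //; apply/eqP/ffunP => k.
  by apply: val_inj; rewrite /= multE -(nb_cell_pattern k fw) wm.
rewrite (prob_cell_counts (fun k => m k))/= big_split /= mulrAC -!mulrA; congr (_ * _).
  rewrite -expR_sum; congr expR.
  by rewrite sumrN -mulr_sumr sum_fine_unif_cell mulr1.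
rewrite -big_split /=; apply: eq_bigr => k _.
by rewrite [LHS]mulrA -exprMn mulrCA.
Qed.

End patterns.

(** The sum over permutations turns the left side into a mean of permanents of the matrices
    [i \in f j]. Ryser's formula writes each permanent as a signed sum of products in which all
    nodes carry the same weight function, the case settled by [pattern_moment]. *)
Lemma box_moment n (B : 'I_n -> set plane) : (forall i, measurable (B i)) ->
  (\sum_(s : {perm 'I_n})
    P (size_event n `&` node_tuple n @^-1` box (fun j => B (s j))) =
  (expR (- rho) * rho ^+ n)%:E * power_prob unif n (box B))%E.
Proof.
move=> mB.
(* The type of a point records which of the sets [B i] contain it, so that membership of a tuple in
   a permuted box is read off its pattern. *)
pose pat (x : plane) : {set 'I_n} := [set i | `[< B i x >]]%SET.
have mpat k : measurable (pat @^-1` [set k]).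
  rewrite (_ : _ @^-1` _ =
      \bigcap_(i in [set: 'I_n]) (if i \in k then B i else ~` B i)).
    apply: fin_bigcap_measurable => // i _; case: ifP => // _.
    exact: measurableC.
  apply/seteqP; split => x /=.
    move=> <- i _; rewrite inE; case: asboolP => //.
  move=> xk; apply/setP => i; have := xk i I; rewrite inE.
  by case: ifP => _ /asboolP => [->//|Bi]; apply/negbTE/asboolPn/asboolP.
pose q (f : {ffun 'I_n -> {set 'I_n}}) := fine (P (pattern_event pat f)).
have qE f : P (pattern_event pat f) = (q f)%:E.
  rewrite /q fineK// fin_num_measure//; exact: measurable_pattern_event.
pose v i := fine (unif (B i)).
have evE s : P (size_event n `&` node_tuple n @^-1` box (fun j => B (s j))) =
    (\sum_f q f * \prod_j (s j \in f j)%:R)%:E :> \bar R.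
  rewrite (_ : _ `&` _ = [set w | exists2 f : {ffun 'I_n -> {set 'I_n}},
      [forall j, s j \in f j] & pattern_event pat f w]); last first.
    apply/seteqP; split => w /=.
      move=> [sX wB]; exists [ffun i : 'I_n => pat (nth 0 (X w) i)].
        apply/forallP => j; rewrite ffunE inE; apply/asboolP.
        by have := wB j; rewrite tnth_mktuple.
      by split => // i; rewrite ffunE.
    move=> [f /forallP sf [sX fw]]; split => // j.
    by have := sf j; rewrite -fw inE => /asboolP; rewrite tnth_mktuple.
  rewrite measure_fin_partition; last 2 first.
  - by move=> f; exact: measurable_pattern_event.
  - by move=> f g w; exact: pattern_event_disjoint.
  rewrite -sumEFin big_mkcond /=; apply: eq_bigr => f _.
  case: ifP => [/forallP sf|].
    by rewrite qE big1 ?mulr1// => j _; rewrite sf.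
  move/negbT; rewrite negb_forall => /existsP[j /negbTE sfj].
  by rewrite (bigD1 j)//= sfj mul0r mulr0.
under eq_bigr do rewrite evE.
rewrite sumEFin power_prob_box// (eq_bigr (fun i => (v i)%:E)); last first.
  by move=> i _; rewrite fineK// fin_num_measure.
rewrite prodEFin -EFinM; congr EFin.
rewrite exchange_big /=.
under eq_bigr => f _ do rewrite -mulr_sumr
  (permanent_polarization (fun i j => (i \in f j)%:R)) mulr_sumr.
rewrite exchange_big /=.
have cellE i : \sum_(k : {set 'I_n} | i \in k) fine (unif (cell pat k)) = v i.
  rewrite sum_fine => [|k _]; last first.
    by rewrite fin_num_measure//; exact: measurableI (mpat k) measurable_torus.
  rewrite -measure_fin_partition; last 2 first.
  - by move=> k; exact: measurableI (mpat k) measurable_torus.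
  - by move=> k l x [/= <- _] [/= <- _].
  rewrite /v [in RHS]unifE// -unif_sub_torus//; last first.
    exact: measurableI (mB i) measurable_torus.
  congr (fine (unif _)); apply/seteqP; split => x /=.
    by move=> [k + [xk xt]]; rewrite -xk inE => /asboolP.
  by move=> [xB xt]; exists (pat x) => //; rewrite inE; exact/asboolP.
transitivity (\sum_(S : {set 'I_n}) (-1) ^+ #|~: S|%SET *
    (expR (- rho) * ((rho * \sum_(i in S) v i) ^+ n / n`!%:R))).
  apply: eq_bigr => S _.
  under eq_bigr => f _ do rewrite mulrCA.
  rewrite -mulr_sumr; congr (_ * _).
  rewrite (pattern_moment mpat (fun k => \sum_(i in S) (i \in k)%:R) n).
  congr (_ * ((_ * _) ^+ _ / _)).
  under eq_bigr do rewrite mulr_suml.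
  rewrite exchange_big /=; apply: eq_bigr => i _.
  rewrite -cellE [RHS]big_mkcond; apply: eq_bigr => k _.
  by case: ifP; rewrite ?mul1r ?mul0r.
(* Polarization in the reverse direction, for a matrix with equal columns: its permanent is the
   product of the [v i] times the number of permutations. *)
have := permanent_polarization (fun i _ : 'I_n => v i).
rewrite (eq_bigr (fun=> \prod_i v i)) => [|s _]; last first.
  by rewrite [RHS](reindex_inj (@perm_inj _ s)).
rewrite sumr_const card_Sn.
under [in RHS]eq_bigr do rewrite prodr_const card_ord.
move=> vE.
transitivity (\sum_(S : {set 'I_n}) expR (- rho) * rho ^+ n / n`!%:R *
    ((-1) ^+ #|~: S|%SET * (\sum_(i in S) v i) ^+ n)).
  by apply: eq_bigr => S _; rewrite exprMn; ring.
have f0 : n`!%:R != 0 :> R by rewrite pnatr_eq0 -lt0n fact_gt0.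
by rewrite -mulr_sumr -vE -(mulr_natr (\prod_i v i)); field.
Qed.

End poisson_process.

Section image_measure.
Context d d' (T1 : measurableType d) (T2 : measurableType d') (R : realType)
  (mu : {measure set T1 -> \bar R}) (f : {mfun T1 >-> T2}).

Definition image_measure := pushforward mu f.

Let image_measure0 : image_measure set0 = 0%E.
Proof. exact: measure0. Qed.

Let image_measure_ge0 A : (0 <= image_measure A)%E.
Proof. exact: measure_ge0. Qed.

Let image_measure_sigma_additive : semi_sigma_additive image_measure.
Proof. exact: measure_semi_sigma_additive. Qed.

HB.instance Definition _ := isMeasure.Build _ _ _ image_measure
  image_measure0 image_measure_ge0 image_measure_sigma_additive.
End image_measure.

Section poisson_symmetric.
Context {R : realType} d (T : measurableType d) (P : probability T R).
Local Notation plane := (measurableTypeR R * measurableTypeR R)%type.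
Variables (rho : R) (X : T -> seq (R * R)).
Hypotheses (rho_gt0 : 0 < rho) (PX : is_poisson_process P rho X).

(** The sum of the laws of all shufflings of the nodes is known on boxes, hence everywhere. A
    symmetric [F] has the same integral against each of these [n]! laws, whence the denominator. *)
Lemma poisson_symmetric_integral n (F : n.-tuple plane -> \bar R) :
  measurable_fun [set: n.-tuple plane] F -> (forall t, 0 <= F t)%E ->
  (forall (s : {perm 'I_n}) t, F (permute_tuple s t) = F t) ->
  (\int[P]_(w in size_event X n) F (node_tuple X n w) =
   (expR (- rho) * rho ^+ n / n`!%:R)%:E * \int[power_prob unif n]_t F t)%E.
Proof.
move=> mF F0 Fs.
have mE := measurable_size_event PX n.
have mnt : measurable_fun setT (node_tuple X n).
  exact: (measurable_node_tuple PX).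
pose PE : {measure set T -> \bar R} := mrestr P mE.
pose perms := enum {perm 'I_n}.
pose shuf k w := permute_tuple (nth 1%g perms k) (node_tuple X n w).
have mshuf k : measurable_fun setT (shuf k).
  exact: (measurableT_comp (measurable_permute_tuple _) mnt).
pose shufm k : {mfun T >-> n.-tuple plane} :=
  HB.pack (shuf k) (isMeasurableFun.Build _ _ _ _ (shuf k) (mshuf k)).
pose nu k : {measure set (n.-tuple plane) -> \bar R} := image_measure PE (shufm k).
pose q : R := expR (- rho) * rho ^+ n.
have q0 : 0 <= q by rewrite mulr_ge0 ?expR_ge0 ?exprn_ge0 ?ltW.
pose m2 : {measure set (n.-tuple plane) -> \bar R} := mscale (NngNum q0) (power_prob unif n).
have m12 B : (forall i, measurable (B i)) -> msum nu #|{perm 'I_n}| (box B) = m2 (box B).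
  move=> mB; rewrite /m2 /= /mscale /= -(box_moment rho_gt0 PX mB) /msum.
  transitivity (\sum_(s <- perms) PE ((permute_tuple s \o node_tuple X n) @^-1` box B))%E.
    by rewrite (big_nth 1%g) big_mkord cardE.
  (* Here the points are permuted, in [box_moment] the sides of the box; the two actions are inverse
     to each other. *)
  rewrite big_enum /= (reindex_inj invg_inj)/=; apply: eq_bigr => s _.
  rewrite /mrestr setIC; congr (P (_ `&` _)); apply/seteqP; split => w /= wB j.
    by have := wB (s j); rewrite !tnth_mktuple permK.
  by rewrite !tnth_mktuple; have := wB (s^-1 j)%g; rewrite permKV tnth_mktuple.
have mu12 E : measurable E -> msum nu #|{perm 'I_n}| E = m2 E.
  apply: box_measure_unique => //.
  rewrite /= /msum; apply: lte_sum_pinfty => k _.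
  rewrite /nu /= /image_measure /pushforward /= /mrestr preimage_setT setTI.
  by rewrite (le_lt_trans (probability_le1 _ mE))// ltry.
have : (\int[msum nu #|{perm 'I_n}|]_t F t = \int[m2]_t F t)%E.
  by apply: eq_measure_integral => A mA _; exact: mu12.
rewrite ge0_integral_measure_sum// ge0_integral_mscale//.
rewrite (eq_bigr (fun=> \int[P]_(w in size_event X n) F (node_tuple X n w))%E); last first.
  move=> k _; rewrite ge0_integral_pushforward//= preimage_setT.
  rewrite ge0_integral_mrestr//; last exact: measurableT_comp.
  by apply: eq_integral => w _; rewrite /= /shuf Fs.
have c0 : (0 <= \int[P]_(w in size_event X n) F (node_tuple X n w))%E.
  exact: integral_ge0.
set c := (X in (_ -> X = _)%E) in c0 *.
have -> N : (\sum_(i < N) c = N%:R%:E * c)%E.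
  elim: N => [|N IH]; first by rewrite big_ord0 mul0e.
  by rewrite big_ord_recr IH -natr1 EFinD ge0_muleDl ?lee_fin// mul1e.
rewrite card_Sn => cE.
have f0 : n`!%:R != 0 :> R by rewrite pnatr_eq0 -lt0n fact_gt0.
by rewrite [_ / _]mulrC EFinM -muleA -[X in (_ * X)%E]cE muleA -EFinM mulVf// mul1e.
Qed.
End poisson_symmetric.

(** * Conditioning on the positions of the nodes *)

Section conditional_graph.
Context {R : realType} d (T : measurableType d) (P : probability T R).
Local Notation plane := (measurableTypeR R * measurableTypeR R)%type.
Variables (rho : R) (h : R -> R) (G : random_graph R T).
Hypotheses (rho_gt0 : 0 < rho) (PG : is_random_connection_network P rho h G).

Let PX : is_poisson_process P rho (nodes G) := PG.1.

Definition nat_rel n (e : {ffun 'I_n * 'I_n -> bool}) : rel nat := fun i j =>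
  if insub i is Some i' then if insub j is Some j' then e (i', j') else false
  else false.

Lemma nat_relE n (e : {ffun 'I_n * 'I_n -> bool}) (i j : 'I_n) :
  nat_rel e i j = e (i, j).
Proof. by rewrite /nat_rel !valK. Qed.

Definition graph_event n (e : {ffun 'I_n * 'I_n -> bool}) : set T :=
  size_event (nodes G) n `&`
  [set w | forall i j, (i < j < n)%N -> edge G w i j = nat_rel e i j].

Lemma measurable_graph_event n (e : {ffun 'I_n * 'I_n -> bool}) :
  measurable (graph_event e).
Proof.
have [_ [_ medge _]] := PG.
have mn := measurable_size_event PX n.
pose E (p : 'I_n * 'I_n) := [set w | [&& p.1 < size (nodes G w), p.2 < size (nodes G w)
                   & edge G w p.1 p.2]%N].
rewrite (_ : graph_event e = size_event (nodes G) n `&`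
    \bigcap_(p in [set p : 'I_n * 'I_n | (p.1 < p.2)%N])
      (if e p then E p else ~` E p)).
  apply: measurableI => //; apply: fin_bigcap_measurable => // p _.
  by case: ifP => _; [|apply: measurableC]; exact: medge.
apply/seteqP; split => w [sw] /= Hw; split => //.
  move=> [i j] /= ij.
  have := Hw i j; rewrite ij ltn_ord => /(_ isT); rewrite nat_relE.
  by case: (e (i, j)) => ew; rewrite /E /= (sw : size _ = n) !ltn_ord ew.
move=> i j /andP[ij jn]; have ilt := ltn_trans ij jn.
have := Hw (Ordinal ilt, Ordinal jn) ij.
rewrite /E -(nat_relE e) /=.
by case: (nat_rel e i j) => /=; rewrite (sw : size _ = n) ilt jn; case: edge.
Qed.

Lemma graph_event_disjoint n (e f : {ffun 'I_n * 'I_n -> bool}) w :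
  simple_graph e -> simple_graph f ->
  graph_event e w -> graph_event f w -> e = f.
Proof.
move=> /simple_graphP[es ei] /simple_graphP[fs fi] [_ ew] [_ fw].
apply/ffunP => -[i j].
have lt_eq (k l : 'I_n) : (k < l)%N -> e (k, l) = f (k, l).
  by move=> kl; rewrite -!nat_relE -ew ?kl ?ltn_ord// fw ?kl ?ltn_ord.
have [ij|ji|/val_inj ->] := ltngtP i j; last by rewrite ei fi.
- exact: lt_eq.
- by rewrite es fs lt_eq.
Qed.

Lemma nb_isolated_graph_event n (e : {ffun 'I_n * 'I_n -> bool}) w :
  simple_graph e -> graph_event e w -> nb_isolated G w = nb_isolated_vertices e.
Proof.
move=> /simple_graphP[es ei] [sw ew]; have [_ [edge_sym _ _]] := PG.
rewrite /nb_isolated (sw : size _ = n); apply: eq_card => i; rewrite !inE.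
apply: eq_forallb => j; rewrite -val_eqE /=; case: eqVneq => //= ij.
rewrite -nat_relE; congr (~~ _).
have [lt|gt|ji] := ltngtP i j.
- by rewrite ew ?lt ?ltn_ord.
- by rewrite edge_sym ew ?gt ?ltn_ord// !nat_relE es.
- by rewrite ji eqxx in ij.
Qed.

Lemma graph_event_exists n w : size_event (nodes G) n w ->
  exists2 e : {ffun 'I_n * 'I_n -> bool}, simple_graph e & graph_event e w.
Proof.
move=> sw; have [_ [edge_sym _ _]] := PG.
(* The diagonal of [edge] is unconstrained, so it is erased. *)
exists [ffun p : 'I_n * 'I_n => (p.1 != p.2) && edge G w p.1 p.2].
  apply/simple_graphP; split => [i j|i]; rewrite !ffunE /= ?eqxx//.
  by rewrite eq_sym edge_sym.
split => // i j /andP[ij jn]; have ilt := ltn_trans ij jn.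
by rewrite -[i]/(val (Ordinal ilt)) -[j]/(val (Ordinal jn)) nat_relE ffunE /=
  -val_eqE /= neq_ltn ij.
Qed.

Definition isolated_event k : set T := nb_isolated G @^-1` [set k].

Lemma isolated_eventE k n : isolated_event k `&` size_event (nodes G) n =
  [set w | exists2 e : {ffun 'I_n * 'I_n -> bool},
     simple_graph e && (nb_isolated_vertices e == k) & graph_event e w].
Proof.
apply/seteqP; split => w /=.
  move=> [wk sw]; have [e se ew] := graph_event_exists sw.
  by exists e => //; rewrite se -(nb_isolated_graph_event se ew) wk eqxx.
move=> [e /andP[se /eqP ek] ew]; split; last by case: ew.
by rewrite /isolated_event /= (nb_isolated_graph_event se ew).
Qed.

Lemma measurable_isolated_size k n :
  measurable (isolated_event k `&` size_event (nodes G) n).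
Proof.
rewrite isolated_eventE (_ : mkset _ = \bigcup_(e in
    [set e : {ffun 'I_n * 'I_n -> bool} | simple_graph e && (nb_isolated_vertices e == k)])
    graph_event e).
  by apply: fin_bigcup_measurable => // e _; exact: measurable_graph_event.
by apply/seteqP; split => w /= [e ? ?]; exists e.
Qed.

Lemma isolated_event_bigcup k :
  isolated_event k = \bigcup_n (isolated_event k `&` size_event (nodes G) n).
Proof.
by apply/seteqP; split => [w wk|w [n _ []]//]; exists (size (nodes G w)).
Qed.

Lemma measurable_isolated_event k : measurable (isolated_event k).
Proof.
by rewrite isolated_event_bigcup; apply: bigcupT_measurable => n;
  exact: measurable_isolated_size.
Qed.

(** This makes the event admissible as [F] in [independent_connections]. *)
Lemma sigma_nodes_size_event n : sigma_nodes (nodes G) (size_event (nodes G) n).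
Proof.
pose gen := [set E | exists i (B : set plane), measurable B /\
  E = node_event (nodes G) i B].
rewrite /sigma_nodes -/gen.
have ggt i : <<s gen >> [set w | (i < size (nodes G w))%N].
  by rewrite size_gtE; apply: sub_sigma_algebra; exists i, setT; split.
rewrite (_ : size_event _ n = [set w | (n <= size (nodes G w))%N] `\`
    [set w | (n < size (nodes G w))%N]); last first.
  apply/seteqP; split => w; rewrite /size_event /=; first by move=> ->; rewrite ltnn.
  by move=> [nX /negP]; rewrite -leqNgt => Xn; apply/eqP; rewrite eqn_leq Xn.
pose GT := g_sigma_algebraType gen.
apply: (@measurableD _ GT); last exact: ggt.
case: n => [|n]; last exact: ggt.
by rewrite (_ : mkset _ = setT)//; apply/seteqP.
Qed.

Definition tuple_kernel n (t : n.-tuple (R * R)) : 'I_n -> 'I_n -> R :=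
  fun i j => h (tdist (tnth t i) (tnth t j)).

Hypothesis h01 : forall x, 0 <= x -> 0 <= h x <= 1.

Lemma prob_graph_event n (e : {ffun 'I_n * 'I_n -> bool}) :
  (P (graph_event e) = \int[P]_(w in size_event (nodes G) n)
     (graph_weight (tuple_kernel (node_tuple (nodes G) n w)) e)%:E)%E.
Proof.
have [_ [_ _ cond]] := PG.
rewrite /graph_event cond//; last exact: sigma_nodes_size_event.
apply: eq_integral => w _; congr EFin; apply: eq_bigr => j _.
pose F i := bernoulli_pmf (h (tdist (nth 0 (nodes G w) i) (nth 0 (nodes G w) j)))
  (nat_rel e i j).
rewrite (big_ord_widen n F (ltnW (ltn_ord j))); apply: eq_bigr => i _.
by rewrite /F nat_relE /tuple_kernel !tnth_mktuple.
Qed.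

End conditional_graph.

Lemma nneseries_expR (R : realType) (a : R) : 0 <= a ->
  (\sum_(n <oo) (a ^+ n / n`!%:R)%:E = (expR a)%:E)%E.
Proof.
move=> a0; rewrite expRE -EFin_lim; last first.
  rewrite /pseries/=; under eq_fun do rewrite mulrC.
  exact: is_cvg_series_exp_coeff.
apply/congr_lim/funext => n/=; rewrite /pseries/= /series/= -sumEFin//.
by under [RHS]eq_bigr do rewrite mulrC.
Qed.

(** * Mecke's formula and the Stein recursion *)

Section poisson_expectation.
Context d (A : measurableType d) (R : realType) (U : probability A R).
Variable rho : R.
Hypothesis rho_gt0 : 0 < rho.
Local Open Scope ereal_scope.

Definition poisson_weight n : R := (expR (- rho) * rho ^+ n / n`!%:R)%R.

Lemma poisson_weight_ge0 n : (0 <= poisson_weight n)%R.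
Proof. by rewrite divr_ge0// mulr_ge0 ?expR_ge0// exprn_ge0// ltW. Qed.

(** The source of the factor [rho] in Mecke's formula: it is traded for the choice of one among
    [n + 1] points. *)
Lemma poisson_weightS n :
  (poisson_weight n.+1 * n.+1%:R = poisson_weight n * rho)%R.
Proof.
rewrite /poisson_weight exprS factS natrM.
have f0 : (n`!%:R != 0 :> R)%R by rewrite pnatr_eq0 -lt0n fact_gt0.
have n0 : (n.+1%:R != 0 :> R)%R by rewrite pnatr_eq0.
by field; rewrite f0 (_ : (1 + n%:R = n.+1%:R :> R)%R)// -natr1 addrC.
Qed.

Definition poisson_mean (F : forall n, n.-tuple A -> \bar R) : \bar R :=
  \sum_(n <oo) (poisson_weight n)%:E * \int[power_prob U n]_t F n t.

Definition mfamily (F : forall n, n.-tuple A -> \bar R) :=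
  forall n, measurable_fun [set: n.-tuple A] (F n) /\ forall t, 0 <= F n t.

Let term_ge0 F n : mfamily F ->
  0 <= (poisson_weight n)%:E * \int[power_prob U n]_t F n t.
Proof.
move=> mF; rewrite mule_ge0 ?lee_fin ?poisson_weight_ge0//.
by apply: integral_ge0 => t _; have [] := mF n.
Qed.

Lemma poisson_mean_ge0 F : mfamily F -> 0 <= poisson_mean F.
Proof. by move=> mF; apply: nneseries_ge0 => n _ _; exact: term_ge0. Qed.

Lemma le_poisson_mean F F' : mfamily F -> mfamily F' ->
  (forall n t, F n t <= F' n t) -> poisson_mean F <= poisson_mean F'.
Proof.
move=> mF mF' FF'; apply: lee_nneseries => [n _ _|n _]; first exact: term_ge0.
rewrite lee_wpmul2l ?lee_fin ?poisson_weight_ge0//.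
have [? ?] := mF n; have [? ?] := mF' n.
by apply: ge0_le_integral.
Qed.

Lemma eq_poisson_mean F F' : (forall n t, F n t = F' n t) ->
  poisson_mean F = poisson_mean F'.
Proof.
move=> FF'; apply: eq_eseriesr => n _; congr (_ * _).
by apply: eq_integral => t _.
Qed.

Lemma poisson_meanD F F' : mfamily F -> mfamily F' ->
  poisson_mean (fun n t => F n t + F' n t) = poisson_mean F + poisson_mean F'.
Proof.
move=> mF mF'; rewrite -nneseriesD; last 2 first.
- by move=> n _ _; exact: term_ge0.
- by move=> n _ _; exact: term_ge0.
apply: eq_eseriesr => n _; have [? ?] := mF n; have [? ?] := mF' n.
rewrite ge0_integralD// ge0_muleDr//; exact: integral_ge0.
Qed.

Lemma poisson_meanZ (c : R) F : (0 <= c)%R -> mfamily F ->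
  poisson_mean (fun n t => c%:E * F n t) = c%:E * poisson_mean F.
Proof.
move=> c0 mF; rewrite -nneseriesZl; last by move=> n _; exact: term_ge0.
apply: eq_eseriesr => n _; have [? ?] := mF n.
by rewrite ge0_integralZl ?lee_fin// muleCA.
Qed.

Lemma mfamilyZ (c : R) F : (0 <= c)%R -> mfamily F ->
  mfamily (fun n t => c%:E * F n t).
Proof.
move=> c0 mF n; have [? ?] := mF n.
by split => [|t]; [exact: measurable_funeM|exact: mule_ge0].
Qed.

Lemma poisson_mean1 : poisson_mean (fun _ _ => 1) = 1.
Proof.
rewrite /poisson_mean.
transitivity (\sum_(n <oo) (expR (- rho))%:E * (rho ^+ n / n`!%:R)%:E).
  apply: eq_eseriesr => n _; rewrite integral_cst// mul1e.
  rewrite [X in _ * X](_ : _ = 1); last exact: probability_setT.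
  by rewrite mule1 /poisson_weight -mulrA EFinM.
rewrite nneseriesZl; last first.
  by move=> n _; rewrite lee_fin divr_ge0// exprn_ge0// ltW.
by rewrite nneseries_expR ?ltW// -EFinM -expRD addNr expR0.
Qed.

(** The probability generating functional of a Poisson process, averaged over a parameter [s] by
    Tonelli's theorem. With one additional point as [s] it yields the mean of the isolation
    probability, with two its second moment. *)
Lemma poisson_mean_mixture d' (S : measurableType d') (nu : probability S R)
    (u : S * A -> R) :
  measurable_fun setT u -> (forall p, 0 <= u p <= 1)%R ->
  poisson_mean (fun n t => \int[nu]_s (\prod_(i < n) u (s, tnth t i))%:E) =
  \int[nu]_s (expR (- rho * (1 - fine (\int[U]_y (u (s, y))%:E))))%:E.
Proof.
move=> mu u01; have u0 p : (0 <= u p)%R by have /andP[] := u01 p.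
have u1 p : (u p <= 1)%R by have /andP[] := u01 p.
have musec s : measurable_fun setT (fun y => u (s, y)).
  exact: measurableT_comp mu (pair1_measurable _).
pose m s := fine (\int[U]_y (u (s, y))%:E).
have mE s : \int[U]_y (u (s, y))%:E = (m s)%:E.
  rewrite /m fineK// ge0_fin_numE; last by apply: integral_ge0 => y _; rewrite lee_fin.
  apply: (@le_lt_trans _ _ (\int[U]_y 1)); last first.
    rewrite integral_cst// mul1e [X in X < _](_ : _ = 1) ?ltry//.
    exact: probability_setT.
  apply: ge0_le_integral => //.
  - by move=> y _; rewrite lee_fin.
  - exact/measurable_EFinP.
  - by move=> y _; rewrite lee_fin.
have m0 s : (0 <= m s)%R.
  by apply: fine_ge0; apply: integral_ge0 => y _; rewrite lee_fin.
have mm : measurable_fun setT (fun s => (m s)%:E).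
  rewrite (_ : (fun s => (m s)%:E) = fubini_F U (EFin \o u)); last first.
    by apply/funext => s; exact/esym/mE.
  apply: measurable_fun_fubini_tonelli_F => //; exact/measurable_EFinP.
rewrite /poisson_mean.
transitivity (\sum_(n <oo) \int[nu]_s (poisson_weight n * m s ^+ n)%:E).
  apply: eq_eseriesr => n _.
  pose f (p : S * n.-tuple A) := (\prod_(i < n) u (p.1, tnth p.2 i))%:E.
  have mf : measurable_fun setT f.
    apply/measurable_EFinP; apply: measurable_prod => i _.
    apply: (measurableT_comp mu); apply/measurable_fun_pairP; split => /=.
      exact: measurable_fst.
    exact: (measurableT_comp (measurable_tnth i) measurable_snd).
  have f0 p : 0 <= f p by rewrite lee_fin prodr_ge0.
  rewrite -[X in _ * X]/(\int[power_prob U n]_t \int[nu]_s f (s, t)).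
  rewrite -(@fubini_tonelli _ _ _ _ R nu (power_prob U n) f mf f0)/=.
  rewrite -ge0_integralZl ?lee_fin ?poisson_weight_ge0//.
  - apply: eq_integral => s _; rewrite [RHS]EFinM; congr (_ * _).
    by rewrite /f/= (integral_power_prod U n (musec s))// mE EFin_expe.
  - exact: measurable_fun_fubini_tonelli_F.
  - by move=> s _; exact: integral_ge0.
rewrite -integral_nneseries//; last 2 first.
- move=> n; apply/measurable_EFinP; apply: measurable_funM => //.
  by apply: measurable_funX; exact/measurable_EFinP.
- move=> n s _; by rewrite lee_fin mulr_ge0 ?poisson_weight_ge0// exprn_ge0.
apply: eq_integral => s _.
transitivity (\sum_(n <oo) (expR (- rho))%:E * ((rho * m s) ^+ n / n`!%:R)%:E).
  by apply: eq_eseriesr => n _; rewrite -EFinM /poisson_weight exprMn; congr EFin; ring.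
rewrite nneseriesZl; last first.
  by move=> n _; rewrite lee_fin divr_ge0// exprn_ge0// mulr_ge0// ltW.
rewrite nneseries_expR ?mulr_ge0 ?(ltW rho_gt0)// -EFinM -expRD.
by congr (expR _)%:E; rewrite -/(m s); ring.
Qed.

End poisson_expectation.

(** * Mecke's formula for the number of isolated vertices *)

Section mecke.
Context d (A : measurableType d) (R : realType) (U : probability A R).
Variables (rho : R) (H : A -> A -> R).
Hypotheses (rho_gt0 : 0 < rho)
  (mH : measurable_fun setT (fun p : A * A => H p.1 p.2))
  (H01 : forall x y, 0 <= H x y <= 1) (Hsym : forall x y, H x y = H y x).

Definition kernel_matrix n (t : n.-tuple A) : 'I_n -> 'I_n -> R :=
  fun i j => H (tnth t i) (tnth t j).

Definition tuple_isolated_prob k n (t : n.-tuple A) : R :=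
  isolated_prob (kernel_matrix t) k.

(** The variable [Z] of the overview is [rho] times this. *)
Definition isolation_prob n (t : n.-tuple A) : R :=
  fine (\int[U]_x (\prod_(i < n) (1 - H x (tnth t i)))%:E)%E.

Let km01 n (t : n.-tuple A) i j : 0 <= kernel_matrix t i j <= 1.
Proof. exact: H01. Qed.

Let mkm n (i j : 'I_n) :
  measurable_fun [set: n.-tuple A] (fun t => kernel_matrix t i j).
Proof.
apply: (measurableT_comp mH (_ : measurable_fun setT (fun t => (tnth t i, tnth t j)))).
by apply/measurable_fun_pairP; split => /=; exact: measurable_tnth.
Qed.

Lemma measurable_graph_weight n (e : {ffun 'I_n * 'I_n -> bool}) :
  measurable_fun [set: n.-tuple A] (fun t => graph_weight (kernel_matrix t) e).
Proof.
rewrite /graph_weight; apply: measurable_prod => j _.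
under eq_fun do rewrite big_mkcond.
apply: measurable_prod => i _; case: (i < j)%N => //.
by rewrite /bernoulli_pmf; case: (e (i, j)); [exact: mkm|apply: measurable_funB => //; exact: mkm].
Qed.

Lemma measurable_tuple_isolated_prob k n :
  measurable_fun [set: n.-tuple A] (@tuple_isolated_prob k n).
Proof.
rewrite /tuple_isolated_prob /isolated_prob.
under eq_fun do rewrite big_mkcond.
by apply: measurable_sum => e; case: (_ && _) => //; exact: measurable_graph_weight.
Qed.

Let misolated_prob_at k n i :
  measurable_fun [set: n.-tuple A] (fun t => isolated_prob_at (kernel_matrix t) k i).
Proof.
rewrite /isolated_prob_at; under eq_fun do rewrite big_mkcond.
by apply: measurable_sum => e; case: [&& _, _ & _] => //; exact: measurable_graph_weight.
Qed.

Let isolated_prob_at_ge0 k n (t : n.-tuple A) i :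
  0 <= isolated_prob_at (kernel_matrix t) k i.
Proof. by apply: sumr_ge0 => e _; apply: graph_weight_ge0. Qed.

Lemma tuple_isolated_prob_ge0 k n (t : n.-tuple A) : 0 <= tuple_isolated_prob k t.
Proof. exact: isolated_prob_ge0. Qed.

Lemma sum_tuple_isolated_prob_le1 N n (t : n.-tuple A) :
  \sum_(k < N) tuple_isolated_prob k t <= 1.
Proof. exact: sum_isolated_prob_le1. Qed.

Lemma tuple_isolated_prob_le1 k n (t : n.-tuple A) : tuple_isolated_prob k t <= 1.
Proof.
apply: le_trans (sum_tuple_isolated_prob_le1 k.+1 t).
by rewrite big_ord_recr/= lerDr sumr_ge0// => i _; exact: tuple_isolated_prob_ge0.
Qed.

Lemma tuple_isolated_prob_permute k n (s : {perm 'I_n}) (t : n.-tuple A) :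
  tuple_isolated_prob k (permute_tuple s t) = tuple_isolated_prob k t.
Proof.
rewrite /tuple_isolated_prob -(isolated_prob_perm s _ (km01 t))//.
  by congr isolated_prob; apply/funext => i; apply/funext => j;
    rewrite /kernel_matrix !tnth_mktuple.
by move=> i j; exact: Hsym.
Qed.

Let oneBH01 x y : 0 <= 1 - H x y <= 1.
Proof. by have /andP[? ?] := H01 x y; apply/andP; split; lra. Qed.

Let prodH01 n x (t : n.-tuple A) : 0 <= \prod_(i < n) (1 - H x (tnth t i)) <= 1.
Proof.
apply/andP; split; first by apply: prodr_ge0 => i _; have /andP[] := oneBH01 x (tnth t i).
by apply: prodr_ile1 => i _; exact: oneBH01.
Qed.

Let mprodH n : measurable_fun setT
  (fun p : A * n.-tuple A => \prod_(i < n) (1 - H p.1 (tnth p.2 i))).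
Proof.
apply: measurable_prod => i _; apply: measurable_funB => //.
apply: (measurableT_comp mH (_ : measurable_fun setT
  (fun p : A * n.-tuple A => (p.1, tnth p.2 i)))).
apply/measurable_fun_pairP; split => /=; first exact: measurable_fst.
exact: (measurableT_comp (measurable_tnth i) measurable_snd).
Qed.

Lemma isolation_probE n (t : n.-tuple A) :
  ((isolation_prob t)%:E = \int[U]_x (\prod_(i < n) (1 - H x (tnth t i)))%:E)%E.
Proof.
rewrite /isolation_prob fineK// ge0_fin_numE; last first.
  by apply: integral_ge0 => x _; rewrite lee_fin; have /andP[] := prodH01 x t.
apply: (@le_lt_trans _ _ (\int[U]_x 1)%E); last first.
  by rewrite integral_cst// mul1e [ltLHS](_ : _ = 1%E) ?ltry//; exact: probability_setT.
apply: ge0_le_integral => //.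
- by move=> x _; rewrite lee_fin; have /andP[] := prodH01 x t.
- apply/measurable_EFinP; exact: (measurableT_comp (@mprodH n) (pair2_measurable t)).
- by move=> x _; rewrite lee_fin; have /andP[] := prodH01 x t.
Qed.

Lemma isolation_prob_ge0 n (t : n.-tuple A) : 0 <= isolation_prob t.
Proof.
apply: fine_ge0; apply: integral_ge0 => x _.
by rewrite lee_fin; have /andP[] := prodH01 x t.
Qed.

Lemma measurable_isolation_prob n :
  measurable_fun [set: n.-tuple A] (@isolation_prob n).
Proof.
apply/measurable_EFinP.
pose f (p : A * n.-tuple A) := (\prod_(i < n) (1 - H p.1 (tnth p.2 i)))%:E.
rewrite (_ : EFin \o _ = fubini_G U f); last first.
  by apply/funext => t; exact: isolation_probE.
apply: measurable_fun_fubini_tonelli_G => //; first by apply/measurable_EFinP; exact: mprodH.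
by move=> p; rewrite lee_fin; have /andP[] := prodH01 p.1 p.2.
Qed.

(* The vertex of index [i] is exchanged with vertex [0], which is then
   isolated from the others with probability [isolation_prob]. *)
Lemma mecke_tuple k n :
  (\int[power_prob U n.+1]_t (k.+1%:R * tuple_isolated_prob k.+1 t)%:E =
   n.+1%:R%:E * \int[power_prob U n]_t (isolation_prob t * tuple_isolated_prob k t)%:E)%E.
Proof.
transitivity (\int[power_prob U n.+1]_t
    (\sum_(i < n.+1) (isolated_prob_at (kernel_matrix t) k.+1 i)%:E))%E.
  apply: eq_integral => t _; rewrite sumEFin sum_isolated_prob_at.
  by rewrite mulr_natl.
rewrite ge0_integral_sum//; last 2 first.
- by move=> i; apply/measurable_EFinP; exact: misolated_prob_at.
- by move=> i t _; rewrite lee_fin; exact: isolated_prob_at_ge0.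
rewrite (eq_bigr (fun=> \int[power_prob U n]_t
    (isolation_prob t * tuple_isolated_prob k t)%:E)%E) => [|i _].
  set c := (\int[_]_t _)%E.
  have c0 : (0 <= c)%E.
    apply: integral_ge0 => t _.
    by rewrite lee_fin mulr_ge0 ?isolation_prob_ge0 ?tuple_isolated_prob_ge0.
  elim: n.+1 => [|N IH]; first by rewrite big_ord0 mul0e.
  by rewrite big_ord_recr IH -natr1 EFinD ge0_muleDl ?lee_fin// mul1e.
rewrite (eq_integral (fun t => (isolated_prob_at
    (kernel_matrix (permute_tuple (tperm ord0 i) t)) k.+1 ord0)%:E)); last first.
  move=> t _; congr EFin.
  rewrite -[in LHS](tpermL ord0 i) -(isolated_prob_at_perm _ _ _ (km01 t)); last first.
    by move=> a b; exact: Hsym.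
  by congr isolated_prob_at; apply/funext => a; apply/funext => b;
    rewrite /kernel_matrix !tnth_mktuple.
rewrite (@integral_power_permute _ _ _ U _ (tperm ord0 i)
   (fun t => (isolated_prob_at (kernel_matrix t) k.+1 ord0)%:E)); last 2 first.
- by apply/measurable_EFinP; exact: misolated_prob_at.
- by move=> t; rewrite lee_fin; exact: isolated_prob_at_ge0.
rewrite integral_powerS_swap; last 2 first.
- by apply/measurable_EFinP; exact: misolated_prob_at.
- by move=> t; rewrite lee_fin; exact: isolated_prob_at_ge0.
apply: eq_integral => t _; rewrite EFinM isolation_probE -ge0_integralZr//; last 3 first.
- apply/measurable_EFinP; exact: (measurableT_comp (@mprodH n) (pair2_measurable t)).
- by move=> x _; rewrite lee_fin; have /andP[] := prodH01 x t.
- by rewrite lee_fin tuple_isolated_prob_ge0.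
apply: eq_integral => x _; rewrite -EFinM isolated_prob_at0; congr EFin.
congr (_ * _); first by apply: eq_bigr => i' _; rewrite /kernel_matrix tnthS.
rewrite -[LHS]/(@isolated_prob R n _ k); congr isolated_prob.
by apply/funext => a; apply/funext => b; rewrite /kernel_matrix !tnthS.
Qed.

Lemma mecke k :
  poisson_mean U rho (fun n t => (k.+1%:R * tuple_isolated_prob k.+1 t)%:E) =
  poisson_mean U rho
    (fun n t => (rho * isolation_prob t * tuple_isolated_prob k t)%:E).
Proof.
have term0 n : (0 <= (poisson_weight rho n)%:E *
    \int[power_prob U n]_t (k.+1%:R * tuple_isolated_prob k.+1 t)%:E)%E.
  rewrite mule_ge0 ?lee_fin ?poisson_weight_ge0//.
  apply: integral_ge0 => t _; rewrite lee_fin mulr_ge0//.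
  exact: tuple_isolated_prob_ge0.
rewrite /poisson_mean nneseries_recl// -nneseries_addn//.
(* The empty configuration has no isolated vertex, so the series on the left starts at one point;
   this is the shift from [n] to [n + 1]. *)
rewrite [X in (X + _)%E](_ : _ = 0%E) ?add0e; last first.
  rewrite integral0_eq ?mule0// => t _.
  by rewrite /tuple_isolated_prob isolated_prob_large// mulr0.
apply: eq_eseriesr => n _.
rewrite addn1 mecke_tuple muleA -EFinM poisson_weightS EFinM -muleA; congr (_ * _)%E.
rewrite -ge0_integralZl ?lee_fin ?ltW//; last 2 first.
- apply/measurable_EFinP; apply: measurable_funM.
    exact: measurable_isolation_prob.
  exact: measurable_tuple_isolated_prob.
- by move=> t _; rewrite lee_fin mulr_ge0 ?isolation_prob_ge0 ?tuple_isolated_prob_ge0.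
by apply: eq_integral => t _; rewrite -EFinM mulrA.
Qed.

End mecke.

Lemma integral_bounded_fin d (S : measurableType d) (R : realType)
    (nu : probability S R) (f : S -> R) (B : R) :
  measurable_fun setT f -> (forall s, 0 <= f s <= B) ->
  (\int[nu]_s (f s)%:E \is a fin_num)%E.
Proof.
move=> mf fB; have f0 s : 0 <= f s by have /andP[] := fB s.
rewrite ge0_fin_numE; last by apply: integral_ge0 => s _; rewrite lee_fin.
apply: (@le_lt_trans _ _ (\int[nu]_s B%:E)%E); last first.
  rewrite integral_cst// [X in (_ * X)%E](_ : _ = 1%E) ?mule1 ?ltry//.
  exact: probability_setT.
apply: ge0_le_integral => //.
- by move=> s _; rewrite lee_fin.
- exact/measurable_EFinP.
- by move=> s _; rewrite lee_fin; have /andP[] := fB s.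
Qed.

Lemma integral_one d (S : measurableType d) (R : realType) (nu : probability S R) :
  (\int[nu]_s 1 = 1)%E.
Proof.
rewrite integral_cst// mul1e; exact: probability_setT.
Qed.

(** * Finite means of bounded functions *)

Section bounded_poisson_mean.
Context d (A : measurableType d) (R : realType) (U : probability A R).
Variables (rho : R).
Hypotheses (rho_gt0 : 0 < rho).

(** A bound uniform in [n] makes the means finite, so that the Stein estimates can subtract them as
    real numbers. *)
Definition bounded_family (f : forall n, n.-tuple A -> R) :=
  (forall n, measurable_fun [set: n.-tuple A] (f n)) /\
  exists B, forall n t, 0 <= f n t <= B.

Definition real_poisson_mean (f : forall n, n.-tuple A -> R) : R :=
  fine (poisson_mean U rho (fun n t => (f n t)%:E)).

Let mfam f : bounded_family f -> mfamily (fun n t => (f n t)%:E).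
Proof.
move=> [mf [B fB]] n; split=> [|t]; first by apply/measurable_EFinP; exact: mf.
by rewrite lee_fin; have /andP[] := fB n t.
Qed.

Lemma real_poisson_meanE f : bounded_family f ->
  poisson_mean U rho (fun n t => (f n t)%:E) = (real_poisson_mean f)%:E.
Proof.
move=> bf; rewrite /real_poisson_mean fineK// ge0_fin_numE; last first.
  by apply: poisson_mean_ge0 => //; exact: mfam.
have [mf [B fB]] := bf.
have B0 : 0 <= B by have /andP[] := fB 0%N [tuple]; exact: le_trans.
have m1 : @mfamily _ A R (fun _ _ => 1%E) by move=> n; split.
apply: (@le_lt_trans _ _ (poisson_mean U rho (fun n t => B%:E * 1)%E)).
  apply: le_poisson_mean => //; [exact: mfam|exact: mfamilyZ|].
  by move=> n t; rewrite mule1 lee_fin; have /andP[] := fB n t.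
by rewrite poisson_meanZ// poisson_mean1// mule1 ltry.
Qed.

Lemma bounded_familyD f f' : bounded_family f -> bounded_family f' ->
  bounded_family (fun n t => f n t + f' n t).
Proof.
move=> [mf [B fB]] [mf' [B' fB']]; split=> [n|]; first exact: measurable_funD (mf n) (mf' n).
exists (B + B') => n t; have /andP[? ?] := fB n t; have /andP[? ?] := fB' n t.
by apply/andP; split; lra.
Qed.

Lemma bounded_familyM f f' : bounded_family f -> bounded_family f' ->
  bounded_family (fun n t => f n t * f' n t).
Proof.
move=> [mf [B fB]] [mf' [B' fB']]; split=> [n|]; first exact: measurable_funM (mf n) (mf' n).
exists (B * B') => n t; have /andP[? ?] := fB n t; have /andP[? ?] := fB' n t.
by rewrite mulr_ge0//= ler_pM.
Qed.

Lemma bounded_family_cst c : 0 <= c -> bounded_family (fun _ _ => c).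
Proof. by move=> c0; split=> //; exists c => n t; rewrite c0 lexx. Qed.

Lemma bounded_familyZ c f : 0 <= c -> bounded_family f ->
  bounded_family (fun n t => c * f n t).
Proof. by move=> c0; apply: bounded_familyM; exact: bounded_family_cst. Qed.

Lemma real_poisson_meanD f f' : bounded_family f -> bounded_family f' ->
  real_poisson_mean (fun n t => f n t + f' n t) =
  real_poisson_mean f + real_poisson_mean f'.
Proof.
move=> bf bf'; apply: EFin_inj.
rewrite EFinD -!real_poisson_meanE//; last exact: bounded_familyD.
by rewrite -poisson_meanD//; exact: mfam.
Qed.

Lemma real_poisson_meanZ c f : 0 <= c -> bounded_family f ->
  real_poisson_mean (fun n t => c * f n t) = c * real_poisson_mean f.
Proof.
move=> c0 bf; apply: EFin_inj.
rewrite EFinM -!real_poisson_meanE//; last exact: bounded_familyZ.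
by rewrite -poisson_meanZ//; exact: mfam.
Qed.

Lemma real_poisson_mean_cst c : 0 <= c -> real_poisson_mean (fun _ _ => c) = c.
Proof.
move=> c0; have -> : real_poisson_mean (fun _ _ => c) =
    real_poisson_mean (fun _ _ => c * 1).
  by congr fine; apply: eq_poisson_mean => n t; rewrite mulr1.
rewrite real_poisson_meanZ//; last exact: bounded_family_cst.
by rewrite /real_poisson_mean poisson_mean1// mulr1.
Qed.

Lemma le_real_poisson_mean f f' : bounded_family f -> bounded_family f' ->
  (forall n t, f n t <= f' n t) -> real_poisson_mean f <= real_poisson_mean f'.
Proof.
move=> bf bf' ff'; rewrite -lee_fin -!real_poisson_meanE//.
by apply: le_poisson_mean => //; exact: mfam.
Qed.

Lemma eq_real_poisson_mean f f' : (forall n t, f n t = f' n t) ->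
  real_poisson_mean f = real_poisson_mean f'.
Proof. by move=> ff'; congr fine; apply: eq_poisson_mean => n t; rewrite ff'. Qed.

Lemma real_poisson_mean_sum N (f : nat -> forall n, n.-tuple A -> R) :
  (forall k, bounded_family (f k)) ->
  real_poisson_mean (fun n t => \sum_(k < N) f k n t) =
  \sum_(k < N) real_poisson_mean (f k).
Proof.
move=> bf; suff [_ ->//] : bounded_family (fun n t => \sum_(k < N) f k n t) /\
    real_poisson_mean (fun n t => \sum_(k < N) f k n t) =
    \sum_(k < N) real_poisson_mean (f k).
elim: N => [|N [bN IH]].
  have E0 : (fun n (t : n.-tuple A) => \sum_(k < 0) f k n t) = (fun _ _ => 0).
    by apply: functional_extensionality_dep => n; apply/funext => t; rewrite big_ord0.
  by rewrite E0 big_ord0 real_poisson_mean_cst//; split => //; exact: bounded_family_cst.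
have ES : (fun n (t : n.-tuple A) => \sum_(k < N.+1) f k n t) =
    (fun n t => \sum_(k < N) f k n t + f N n t).
  by apply: functional_extensionality_dep => n; apply/funext => t; rewrite big_ord_recr.
by rewrite ES big_ord_recr/= real_poisson_meanD// IH; split => //; exact: bounded_familyD.
Qed.

End bounded_poisson_mean.

(** * Moments of the isolation probability and the Stein estimate *)

Section stein.
Context d (A : measurableType d) (R : realType) (U : probability A R).
Variables (rho : R) (H : A -> A -> R) (c : R).
Hypotheses (rho_gt0 : 0 < rho)
  (mH : measurable_fun setT (fun p : A * A => H p.1 p.2))
  (H01 : forall x y, 0 <= H x y <= 1) (Hsym : forall x y, H x y = H y x)
  (Hc : forall x, (\int[U]_y (H x y)%:E = c%:E)%E).

Let mHsec x : measurable_fun setT (H x).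
Proof. exact: (measurableT_comp mH (pair1_measurable x)). Qed.

(** For a disk model this is the area common to two disks, and [c] is the area of one disk. *)
Definition common_prob (s : A * A) : R :=
  fine (\int[U]_y (H s.1 y * H s.2 y)%:E)%E.

Let HH01 x x' y : 0 <= H x y * H x' y <= 1.
Proof.
have /andP[? ?] := H01 x y; have /andP[? ?] := H01 x' y.
by rewrite mulr_ge0//= mulr_ile1.
Qed.

Let mHH x x' : measurable_fun setT (fun y => H x y * H x' y).
Proof. exact: measurable_funM. Qed.

Lemma common_probE s :
  (\int[U]_y (H s.1 y * H s.2 y)%:E = (common_prob s)%:E)%E.
Proof. by rewrite /common_prob fineK// (@integral_bounded_fin _ _ _ _ _ 1). Qed.

Lemma common_prob_ge0 s : 0 <= common_prob s.
Proof.
by apply: fine_ge0; apply: integral_ge0 => y _; rewrite lee_fin;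
  have /andP[] := HH01 s.1 s.2 y.
Qed.

Lemma common_prob_le s : common_prob s <= c.
Proof.
rewrite -lee_fin -common_probE -(Hc s.1); apply: ge0_le_integral => //.
- by move=> y _; rewrite lee_fin; have /andP[] := HH01 s.1 s.2 y.
- by apply/measurable_EFinP; exact: mHH.
- by apply/measurable_EFinP; exact: mHsec.
- move=> y _; have /andP[? ?] := H01 s.1 y; have /andP[? ?] := H01 s.2 y.
  by rewrite lee_fin ler_piMr.
Qed.

Lemma measurable_common_prob : measurable_fun setT common_prob.
Proof.
apply/measurable_EFinP.
pose f (p : (A * A) * A) := (H p.1.1 p.2 * H p.1.2 p.2)%:E.
rewrite (_ : EFin \o _ = fubini_F U f); last first.
  by apply/funext => s; exact/esym/common_probE.
have m1 : measurable_fun setT (fun p : (A * A) * A => H p.1.1 p.2).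
  apply: (measurableT_comp mH (_ : measurable_fun setT (fun p : (A * A) * A => (p.1.1, p.2)))).
  apply/measurable_fun_pairP; split => /=; last exact: measurable_snd.
  exact: (measurableT_comp measurable_fst measurable_fst).
have m2 : measurable_fun setT (fun p : (A * A) * A => H p.1.2 p.2).
  apply: (measurableT_comp mH (_ : measurable_fun setT (fun p : (A * A) * A => (p.1.2, p.2)))).
  apply/measurable_fun_pairP; split => /=; last exact: measurable_snd.
  exact: (measurableT_comp measurable_snd measurable_fst).
apply: measurable_fun_fubini_tonelli_F => //.
  by apply/measurable_EFinP; exact: measurable_funM.
by move=> p; rewrite lee_fin; have /andP[] := HH01 p.1.1 p.1.2 p.2.
Qed.

Local Notation isol := (fun n t => @isolation_prob _ A R U H n t).
Local Notation tip k := (fun n t => @tuple_isolated_prob _ A R H k n t).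

Lemma isolation_prob_le1 n (t : n.-tuple A) : isolation_prob U H t <= 1.
Proof.
rewrite -lee_fin (isolation_probE U mH H01) -(integral_one U).
have p01 x : 0 <= \prod_(i < n) (1 - H x (tnth t i)) <= 1.
  apply/andP; split.
    by apply: prodr_ge0 => i _; rewrite subr_ge0; have /andP[] := H01 x (tnth t i).
  apply: prodr_ile1 => i _; have /andP[? ?] := H01 x (tnth t i).
  by apply/andP; split; lra.
apply: ge0_le_integral => //.
- by move=> x _; rewrite lee_fin; have /andP[] := p01 x.
- apply/measurable_EFinP; apply: measurable_prod => i _; apply: measurable_funB => //.
  exact: (measurableT_comp mH (pair2_measurable (tnth t i))).
- by move=> x _; rewrite lee_fin; have /andP[] := p01 x.
Qed.

Lemma bounded_isolation_prob : bounded_family isol.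
Proof.
split=> [n|]; first exact: (measurable_isolation_prob U mH H01).
by exists 1 => n t; rewrite isolation_prob_le1 (isolation_prob_ge0 U H01).
Qed.

Lemma bounded_tuple_isolated_prob k : bounded_family (tip k).
Proof.
split=> [n|]; first exact: (measurable_tuple_isolated_prob mH).
by exists 1 => n t; rewrite tuple_isolated_prob_ge0// tuple_isolated_prob_le1.
Qed.

Lemma mean_isolation_prob : real_poisson_mean U rho isol = expR (- rho * c).
Proof.
apply: EFin_inj; rewrite -real_poisson_meanE//; last exact: bounded_isolation_prob.
transitivity (poisson_mean U rho (fun n t => \int[U]_x
    (\prod_(i < n) (fun p => 1 - H p.1 p.2) (x, tnth t i))%:E)%E).
  by apply: eq_poisson_mean => n t; rewrite (isolation_probE U mH H01).
rewrite [LHS](@poisson_mean_mixture _ A R U rho rho_gt0 _ _ U (fun p => 1 - H p.1 p.2))//; last 2 first.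
- exact: measurable_funB.
- by move=> p; have /andP[? ?] := H01 p.1 p.2; apply/andP; split; lra.
rewrite (eq_integral (fun=> (expR (- rho * c))%:E)) => [|x _].
  by rewrite integral_cst// [X in (_ * X)%E](_ : _ = 1%E) ?mule1//; exact: probability_setT.
congr (expR (_ * _))%:E => /=.
have oneB01 y : 0 <= 1 - H x y <= 1.
  by have /andP[? ?] := H01 x y; apply/andP; split; lra.
have m1H : measurable_fun setT (fun y => 1 - H x y) by exact: measurable_funB.
have fin1H := integral_bounded_fin U m1H oneB01.
have : (\int[U]_y (1 - H x y)%:E + \int[U]_y (H x y)%:E = 1)%E.
  rewrite -ge0_integralD//.
  - by rewrite -[RHS](integral_one U); apply: eq_integral => y _; rewrite -EFinD subrK.
  - by move=> y _; rewrite lee_fin; have /andP[] := oneB01 y.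
  - exact/measurable_EFinP.
  - by move=> y _; rewrite lee_fin; have /andP[] := H01 x y.
  - by apply/measurable_EFinP; exact: mHsec.
rewrite Hc -(fineK fin1H) -EFinD => E1.
have := EFin_inj E1; rewrite /=; set m := fine _; lra.
Qed.

(** By [mean_sqr_isolation_prob], this is the second moment of [isolation_prob] relative to the
    square of its mean. *)
Definition second_moment : R :=
  fine (\int[(U \x U)%E]_s (expR (rho * common_prob s))%:E)%E.

Lemma second_momentE :
  (\int[(U \x U)%E]_s (expR (rho * common_prob s))%:E = second_moment%:E)%E.
Proof.
rewrite /second_moment fineK//.
apply: (@integral_bounded_fin _ _ _ (U \x U)%E _ (expR (rho * c))).
  apply: measurableT_comp => //; apply: measurable_funM => //.
  exact: measurable_common_prob.
by move=> s; rewrite expR_ge0 ler_expR ler_wpM2l ?common_prob_le// ltW.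
Qed.

Lemma mean_sqr_isolation_prob :
  real_poisson_mean U rho (fun n t => isol n t * isol n t) =
  expR (- rho * c) ^+ 2 * second_moment.
Proof.
apply: EFin_inj; rewrite -real_poisson_meanE//; last first.
  by apply: bounded_familyM; exact: bounded_isolation_prob.
pose u (p : (A * A) * A) := (1 - H p.1.1 p.2) * (1 - H p.1.2 p.2).
have m1 : measurable_fun setT (fun p : (A * A) * A => H p.1.1 p.2).
  apply: (measurableT_comp mH (_ : measurable_fun setT (fun p : (A * A) * A => (p.1.1, p.2)))).
  apply/measurable_fun_pairP; split => /=; last exact: measurable_snd.
  exact: (measurableT_comp measurable_fst measurable_fst).
have m2 : measurable_fun setT (fun p : (A * A) * A => H p.1.2 p.2).
  apply: (measurableT_comp mH (_ : measurable_fun setT (fun p : (A * A) * A => (p.1.2, p.2)))).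
  apply/measurable_fun_pairP; split => /=; last exact: measurable_snd.
  exact: (measurableT_comp measurable_snd measurable_fst).
have mu : measurable_fun setT u by apply: measurable_funM; exact: measurable_funB.
have u01 p : 0 <= u p <= 1.
  have /andP[? ?] := H01 p.1.1 p.2; have /andP[? ?] := H01 p.1.2 p.2.
  by rewrite /u; apply/andP; split; nra.
transitivity (poisson_mean U rho (fun n t => \int[(U \x U)%E]_s
    (\prod_(i < n) u (s, tnth t i))%:E)%E).
  apply: eq_poisson_mean => n t.
  have msec : measurable_fun setT (fun x => \prod_(i < n) (1 - H x (tnth t i))).
    apply: measurable_prod => i _; apply: measurable_funB => //.
    exact: (measurableT_comp mH (pair2_measurable (tnth t i))).
  have p0 x : 0 <= \prod_(i < n) (1 - H x (tnth t i)).
    by apply: prodr_ge0 => i _; rewrite subr_ge0; have /andP[] := H01 x (tnth t i).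
  rewrite fubini_tonelli1//=; last 2 first.
  - apply/measurable_EFinP; apply: measurable_prod => i _.
    exact: (measurableT_comp mu (pair2_measurable (tnth t i))).
  - by move=> s; rewrite lee_fin; apply: prodr_ge0 => i _; have /andP[] := u01 (s, tnth t i).
  rewrite EFinM {1}(isolation_probE U mH H01) -ge0_integralZr//; last 3 first.
  - by apply/measurable_EFinP; exact: msec.
  - by move=> x _; rewrite lee_fin.
  - by rewrite lee_fin (isolation_prob_ge0 U H01).
  apply: eq_integral => x _; rewrite /fubini_F (isolation_probE U mH H01).
  rewrite -ge0_integralZl//; last 3 first.
  - by apply/measurable_EFinP; exact: msec.
  - by move=> y _; rewrite lee_fin.
  - by rewrite lee_fin.
  by apply: eq_integral => y _; rewrite -EFinM -big_split.
rewrite [LHS](@poisson_mean_mixture _ A R U rho rho_gt0 _ _ _ u)// EFinM -second_momentE -ge0_integralZl//; last first.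
- apply/measurable_EFinP; apply: measurableT_comp => //; apply: measurable_funM => //.
  exact: measurable_common_prob.
apply: eq_integral => s _; rewrite -EFinM -expRM_natl -expRD; congr (expR _)%:E.
have mus : measurable_fun setT (fun y => u (s, y)).
  exact: (measurableT_comp mu (pair1_measurable s)).
have finu := integral_bounded_fin U mus (fun y => u01 (s, y)).
(* Integration of the identity [(1 - x) * (1 - y) + x + y = 1 + x * y], arranged so that no extended
   real is subtracted. *)
suff : fine (\int[U]_y (u (s, y))%:E)%E + c + c = 1 + common_prob s.
  set m := fine _ => mE. have -> : m = 1 + common_prob s - c - c by lra. by ring.
apply: EFin_inj; rewrite !EFinD fineK// -{1}(Hc s.1) -(Hc s.2) -common_probE.
have mu_s : measurable_fun setT (fun y => (u (s, y))%:E) by exact/measurable_EFinP.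
have mH1 : measurable_fun setT (fun y => (H s.1 y)%:E).
  by apply/measurable_EFinP; exact: mHsec.
have mH2 : measurable_fun setT (fun y => (H s.2 y)%:E).
  by apply/measurable_EFinP; exact: mHsec.
have H0 x y : (0 <= (H x y)%:E)%E by rewrite lee_fin; have /andP[] := H01 x y.
have u0 y : (0 <= (u (s, y))%:E)%E by rewrite lee_fin; have /andP[] := u01 (s, y).
rewrite -(integral_one U) -!ge0_integralD//; first last.
- exact: emeasurable_funD.
- by move=> y _; exact: adde_ge0.
- by apply/measurable_EFinP; exact: mHH.
- by move=> y _; rewrite lee_fin; have /andP[] := HH01 s.1 s.2 y.
apply: eq_integral => y _; rewrite -!EFinD; congr EFin.
by rewrite /u /=; ring.
Qed.

Let lam : R := rho * expR (- rho * c).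

Let lam_gt0 : 0 < lam.
Proof. by rewrite mulr_gt0// expR_gt0. Qed.

Let mean_tip k : R := real_poisson_mean U rho (tip k).

Let bounded_centered :
  bounded_family (fun n t => (rho * isol n t - lam) ^+ 2).
Proof.
have [miso _] := bounded_isolation_prob; split=> [n|].
  by apply: measurable_funX; apply: measurable_funB => //; apply: measurable_funM => //; exact: miso.
exists ((rho + lam) ^+ 2) => n t; rewrite sqr_ge0 /=.
have z0 := isolation_prob_ge0 U H01 t; have z1 := isolation_prob_le1 t.
have w0 : 0 <= rho * isolation_prob U H t by rewrite mulr_ge0// ltW.
have w1 : rho * isolation_prob U H t <= rho by rewrite ler_piMr// ltW.
have l0 := lam_gt0; have rl0 : 0 <= rho + lam by rewrite addr_ge0 ?ltW.
rewrite -[leLHS]real_normK ?num_real// ler_sqr ?nnegrE// ler_norml.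
by move: l0 rho_gt0 => l0 r0; apply/andP; split; lra.
Qed.

Lemma variance_isolation_prob :
  real_poisson_mean U rho (fun n t => (rho * isol n t - lam) ^+ 2) =
  lam ^+ 2 * (second_moment - 1).
Proof.
have bz := bounded_isolation_prob.
have bzz := bounded_familyM bz bz.
have r2 : 0 <= rho ^+ 2 by exact: sqr_ge0.
have l2 : 0 <= lam ^+ 2 by exact: sqr_ge0.
have lr : 0 <= 2 * lam * rho by rewrite !mulr_ge0// ltW// lam_gt0.
(* The cross term of the square is moved to the left, because additivity of the mean is available
   for nonnegative families. *)
have : real_poisson_mean U rho (fun n t => (rho * isol n t - lam) ^+ 2 +
      2 * lam * rho * isol n t) =
    real_poisson_mean U rho (fun n t => rho ^+ 2 * (isol n t * isol n t) + lam ^+ 2).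
  by apply: eq_real_poisson_mean => n t; ring.
rewrite !real_poisson_meanD//; last 3 first.
- exact: bounded_familyZ.
- exact: bounded_family_cst.
- exact: bounded_familyZ.
rewrite (real_poisson_mean_cst U rho_gt0 l2) !real_poisson_meanZ// mean_isolation_prob.
rewrite mean_sqr_isolation_prob => /(canRL (addrK _)) ->.
by rewrite /lam; ring.
Qed.

Lemma mean_tuple_isolated_probS k :
  k.+1%:R * mean_tip k.+1 =
  real_poisson_mean U rho (fun n t => rho * isol n t * tip k n t).
Proof.
rewrite /mean_tip -real_poisson_meanZ//; last exact: bounded_tuple_isolated_prob.
by congr fine; exact: mecke.
Qed.

Let bounded_isol_tip k :
  bounded_family (fun n t => rho * isol n t * tip k n t).
Proof.
apply: bounded_familyM (bounded_tuple_isolated_prob k).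
by apply: bounded_familyZ; [exact: ltW|exact: bounded_isolation_prob].
Qed.

(** By Mecke's formula the difference is the mean of [Z - lam] weighted by a number in [0, 1].
    Pointwise, [|D| <= e + D ^+ 2 / e], which brings in the variance; the choice of [e] is left to
    balance the two terms. *)
Lemma stein_bound k (e : R) : 0 < e ->
  `|k.+1%:R * mean_tip k.+1 - lam * mean_tip k| <=
  e + lam ^+ 2 * (second_moment - 1) / e.
Proof.
move=> e0; rewrite mean_tuple_isolated_probS.
have bt := bounded_tuple_isolated_prob k.
have bD := bounded_centered.
have e_ge0 := ltW e0; have ei_ge0 : 0 <= e^-1 by rewrite invr_ge0.
have l0 := ltW lam_gt0.
rewrite -variance_isolation_prob.
have bC : bounded_family (fun n (t : n.-tuple A) => e + e^-1 * (rho * isol n t - lam) ^+ 2).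
  by apply: bounded_familyD; [exact: bounded_family_cst|exact: bounded_familyZ].
have CE : real_poisson_mean U rho (fun n t => e + e^-1 * (rho * isol n t - lam) ^+ 2) =
   e + real_poisson_mean U rho (fun n t => (rho * isol n t - lam) ^+ 2) / e.
  rewrite real_poisson_meanD ?real_poisson_mean_cst ?real_poisson_meanZ//.
  - by rewrite mulrC.
  - exact: bounded_family_cst.
  - exact: bounded_familyZ.
have key (D x : R) : 0 <= x <= 1 -> `|D * x| <= e + e^-1 * D ^+ 2.
  move=> /andP[x0 x1]; rewrite normrM (ger0_norm x0).
  apply: (@le_trans _ _ `|D|); first by rewrite ler_piMr.
  rewrite -(ler_pM2l e0) mulrDr mulrA divff ?gt_eqF// mul1r -[D ^+ 2]real_normK ?num_real//.
  by have := normr_ge0 D; set a := `|D|; nra.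
have tip01 n t : 0 <= tip k n t <= 1.
  by rewrite tuple_isolated_prob_ge0// tuple_isolated_prob_le1.
rewrite -CE ler_distl; apply/andP; split.
  rewrite lerBlDr /mean_tip -real_poisson_meanZ// -real_poisson_meanD//.
  apply: le_real_poisson_mean => //; [exact: bounded_familyZ|exact: bounded_familyD|].
  move=> n t; have := key (rho * isol n t - lam) _ (tip01 n t).
  by rewrite mulrBl ler_norml => /andP[+ _]; lra.
rewrite /mean_tip -real_poisson_meanZ// -real_poisson_meanD//; last exact: bounded_familyZ.
apply: le_real_poisson_mean => //.
  by apply: bounded_familyD => //; exact: bounded_familyZ.
move=> n t; have := key (rho * isol n t - lam) _ (tip01 n t).
by rewrite mulrBl ler_norml => /andP[_]; lra.
Qed.

(** By Mecke's formula the sum is the mean of [Z] weighted by the probability of having fewer than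
    [N] isolated vertices, hence at most the mean of [Z]. *)
Lemma stein_tail N : \sum_(k < N) k.+1%:R * mean_tip k.+1 <= lam.
Proof.
under eq_bigr do rewrite mean_tuple_isolated_probS.
rewrite -(@real_poisson_mean_sum _ _ _ U rho rho_gt0 N
  (fun k n t => rho * isol n t * tip k n t))//.
rewrite /lam -mean_isolation_prob -real_poisson_meanZ ?(ltW rho_gt0)//; last first.
  exact: bounded_isolation_prob.
apply: le_real_poisson_mean => //.
- split=> [n|].
    by apply: measurable_sum => i; have [+ _] := bounded_isol_tip i; exact.
  exists (rho * 1) => n t; rewrite -mulr_sumr.
  have z0 := isolation_prob_ge0 U H01 t; have z1 := isolation_prob_le1 t.
  have s0 : 0 <= \sum_(i < N) tip i n t.
    by apply: sumr_ge0 => i _; exact: tuple_isolated_prob_ge0.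
  rewrite !mulr_ge0 ?(ltW rho_gt0)//= -mulrA ler_pM2l// mulr_ile1//.
  exact: sum_tuple_isolated_prob_le1.
- by apply: bounded_familyZ; [exact: ltW|exact: bounded_isolation_prob].
move=> n t; rewrite -mulr_sumr ler_piMr ?mulr_ge0 ?(ltW rho_gt0)//.
  exact: (isolation_prob_ge0 U H01).
exact: sum_tuple_isolated_prob_le1.
Qed.

End stein.

(** * The law of the number of isolated nodes of the network *)

Section isolated_law.
Context {R : realType} d (T : measurableType d) (P : probability T R).
Local Notation plane := (measurableTypeR R * measurableTypeR R)%type.
Variables (rho : R) (h : R -> R) (G : random_graph R T).
Hypotheses (rho_gt0 : 0 < rho) (PG : is_random_connection_network P rho h G).

Definition torus_kernel (x y : plane) : R := h (tdist x y).

Hypotheses (mh : measurable_fun setT (fun p : plane * plane => torus_kernel p.1 p.2))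
  (h01 : forall x y, 0 <= torus_kernel x y <= 1)
  (hsym : forall x y, torus_kernel x y = torus_kernel y x).

Let PX : is_poisson_process P rho (nodes G) := PG.1.

Let mgw n (e : {ffun 'I_n * 'I_n -> bool}) :
  measurable_fun [set: n.-tuple plane]
    (fun t => graph_weight (kernel_matrix torus_kernel t) e).
Proof. exact: (measurable_graph_weight mh). Qed.

Let gw0 n (e : {ffun 'I_n * 'I_n -> bool}) (t : n.-tuple plane) :
  0 <= graph_weight (kernel_matrix torus_kernel t) e.
Proof. by apply: graph_weight_ge0 => i j; exact: h01. Qed.

Lemma prob_isolated_size k n :
  (P (isolated_event G k `&` size_event (nodes G) n) =
   (poisson_weight rho n)%:E *
   \int[power_prob unif n]_t (tuple_isolated_prob torus_kernel k t)%:E)%E.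
Proof.
have mnt : measurable_fun setT (node_tuple (nodes G) n).
  exact: (measurable_node_tuple PX).
pose Q (e : {ffun 'I_n * 'I_n -> bool}) :=
  simple_graph e && (nb_isolated_vertices e == k).
transitivity (\sum_(e | Q e) P (graph_event G e))%E.
  rewrite (isolated_eventE PG).
  (* Matrices that are not simple may share a [graph_event]; replacing their events by the empty set
     makes the whole family disjoint. *)
  rewrite (_ : mkset _ = [set w | exists2 e, Q e &
      (if simple_graph e then graph_event G e else set0) w]); last first.
    apply/seteqP; split => w /= [e Qe]; have /andP[se _] := Qe.
      by exists e => //; rewrite se.
    by rewrite se; exists e.
  rewrite measure_fin_partition; last 2 first.
  - by move=> e; case: ifP => // _; exact: (measurable_graph_event PG).
  - move=> e f w; case: ifP => // se; case: ifP => // sf.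
    exact: (graph_event_disjoint se sf).
  by apply: eq_bigr => e /andP[-> _].
rewrite -(poisson_symmetric_integral rho_gt0 PX (n := n)
  (F := fun t => (tuple_isolated_prob torus_kernel k t)%:E)); last 3 first.
- by apply/measurable_EFinP; exact: measurable_tuple_isolated_prob.
- by move=> t; rewrite lee_fin; exact: tuple_isolated_prob_ge0.
- by move=> s t; rewrite tuple_isolated_prob_permute.
rewrite /tuple_isolated_prob /isolated_prob.
under [RHS]eq_integral do rewrite -sumEFin big_mkcond.
rewrite ge0_integral_sum//; last 3 first.
- exact: (measurable_size_event PX).
- move=> e; case: (_ && _) => //; apply: measurable_funTS; apply/measurable_EFinP.
  exact: (measurableT_comp (@mgw n e) mnt).
- by move=> e w _; case: ifP => // _; rewrite lee_fin.
rewrite big_mkcond; apply: eq_bigr => e _; rewrite /Q; case: ifP => _.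
  exact: (prob_graph_event PG).
by rewrite integral0.
Qed.

Lemma prob_isolated_event k :
  P (isolated_event G k) =
  poisson_mean unif rho (fun n t => (tuple_isolated_prob torus_kernel k t)%:E).
Proof.
rewrite isolated_event_bigcup measure_bigcup//.
- under eq_eseriesl do rewrite in_setT.
  by apply: eq_eseriesr => n _; exact: prob_isolated_size.
- by move=> n _; exact: (measurable_isolated_size PG).
- by move=> m n _ _ [w [[_ sm] [_ sn]]]; rewrite -(sm : size _ = m).
Qed.

Definition isolated_law k : R := fine (P (isolated_event G k)).

Lemma isolated_lawE k : P (isolated_event G k) = (isolated_law k)%:E.
Proof.
rewrite /isolated_law fineK// fin_num_measure//.
exact: (measurable_isolated_event PG).
Qed.

Lemma isolated_law_ge0 k : 0 <= isolated_law k.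
Proof. exact: fine_ge0. Qed.

Let trivI : trivIset setT (isolated_event G).
Proof. by move=> j k _ _ [w [/= <- <-]]. Qed.

Lemma prob_nb_isolated_lt N :
  P [set w | (nb_isolated G w < N)%N] = (\sum_(k < N) isolated_law k)%:E.
Proof.
rewrite -sumEFin (eq_bigr (fun k : 'I_N => P (isolated_event G k))); last first.
  by move=> k _; exact/esym/isolated_lawE.
rewrite (_ : mkset _ = [set w | exists2 k : 'I_N, xpredT k & isolated_event G k w]).
  rewrite measure_fin_partition//; first by move=> k; exact: (measurable_isolated_event PG).
  by move=> i j w /= wi wj; apply: val_inj; rewrite /= -wi -wj.
apply/seteqP; split => w /=; first by move=> wN; exists (Ordinal wN).
by move=> [k _ ->].
Qed.

Lemma sum_isolated_law_le1 N : \sum_(k < N) isolated_law k <= 1.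
Proof.
rewrite -lee_fin -prob_nb_isolated_lt; apply: probability_le1.
rewrite (_ : mkset _ = \bigcup_(k in `I_N) isolated_event G k).
  by apply: fin_bigcup_measurable => // k _; exact: (measurable_isolated_event PG).
apply/seteqP; split => w /=; first by move=> wN; exists (nb_isolated G w).
by move=> [k kN ->].
Qed.

(** Total mass 1, in a form usable with finite partial sums. *)
Lemma sum_isolated_law_ge (x : R) :
  (forall N, \sum_(k < N) isolated_law k <= x) -> 1 <= x.
Proof.
move=> sx; rewrite -lee_fin -(probability_setT P).
rewrite (_ : [set: T] = \bigcup_k isolated_event G k); last first.
  by apply/seteqP; split => w // _; exists (nb_isolated G w).
rewrite measure_bigcup//; last by move=> k _; exact: (measurable_isolated_event PG).
under eq_eseriesl do rewrite in_setT.
apply: lime_le; first by apply: is_cvg_nneseries => k _ _.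
apply: nearW => N; rewrite big_mkord (eq_bigr (fun k : 'I_N => (isolated_law k)%:E)).
  by rewrite sumEFin lee_fin; exact: sx.
by move=> k _; exact: isolated_lawE.
Qed.

Variable c : R.
Hypothesis hc : forall x, (\int[unif]_y (torus_kernel x y)%:E = c%:E)%E.

Let lam : R := rho * expR (- rho * c).

Let lawE k : isolated_law k =
  real_poisson_mean unif rho (fun n t => tuple_isolated_prob torus_kernel k t).
Proof. by rewrite /isolated_law prob_isolated_event. Qed.

Lemma isolated_law_stein k (e : R) : 0 < e ->
  `|k.+1%:R * isolated_law k.+1 - lam * isolated_law k| <=
  e + lam ^+ 2 * (second_moment unif rho torus_kernel - 1) / e.
Proof. by move=> e0; rewrite !lawE; exact: stein_bound. Qed.

(** Markov's inequality for the number of isolated nodes, whose truncated means are bounded by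
    [stein_tail]. *)
Lemma isolated_law_tail N : 1 - \sum_(k < N.+1) isolated_law k <= lam / N.+1%:R.
Proof.
rewrite lerBlDl; apply: sum_isolated_law_ge => M.
have tail L : \sum_(k < L) k.+1%:R * isolated_law k.+1 <= lam.
  by under eq_bigr do rewrite lawE; exact: stein_tail.
have lam0 : 0 <= lam / N.+1%:R.
  by rewrite divr_ge0// mulr_ge0 ?expR_ge0// ltW.
have [MN|NM] := leqP M N.+1.
  rewrite (big_ord_widen _ isolated_law MN) big_mkcond/= -[leLHS]addr0 lerD//.
  by apply: ler_sum => k _; case: ifP => // _; exact: isolated_law_ge0.
rewrite -(subnKC (ltnW NM)) big_split_ord/= lerD2l ler_pdivlMr ?ltr0n//.
(* The summation index of [stein_tail] is one less than the number of isolated nodes: [k < M - 1]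
   covers the numbers from 1 to [M - 1]. *)
apply: le_trans (tail (M - 1)%N).
have MS : (M - 1 = N + (M - N.+1))%N.
  by case: M NM => // M' NM; rewrite !subSS subn0 subnKC// -ltnS ltnW.
rewrite MS big_split_ord /= -[leLHS]add0r lerD//.
  by apply: sumr_ge0 => k _; rewrite mulr_ge0// isolated_law_ge0.
rewrite mulr_suml; apply: ler_sum => k _; rewrite addSn mulrC.
by rewrite ler_wpM2r ?isolated_law_ge0// ler_nat ltnS leq_addr.
Qed.

End isolated_law.

(** * Geometry of the torus *)

Section lebesgue_affine.
Context {R : realType}.
Local Notation mu := (@lebesgue_measure R).
Local Open Scope ereal_scope.

Section affine.
Variables (a c : R).
Hypothesis a0 : (0 < a)%R.

Let phi (x : measurableTypeR R) : measurableTypeR R := (a * x + c)%R.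

Let mphi : measurable_fun setT phi.
Proof.
by apply: measurable_funD => //; apply: measurable_funM => //.
Qed.

HB.instance Definition _ := isMeasurableFun.Build _ _ _ _ phi mphi.

Lemma lebesgue_measure_affine (A : set (measurableTypeR R)) : measurable A ->
  mu A = a%:E * mu (phi @^-1` A).
Proof.
move=> mA.
have -> : mu A = mscale (NngNum (ltW a0)) (image_measure mu phi) A.
  apply: lebesgue_measure_unique => // _ [[u v]] _ <-.
  transitivity (a%:E * mu (phi @^-1` `]u, v]%classic)); last by [].
  rewrite (_ : phi @^-1` _ = `]((u - c) / a)%R, ((v - c) / a)%R]%classic).
    rewrite !lebesgue_measure_itv/= !lte_fin ltr_pM2r ?invr_gt0// ltrD2r.
    case: ifP => uv; last by rewrite mule0.
    by rewrite -!EFinD -EFinM; congr EFin; field; rewrite gt_eqF.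
  apply/seteqP; split => x; rewrite /= !in_itv/= /phi => /andP[ux xv].
    by rewrite ltr_pdivrMr// ler_pdivlMr//; apply/andP; split; rewrite mulrC; lra.
  move: ux xv; rewrite ltr_pdivrMr// ler_pdivlMr// => ux xv.
  by apply/andP; split; rewrite mulrC; lra.
by [].
Qed.

Lemma ge0_integral_affine (D : set R) (f : R -> \bar R) :
  measurable D -> measurable_fun setT f -> (forall x, 0 <= f x) ->
  \int[mu]_(x in D) f x = a%:E * \int[mu]_(x in phi @^-1` D) f (a * x + c)%R.
Proof.
move=> mD mf f0.
transitivity (\int[mscale (NngNum (ltW a0)) (image_measure mu phi)]_(x in D) f x).
  by apply: eq_measure_integral => A mA AD; exact: (lebesgue_measure_affine mA).
rewrite ge0_integral_mscale//; last exact: measurable_funTS.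
by rewrite ge0_integral_pushforward//; exact: measurable_funTS.
Qed.
End affine.

Implicit Types (u v w c : R) (f : R -> \bar R).

Lemma integral_itv_affine a c u v f : (0 < a)%R ->
  measurable_fun setT f -> (forall x, 0 <= f x) ->
  \int[mu]_(x in `[(a * u + c)%R, (a * v + c)%R[) f x =
  a%:E * \int[mu]_(x in `[u, v[) f (a * x + c)%R.
Proof.
move=> a0 mf f0; rewrite (ge0_integral_affine c a0)//; congr (_ * _).
congr (integral _ _ _); apply/seteqP; split => x; rewrite /= !in_itv/=.
  by rewrite lerD2r ltrD2r ler_pM2l// ltr_pM2l.
by rewrite lerD2r ltrD2r ler_pM2l// ltr_pM2l.
Qed.

Lemma integral_itv_shift c u v f :
  measurable_fun setT f -> (forall x, 0 <= f x) ->
  \int[mu]_(x in `[u, v[) f (x + c)%R = \int[mu]_(x in `[(u + c)%R, (v + c)%R[) f x.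
Proof.
move=> mf f0; have := @integral_itv_affine 1%R c u v f ltr01 mf f0.
by rewrite !mul1r mul1e => ->; apply: eq_integral => x _; rewrite mul1r.
Qed.

Lemma integral_itv_split v u w f : (u <= v)%R -> (v <= w)%R ->
  measurable_fun setT f -> (forall x, 0 <= f x) ->
  \int[mu]_(x in `[u, w[) f x =
  \int[mu]_(x in `[u, v[) f x + \int[mu]_(x in `[v, w[) f x.
Proof.
move=> uv vw mf f0; rewrite -ge0_integral_setU//.
- congr (integral _ _ _); apply/seteqP; split => x; rewrite /= !in_itv/=.
    by move=> /andP[ux xw]; case: (ltP x v) => xv; [left|right]; rewrite ?ux ?xw.
  move=> [] /andP[h1 h2]; apply/andP; split => //; first exact: lt_le_trans vw.
  exact: le_trans h1.
- exact: measurable_funTS.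
- apply/disj_setPS => x [] /=; rewrite !in_itv/= => /andP[_ xv] /andP[vx _].
  by move: xv; rewrite ltNge vx.
Qed.

Definition periodic1 (f : R -> \bar R) := forall x, f (x + 1)%R = f x.

Lemma periodic1_nat f (n : nat) x : periodic1 f -> f (x + n%:R)%R = f x.
Proof.
move=> pf; elim: n => [|n IH]; first by rewrite addr0.
by rewrite -natr1 addrA pf.
Qed.

Lemma periodic1_int f (z : int) x : periodic1 f -> f (x + z%:~R)%R = f x.
Proof.
move=> pf; case: z => n; first exact: periodic1_nat.
by rewrite NegzE mulrNz -(periodic1_nat n.+1 (x - _)%R pf) subrK.
Qed.

(** An integer translation brings [u] to some [v] in the standard period; the part of the interval
    beyond [2^-1] is then moved back by 1. *)
Lemma integral_periodic u f : periodic1 f ->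
  measurable_fun setT f -> (forall x, 0 <= f x) ->
  \int[mu]_(x in `[u, (u + 1)%R[) f x = \int[mu]_(x in `[(- 2^-1)%R, (2^-1)%R[) f x.
Proof.
move=> pf mf f0.
pose z := Num.floor (u + 2^-1); pose v : R := (u - z%:~R)%R.
have /andP[zle zlt] := floor_itv (u + 2^-1).
have v1 : (- 2^-1 <= v)%R by rewrite /v -/z in zle zlt *; lra.
have v2 : (v < 2^-1)%R by move: zlt; rewrite intrD mulr1z /v -/z; lra.
transitivity (\int[mu]_(x in `[v, (v + 1)%R[) f x).
  transitivity (\int[mu]_(x in `[v, (v + 1)%R[) f (x + z%:~R)%R).
    by rewrite integral_itv_shift// /v subrK addrAC subrK.
  by apply: eq_integral => x _; exact: periodic1_int.
have h : (- 2^-1 + 1 = 2^-1 :> R)%R by lra.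
have v12 := ltW v2; have v3 : (2^-1 <= v + 1)%R by lra.
rewrite (@integral_itv_split (2^-1)%R v)//.
rewrite [RHS](@integral_itv_split v)//.
rewrite addeC; congr (_ + _).
transitivity (\int[mu]_(x in `[(- 2^-1)%R, v[) f (x + 1)%R).
  by rewrite integral_itv_shift// h.
by apply: eq_integral => x _; exact: pf.
Qed.

Lemma integral_periodic_shift c f : periodic1 f ->
  measurable_fun setT f -> (forall x, 0 <= f x) ->
  \int[unif1]_x f (x + c)%R = \int[unif1]_x f x.
Proof.
move=> pf mf f0; rewrite !ge0_integral_mrestr//; last first.
  exact: (measurableT_comp mf (measurable_funD _ _)).
rewrite /period integral_itv_shift//.
rewrite (_ : (2^-1 + c)%R = (- 2^-1 + c + 1)%R); last by lra.
exact: integral_periodic.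
Qed.

(** Reflection exchanges the closed and the open end of the period, and end points are
    negligible. *)
Lemma integral_unif1N f : periodic1 f ->
  measurable_fun setT f -> (forall x, 0 <= f x) ->
  \int[unif1]_x f (- x)%R = \int[unif1]_x f x.
Proof.
move=> pf mf f0; rewrite !ge0_integral_mrestr//; last first.
  exact: (measurableT_comp mf).
rewrite /period.
have mN : measurable_fun setT (-%R : measurableTypeR R -> measurableTypeR R) by apply: (@measurable_funN _ _ _ _ id).
transitivity (\int[pushforward mu (-%R : measurableTypeR R -> measurableTypeR R)]_(x in `](- 2^-1)%R, (2^-1)%R]) f x).
  rewrite ge0_integral_pushforward//; last exact: measurable_funTS.
  congr (integral _ _ _); apply/seteqP; split => x; rewrite /= !in_itv/= => /andP[? ?]; apply/andP; split; lra.
transitivity (\int[mu]_(x in `](- 2^-1)%R, (2^-1)%R]) f x).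
  by apply: eq_measure_integral => A mA _; exact: lebesgue_measureN.
rewrite integral_itv_bndoo; last exact: measurable_funTS.
by rewrite [RHS]integral_itv_bndoo//; exact: measurable_funTS.
Qed.

End lebesgue_affine.

(** * Distances on the circle and on the torus *)

Section circle_dist.
Context {R : realType}.
Implicit Types t : R.

(** The distance from [t] to the nearest integer. *)
Definition circle_dist t : R :=
  Num.min (t - (Num.floor t)%:~R) (1 - (t - (Num.floor t)%:~R)).

Lemma circle_dist_ge0 t : 0 <= circle_dist t.
Proof.
have /andP[h1 h2] := floor_itv t; rewrite intrD mulr1z in h2.
by rewrite /circle_dist le_min; apply/andP; split; lra.
Qed.

Lemma circle_dist_le_half t : circle_dist t <= 2^-1.
Proof. by rewrite /circle_dist ge_min; apply/orP; case: (leP (t - (Num.floor t)%:~R) 2^-1) => ?; [left|right]; lra. Qed.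

Lemma circle_dist_int t (z : int) : circle_dist (t + z%:~R) = circle_dist t.
Proof.
have -> : circle_dist (t + z%:~R) =
    Num.min (t + z%:~R - (Num.floor t + z)%:~R) (1 - (t + z%:~R - (Num.floor t + z)%:~R)).
  rewrite /circle_dist; congr (Num.min (_ - _%:~R) (1 - (_ - _%:~R)));
  apply: floor_def; have /andP[h1 h2] := floor_itv t;
  by rewrite addrAC !intrD !mulr1z in h2 *; apply/andP; split; lra.
by rewrite /circle_dist intrD; congr Num.min; ring.
Qed.

Lemma circle_dist1 t : circle_dist (t + 1) = circle_dist t.
Proof. exact: (circle_dist_int t 1). Qed.

Lemma circle_dist_le_norm t : circle_dist t <= `|t|.
Proof.
have /andP[h1 h2] := floor_itv t; rewrite intrD mulr1z in h2.
have hd := circle_dist_le_half t.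
have [t0|t0] := leP 0 t.
  rewrite (ger0_norm t0); have [t1|t1] := ltP t 1; last by lra.
  have -> : circle_dist t = Num.min t (1 - t).
    by rewrite /circle_dist (_ : Num.floor t = 0) ?subr0//; apply: floor_def; rewrite t0.
  by rewrite ge_min lexx.
rewrite (ltr0_norm t0); have [t1|t1] := ltP t (-1); first by lra.
have -> : circle_dist t = Num.min (t + 1) (- t).
  rewrite /circle_dist (_ : Num.floor t = -1).
    by rewrite mulrN1z opprK; congr Num.min; ring.
  by apply: floor_def; rewrite mulrN1z t1 addNr.
by rewrite ge_min lexx orbT.
Qed.

Lemma circle_dist_le t (z : int) : circle_dist t <= `|t + z%:~R|.
Proof. by rewrite -(circle_dist_int t z) circle_dist_le_norm. Qed.

Lemma circle_dist_attained t : exists z : int, `|t + z%:~R| = circle_dist t.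
Proof.
have /andP[h1 h2] := floor_itv t; rewrite intrD mulr1z in h2.
rewrite /circle_dist; set f := Num.floor t in h1 h2 *.
have [hm|hm] := leP (t - f%:~R) (1 - (t - f%:~R)).
  by exists (- f); rewrite intrN ger0_norm//; lra.
exists (- (f + 1)); rewrite intrN intrD mulr1z ler0_norm; last by lra.
by ring.
Qed.

Lemma circle_distN t : circle_dist (- t) = circle_dist t.
Proof.
suff H s : circle_dist (- s) <= circle_dist s.
  by apply/eqP; rewrite eq_le H -{1}[t]opprK H.
have [z <-] := circle_dist_attained s.
by rewrite -normrN opprD -intrN circle_dist_le.
Qed.

Lemma circle_dist_small t : `|t| <= 2^-1 -> circle_dist t = `|t|.
Proof.
move=> th; apply/eqP; rewrite eq_le circle_dist_le_norm/=.
have [z <-] := circle_dist_attained t.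
have [->|z0] := eqVneq z 0; first by rewrite addr0.
have z1 : 1 <= `|z%:~R : R|.
  by rewrite -intr_norm (ler_int _ 1) -gtz0_ge1 normr_gt0.
have : `|z%:~R| <= `|t + z%:~R| + `|t|.
  by rewrite -{1}[z%:~R](addKr t) addrC (le_trans (ler_normB _ _))// addrC.
lra.
Qed.

Lemma measurable_circle_dist : measurable_fun setT circle_dist.
Proof.
have mfl : measurable_fun setT (fun t : R => (Num.floor t)%:~R : R).
  by apply: nondecreasing_measurable => // s t st; rewrite ler_int le_floor.
have m1 : measurable_fun setT (fun t : R => t - (Num.floor t)%:~R) by exact: measurable_funB.
by apply: measurable_minr => //; exact: measurable_funB.
Qed.

(** The two integer coordinates of the translation can be optimized separately, and each optimum is
    attained. *)
Lemma tdistE (x y : R * R) : tdist x y =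
  Num.sqrt (circle_dist (x.1 - y.1) ^+ 2 + circle_dist (x.2 - y.2) ^+ 2).
Proof.
set S := [set enorm (x + (z.1%:~R, z.2%:~R) - y) | z in [set: int * int]].
have Slb : lbound S (Num.sqrt (circle_dist (x.1 - y.1) ^+ 2 + circle_dist (x.2 - y.2) ^+ 2)).
  move=> _ [[z1 z2] _ <-]; rewrite /enorm /= ler_wsqrtr//.
  rewrite (addrAC x.1) (addrAC x.2).
  by rewrite lerD// -[leRHS]real_normK ?num_real// ler_sqr ?nnegrE ?circle_dist_ge0// circle_dist_le.
apply/eqP; rewrite eq_le; apply/andP; split; last first.
  by apply: lb_le_inf => //; exists (enorm (x + (0%:~R, 0%:~R) - y)); exists (0, 0).
apply: ge_inf; first by exists (Num.sqrt (circle_dist (x.1 - y.1) ^+ 2 + circle_dist (x.2 - y.2) ^+ 2)).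
have [z1 z1E] := circle_dist_attained (x.1 - y.1).
have [z2 z2E] := circle_dist_attained (x.2 - y.2).
exists (z1, z2) => //; rewrite /enorm /= (addrAC x.1) (addrAC x.2).
by rewrite -z1E -z2E !real_normK ?num_real.
Qed.

Lemma circle_dist_antipode t : `|t| <= 4^-1 -> 4^-1 <= circle_dist (t + - 2^-1).
Proof.
have [z <-] := circle_dist_attained (t + - 2^-1).
rewrite ler_norml => /andP[t1 t2]; have [z0|z0] := leP z 0.
  have z0' : z%:~R <= 0 :> R by rewrite (ler_int R z 0).
  by rewrite ler0_norm; lra.
have z1 : 1 <= z%:~R :> R by rewrite (ler_int R 1 z) -gtz0_ge1.
by rewrite ger0_norm; lra.
Qed.

End circle_dist.

(** * Overlap of two translates of a monotone profile on the circle *)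

Section circle_overlap.
Context {R : realType}.
Local Notation mu := (@lebesgue_measure R).
Variable m : R -> R.
Hypotheses (m0 : forall s, 0 <= m s)
  (m_noninc : forall s t : R, 0 <= s -> s <= t -> m t <= m s).

Let M (u : R) : R := m (circle_dist u).

Let mM : measurable_fun setT M.
Proof.
have mm : measurable_fun setT (fun s : R => m (Num.max 0 s)).
  apply: nonincreasing_measurable => // s t st; apply: m_noninc.
    by rewrite le_max lexx.
  by rewrite ge_max le_max lexx /= le_max st orbT.
have -> : M = (fun s : R => m (Num.max 0 s)) \o circle_dist.
  by apply/funext => u /=; rewrite max_r// circle_dist_ge0.
exact: measurableT_comp mm measurable_circle_dist.
Qed.

Let mMs (c : R) : measurable_fun setT (fun u : R => (M (u + c))%:E).
Proof.
by apply/measurable_EFinP; apply: (measurableT_comp mM); exact: measurable_funD.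
Qed.

Let mM0 : measurable_fun setT (fun u : R => (M u)%:E).
Proof. exact/measurable_EFinP. Qed.

Let pM (c : R) : periodic1 (fun u => (M (u + c))%:E).
Proof. by move=> u; rewrite /M addrAC circle_dist1. Qed.

Let M0 u : (0 <= (M u)%:E)%E.
Proof. by rewrite lee_fin; exact: m0. Qed.

(* On the half circle of points closer to [t] than to [0] the minimum is at
   most [M u], on the other half at most [M (u - t)]; the gain is the difference
   of the integrals of [M] around [0] and around the antipode of [0]. *)
Lemma circle_overlap_pos (t tau : R) : 0 < tau -> tau <= t -> t <= 2^-1 ->
  (\int[unif1]_u (Num.min (M u) (M (u - t)))%:E + (tau * m (tau / 2))%:E <=
   \int[unif1]_u (M u)%:E + (tau * m (4^-1))%:E)%E.
Proof.
move=> tau0 taut t2.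
have a1 : t / 2 - 2^-1 <= t / 2 by lra.
have a2 : t / 2 <= t / 2 + 2^-1 by lra.
have a3 : t / 2 - 2^-1 - t <= t / 2 - 2^-1 by lra.
have a4 : t / 2 - 2^-1 <= t / 2 - t by lra.
have a5 : t / 2 - 2^-1 <= - (t / 2) by lra.
have a6 : - (t / 2) <= t / 2 by lra.
have b1 : - (t / 2) <= - (tau / 2) by lra.
have b2 : - (tau / 2) <= t / 2 by lra.
have b3 : - (tau / 2) <= tau / 2 by lra.
have b4 : tau / 2 <= t / 2 by lra.
pose F u := (Num.min (M u) (M (u - t)))%:E.
have mF : measurable_fun setT F.
  apply/measurable_EFinP; apply: measurable_minr => //.
  by apply/measurable_EFinP; exact: mMs.
have F0 u : (0 <= F u)%E by rewrite lee_fin le_min !m0.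
have pF : periodic1 F.
  by move=> u; rewrite /F; congr (Num.min _ _)%:E; rewrite /M ?circle_dist1// addrAC circle_dist1.
have pM0 : periodic1 (fun u => (M u)%:E) by move=> u; rewrite /M circle_dist1.
rewrite !ge0_integral_mrestr// -(integral_periodic (t / 2 - 2^-1) pF mF F0).
rewrite -[X in (_ <= X + _)%E](integral_periodic (t / 2 - 2^-1) pM0 mM0 M0).
have -> : t / 2 - 2^-1 + 1 = t / 2 + 2^-1 by lra.
rewrite (@integral_itv_split _ (t / 2) (t / 2 - 2^-1)) ?(@integral_itv_split _ (t / 2) (t / 2 - 2^-1) (t / 2 + 2^-1) (fun u => (M u)%:E))//.
rewrite addeAC [leRHS]addeAC; apply: leeD; last first.
  apply: ge0_le_integral => //; [exact: measurable_funTS|exact: measurable_funTS|].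
  by move=> u _; rewrite lee_fin ge_min lexx.
apply: (@le_trans _ _ (\int[mu]_(u in `[(t / 2 - 2^-1)%R, (t / 2)%R[) (M (u - t))%:E + (tau * m (tau / 2))%:E)%E).
  apply: leeD => //; apply: ge0_le_integral => //; [exact: measurable_funTS|exact: measurable_funTS (mMs _)|].
  by move=> u _; rewrite lee_fin ge_min lexx orbT.
rewrite (@integral_itv_shift _ (- t) _ _ (fun u => (M u)%:E))//.
(* Both intervals of length 1/2 contain the one from [t / 2 - 2^-1] to [- (t / 2)]. Its contribution
   cancels, which leaves two intervals of length [t], centred at [- 2^-1] and at 0. *)
rewrite (@integral_itv_split _ (t / 2 - 2^-1) (t / 2 - 2^-1 - t))//.
rewrite (@integral_itv_split _ (- (t / 2)) (t / 2 - 2^-1) (t / 2))//.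
have -> : t / 2 - t = - (t / 2) by lra.
rewrite addeAC -[leRHS]addeA [leRHS]addeC; apply: leeD => //.
have -> : t / 2 - 2^-1 - t = - (t / 2) + - 2^-1 by lra.
rewrite -(@integral_itv_shift _ (- 2^-1) _ _ (fun u => (M u)%:E))//.
pose N (u : R) := (M (u + - 2^-1))%:E.
have mN : measurable_fun setT N by exact: mMs.
have N0 u : (0 <= N u)%E by exact: M0.
rewrite [X in (X + _ <= _)%E](_ : _ = \int[mu]_(x in `[(- (t / 2))%R, (t / 2)%R[) N x)%E//.
have N4 u : `|u| <= 4^-1 -> (N u <= (m (4^-1))%:E)%E.
  by move=> u4; rewrite lee_fin; apply: m_noninc; rewrite ?circle_dist_antipode.
have NM u : `|u| <= 4^-1 -> (N u <= (M u)%:E)%E.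
  move=> u4; rewrite (le_trans (N4 u u4))// lee_fin /M circle_dist_small; last by lra.
  exact: m_noninc.
have itvN (a b : R) : - 4^-1 <= a -> b <= 4^-1 ->
    (\int[mu]_(u in `[a, b[) N u <= \int[mu]_(u in `[a, b[) (M u)%:E)%E.
  move=> ha hb; apply: ge0_le_integral => //; [exact: measurable_funTS|exact: measurable_funTS|].
  move=> u; rewrite /= in_itv/= => /andP[ua ub]; apply: NM.
  by rewrite ler_norml; apply/andP; split; lra.
(* The gain comes from the middle interval of length [tau], where [N] is at most [m 4^-1] and [M] at
   least [m (tau / 2)]. On the two outer intervals [N <= M] is enough. *)
rewrite (@integral_itv_split _ (- (tau / 2)) (- (t / 2)) (t / 2) N)//.
rewrite (@integral_itv_split _ (tau / 2) (- (tau / 2)) (t / 2) N)//.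
rewrite (@integral_itv_split _ (- (tau / 2)) (- (t / 2)) (t / 2) (fun u => (M u)%:E))//.
rewrite (@integral_itv_split _ (tau / 2) (- (tau / 2)) (t / 2) (fun u => (M u)%:E))//.
rewrite -[leLHS]addeA -[leRHS]addeA; apply: leeD; first by apply: itvN; lra.
rewrite [leLHS]addeAC [leRHS]addeAC; apply: leeD; last by apply: itvN; lra.
have cstE (k : R) : 0 <= k ->
    ((tau * k)%:E = \int[mu]_(u in `[(- (tau / 2))%R, (tau / 2)%R[) k%:E)%E.
  move=> k0; rewrite integral_cst//= lebesgue_measure_itv/= lte_fin ifT; last by lra.
  by rewrite -EFinD -EFinM; congr EFin; field.
rewrite !cstE// -!ge0_integralD//; last 4 first.
- exact: measurable_funTS.
- by move=> u _; rewrite lee_fin.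
- exact: measurable_funTS.
- by move=> u _; rewrite lee_fin.
apply: ge0_le_integral => //.
- by move=> u _; rewrite adde_ge0// lee_fin.
- by apply: emeasurable_funD => //; exact: measurable_funTS.
- by apply: emeasurable_funD => //; exact: measurable_funTS.
move=> u; rewrite /= in_itv/= => /andP[ua ub].
rewrite addeC; apply: leeD; last by apply: N4; rewrite ler_norml; apply/andP; split; lra.
have ut : `|u| <= tau / 2 by rewrite ler_norml; apply/andP; split; lra.
rewrite lee_fin /M circle_dist_small; last by lra.
exact: m_noninc.
Qed.

Lemma circle_overlap (s tau : R) : 0 < tau -> tau <= circle_dist s ->
  (\int[unif1]_u (Num.min (M u) (M (u + s)))%:E + (tau * m (tau / 2))%:E <=
   \int[unif1]_u (M u)%:E + (tau * m (4^-1))%:E)%E.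
Proof.
move=> tau0 taus; have [z zE] := circle_dist_attained s.
have s2 := circle_dist_le_half s.
have Mz u : M (u + s) = M (u + (s + z%:~R)) by rewrite /M addrA circle_dist_int.
under eq_integral do rewrite Mz.
have [sz|sz] := leP 0 (s + z%:~R); last first.
  have -> : s + z%:~R = - circle_dist s by rewrite -zE ltr0_norm// opprK.
  exact: circle_overlap_pos.
have -> : s + z%:~R = circle_dist s by rewrite -zE ger0_norm.
set t := circle_dist s in taus s2 *.
pose F u := (Num.min (M (u - t)) (M u))%:E.
have mF : measurable_fun setT F.
  apply/measurable_EFinP; apply: measurable_minr => //.
  by apply/measurable_EFinP; exact: mMs.
have F0 u : (0 <= F u)%E by rewrite lee_fin le_min !m0.
have pF : periodic1 F.
  by move=> u; rewrite /F; congr (Num.min _ _)%:E; rewrite /M ?circle_dist1// addrAC circle_dist1.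
have FE u : (Num.min (M u) (M (u + t)))%:E = F (u + t)%R by rewrite /F addrK.
under eq_integral do rewrite FE.
rewrite integral_periodic_shift//.
under eq_integral do rewrite /F minC.
exact: circle_overlap_pos.
Qed.

End circle_overlap.

(** * The connection kernel of the torus and its marginals *)

Section radial_kernel.
Context {R : realType}.
Local Notation plane := (measurableTypeR R * measurableTypeR R)%type.
Variables (g : R -> R) (r : R).
Hypotheses (r_gt0 : 0 < r) (g01 : forall x : R, 0 <= x -> 0 <= g x <= 1)
  (g_noninc : forall x y : R, 0 <= x -> x <= y -> g y <= g x).

Definition radial (s1 s2 : R) : R := g (Num.sqrt (s1 ^+ 2 + s2 ^+ 2) / r).

Let arg_ge0 (s1 s2 : R) : 0 <= Num.sqrt (s1 ^+ 2 + s2 ^+ 2) / r.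
Proof. by rewrite divr_ge0 ?sqrtr_ge0// ltW. Qed.

Lemma radial01 s1 s2 : 0 <= radial s1 s2 <= 1.
Proof. exact: g01. Qed.

Lemma radialC s1 s2 : radial s1 s2 = radial s2 s1.
Proof. by rewrite /radial addrC. Qed.

Lemma radial_noninc s1 s2 t1 t2 : 0 <= s1 -> s1 <= t1 -> 0 <= s2 -> s2 <= t2 ->
  radial t1 t2 <= radial s1 s2.
Proof.
move=> s10 st1 s20 st2; apply: g_noninc => //.
rewrite ler_pM2r ?invr_gt0// ler_wsqrtr// lerD// ler_sqr ?nnegrE//.
  exact: le_trans st1.
exact: le_trans st2.
Qed.

Lemma measurable_sqrt : measurable_fun setT (@Num.sqrt R).
Proof. by apply: nondecreasing_measurable => // x y; exact: ler_wsqrtr. Qed.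

Lemma measurable_profile : measurable_fun setT (fun s : R => g (Num.max 0 s)).
Proof.
apply: nonincreasing_measurable => // s t st; apply: g_noninc.
  by rewrite le_max lexx.
by rewrite ge_max le_max lexx /= le_max st orbT.
Qed.

Lemma measurable_radial d (T : measurableType d) (u v : T -> R) :
  measurable_fun setT u -> measurable_fun setT v ->
  measurable_fun setT (fun x => radial (u x) (v x)).
Proof.
move=> mu mv.
have -> : (fun x => radial (u x) (v x)) = (fun s : R => g (Num.max 0 s)) \o
    (fun x => Num.sqrt (u x ^+ 2 + v x ^+ 2) / r).
  by apply/funext => x /=; rewrite /radial max_r.
apply: measurableT_comp; first exact: measurable_profile.
apply: measurable_funM => //; apply: (measurableT_comp measurable_sqrt).
by apply: measurable_funD; exact: measurable_funX.
Qed.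

Local Notation TK := (torus_kernel (fun x => g (x / r))).
Local Notation dz := circle_dist.

Lemma torus_kernelE x y : TK x y = radial (dz (x.1 - y.1)) (dz (x.2 - y.2)).
Proof. by rewrite /torus_kernel tdistE. Qed.

Lemma torus_kernel01 x y : 0 <= TK x y <= 1.
Proof. by rewrite torus_kernelE radial01. Qed.

Lemma torus_kernel_sym x y : TK x y = TK y x.
Proof.
by rewrite !torus_kernelE -(circle_distN (x.1 - _)) -(circle_distN (x.2 - _)) !opprB.
Qed.

Lemma measurable_torus_kernel :
  measurable_fun setT (fun p : plane * plane => TK p.1 p.2).
Proof.
under eq_fun do rewrite torus_kernelE.
apply: measurable_radial; apply: (measurableT_comp measurable_circle_dist);
  apply: measurable_funB.
- exact: (measurableT_comp measurable_fst measurable_fst).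
- exact: (measurableT_comp measurable_fst measurable_snd).
- exact: (measurableT_comp measurable_snd measurable_fst).
- exact: (measurableT_comp measurable_snd measurable_snd).
Qed.

(** The kernel integrated over one coordinate, at distance [s] in the other. It is again
    nonincreasing, which reduces the overlap in the plane to the overlap on a circle. *)
Definition marginal (s : R) : R :=
  fine (\int[unif1]_v (radial s (dz v))%:E)%E.

Let mrad (s : R) : measurable_fun setT (fun v : R => radial s (dz v)).
Proof. by apply: measurable_radial => //; exact: measurable_circle_dist. Qed.

Lemma marginalE s :
  (\int[unif1]_v (radial s (dz v))%:E = (marginal s)%:E)%E.
Proof.
rewrite /marginal fineK// (@integral_bounded_fin _ _ _ unif1 _ 1)//.
  exact: mrad.
by move=> v; exact: radial01.
Qed.

Lemma marginal_ge0 s : 0 <= marginal s.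
Proof.
by apply: fine_ge0; apply: integral_ge0 => v _; rewrite lee_fin; have /andP[] := radial01 s (dz v).
Qed.

Lemma marginal_noninc s t : 0 <= s -> s <= t -> marginal t <= marginal s.
Proof.
move=> s0 st; rewrite -lee_fin -!marginalE; apply: ge0_le_integral => //.
- by move=> v _; rewrite lee_fin; have /andP[] := radial01 t (dz v).
- by apply/measurable_EFinP; exact: mrad.
- by apply/measurable_EFinP; exact: mrad.
- by move=> v _; rewrite lee_fin radial_noninc ?circle_dist_ge0.
Qed.

Lemma marginal_le1 s : marginal s <= 1.
Proof.
rewrite -lee_fin -marginalE -(integral_one (@unif1 R)); apply: ge0_le_integral => //.
- by move=> v _; rewrite lee_fin; have /andP[] := radial01 s (dz v).
- by apply/measurable_EFinP; exact: mrad.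
- by move=> v _; rewrite lee_fin; have /andP[] := radial01 s (dz v).
Qed.

Lemma integral_unif1_sub (c : R) (f : R -> \bar R) : periodic1 f ->
  measurable_fun setT f -> (forall x, 0 <= f x)%E ->
  (\int[unif1]_y f (c - y)%R = \int[unif1]_y f y)%E.
Proof.
move=> pf mf f0; pose F y := f (- y).
have pF : periodic1 F.
  by move=> y; rewrite /F -[in LHS](pf (- (y + 1))); congr f; ring.
have mF : measurable_fun setT F by apply: (measurableT_comp mf).
transitivity (\int[unif1]_y F (y + - c)%R)%E.
  by apply: eq_integral => y _; rewrite /F; congr f; ring.
rewrite integral_periodic_shift//; last by move=> x; exact: f0.
exact: integral_unif1N.
Qed.

Let mmarg : measurable_fun setT (fun u : R => marginal (dz u)).
Proof.
have mm : measurable_fun setT (fun s : R => marginal (Num.max 0 s)).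
  apply: nonincreasing_measurable => // s t st; apply: marginal_noninc.
    by rewrite le_max lexx.
  by rewrite ge_max le_max lexx /= le_max st orbT.
have -> : (fun u : R => marginal (dz u)) = (fun s : R => marginal (Num.max 0 s)) \o dz.
  by apply/funext => u /=; rewrite max_r// circle_dist_ge0.
exact: measurableT_comp mm measurable_circle_dist.
Qed.

(** The constant [c] of the overview: by translation invariance, the integral of the kernel around
    any point ([integral_torus_kernel]). *)
Definition degree : R := fine (\int[unif1]_u (marginal (dz u))%:E)%E.

Lemma degreeE : (\int[unif1]_u (marginal (dz u))%:E = degree%:E)%E.
Proof.
rewrite /degree fineK// (@integral_bounded_fin _ _ _ unif1 _ 1)//.
by move=> u; rewrite marginal_ge0 marginal_le1.
Qed.

Lemma degree_ge0 : 0 <= degree.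
Proof. by apply: fine_ge0; apply: integral_ge0 => u _; rewrite lee_fin marginal_ge0. Qed.

Lemma marginal_shift (s c : R) :
  (\int[unif1]_v (radial s (dz (c - v)))%:E = (marginal s)%:E)%E.
Proof.
rewrite (@integral_unif1_sub c (fun v => (radial s (dz v))%:E)) ?marginalE//.
- by move=> v; rewrite circle_dist1.
- by apply/measurable_EFinP; exact: mrad.
- by move=> v; rewrite lee_fin; have /andP[] := radial01 s (dz v).
Qed.

Let mTKsec x : measurable_fun setT (TK x).
Proof. exact: (measurableT_comp measurable_torus_kernel (pair1_measurable x)). Qed.

Lemma integral_torus_kernel x : (\int[unif]_y (TK x y)%:E = degree%:E)%E.
Proof.
rewrite integral_unif1; last 2 first.
- by apply/measurable_EFinP; exact: mTKsec.
- by move=> y; rewrite lee_fin; have /andP[] := torus_kernel01 x y.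
transitivity (\int[unif1]_u (marginal (dz (x.1 - u)))%:E)%E.
  apply: eq_integral => u _; rewrite -(marginal_shift _ x.2).
  by apply: eq_integral => v _; rewrite torus_kernelE.
rewrite (@integral_unif1_sub x.1 (fun u => (marginal (dz u))%:E)) ?degreeE//.
- by move=> v; rewrite circle_dist1.
- by apply/measurable_EFinP.
- by move=> v; rewrite lee_fin marginal_ge0.
Qed.

Let mTKK x x' : measurable_fun setT (fun y => (TK x y * TK x' y)%:E).
Proof. by apply/measurable_EFinP; exact: measurable_funM. Qed.

Let TKK0 x x' y : (0 <= (TK x y * TK x' y)%:E)%E.
Proof.
by rewrite lee_fin mulr_ge0//;
  [have /andP[] := torus_kernel01 x y|have /andP[] := torus_kernel01 x' y].
Qed.

Let min_marg_integral (a a' : R) tau : 0 < tau -> tau <= dz (a - a') ->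
  (\int[unif1]_u (Num.min (marginal (dz (a - u))) (marginal (dz (a' - u))))%:E +
    (tau * marginal (tau / 2))%:E <= (degree + tau * marginal (4^-1))%:E)%E.
Proof.
move=> tau0 taua; pose s := a' - a.
pose F u := (Num.min (marginal (dz u)) (marginal (dz (u + s))))%:E.
rewrite (_ : (\int[unif1]_u _)%E = (\int[unif1]_u F (a - u)%R)%E); last first.
  apply: eq_integral => u _; rewrite /F; congr (Num.min _ (marginal (dz _)))%:E.
  by rewrite /s; ring.
rewrite integral_unif1_sub; last 3 first.
- by move=> u; rewrite /F circle_dist1 (addrAC u 1) circle_dist1.
- apply/measurable_EFinP; apply: measurable_minr => //.
  by apply: (measurableT_comp mmarg); exact: measurable_funD.
- by move=> u; rewrite lee_fin le_min !marginal_ge0.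
rewrite EFinD -degreeE; apply: circle_overlap => //.
- exact: marginal_ge0.
- exact: marginal_noninc.
- by rewrite /s -circle_distN opprB.
Qed.

Let radial_prod_le (a a' s s' : R) :
  (\int[unif1]_v (radial s (dz (a - v)) * radial s' (dz (a' - v)))%:E <=
   (Num.min (marginal s) (marginal s'))%:E)%E.
Proof.
have msh (b c : R) : measurable_fun setT (fun v : R => radial c (dz (b - v))).
  by apply: (measurableT_comp (mrad c)); exact: measurable_funB.
rewrite EFin_min le_min; apply/andP; split.
  rewrite -(marginal_shift _ a); apply: ge0_le_integral => //.
  - move=> v _; rewrite lee_fin mulr_ge0//; first by have /andP[] := radial01 s (dz (a - v)).
    by have /andP[] := radial01 s' (dz (a' - v)).
  - by apply/measurable_EFinP; apply: measurable_funM; exact: msh.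
  - by apply/measurable_EFinP; exact: msh.
  - move=> v _; rewrite lee_fin; have /andP[? ?] := radial01 s (dz (a - v)).
    by have /andP[? ?] := radial01 s' (dz (a' - v)); rewrite ler_piMr.
rewrite -(marginal_shift _ a'); apply: ge0_le_integral => //.
- move=> v _; rewrite lee_fin mulr_ge0//; first by have /andP[] := radial01 s (dz (a - v)).
  by have /andP[] := radial01 s' (dz (a' - v)).
- by apply/measurable_EFinP; apply: measurable_funM; exact: msh.
- by apply/measurable_EFinP; exact: msh.
- move=> v _; rewrite lee_fin; have /andP[? ?] := radial01 s (dz (a - v)).
  by have /andP[? ?] := radial01 s' (dz (a' - v)); rewrite ler_piMl.
Qed.

Let mminmarg (a a' : R) : measurable_fun setT
  (fun u : R => (Num.min (marginal (dz (a - u))) (marginal (dz (a' - u))))%:E).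
Proof.
apply/measurable_EFinP; apply: measurable_minr;
  by apply: (measurableT_comp mmarg); exact: measurable_funB.
Qed.

(** The coordinate other than the separated one is integrated first: a product of two numbers in
    [0, 1] is at most each of them, so the result is at most the smaller of two marginals. The
    separated coordinate is then left to [circle_overlap]. *)
Lemma common_prob_far (s : plane * plane) tau : 0 < tau ->
  (tau <= dz (s.1.1 - s.2.1)) || (tau <= dz (s.1.2 - s.2.2)) ->
  common_prob unif TK s + tau * marginal (tau / 2) <=
  degree + tau * marginal (4^-1).
Proof.
move: s => [x x'] /= tau0 far; rewrite -lee_fin EFinD.
rewrite -(common_probE unif measurable_torus_kernel torus_kernel01 (x, x'))/=.
case/orP: far => far.
  apply: le_trans (min_marg_integral tau0 far); apply: leeD => //.
  rewrite integral_unif1//; apply: ge0_le_integral => //.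
  - by move=> u _; apply: integral_ge0 => v _; exact: TKK0.
  - apply: (@measurable_fun_fubini_tonelli_F _ _ _ _ R unif1 (fun y => (TK x y * TK x' y)%:E)) => //; exact: mTKK.
  - exact: mminmarg.
  move=> u _; apply: le_trans (radial_prod_le x.2 x'.2 _ _).
  rewrite le_eqVlt; apply/orP; left; apply/eqP; apply: eq_integral => v _.
  by rewrite (torus_kernelE x) (torus_kernelE x').
apply: le_trans (min_marg_integral tau0 far); apply: leeD => //.
rewrite integral_unif2//; apply: ge0_le_integral => //.
- by move=> u _; apply: integral_ge0 => v _; exact: TKK0.
- apply: (@measurable_fun_fubini_tonelli_G _ _ _ _ R unif1 (fun y => (TK x y * TK x' y)%:E)) => //; exact: mTKK.
- exact: mminmarg.
move=> v _; apply: le_trans (radial_prod_le x.1 x'.1 _ _).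
rewrite le_eqVlt; apply/orP; left; apply/eqP; apply: eq_integral => u _.
by rewrite (torus_kernelE x) (torus_kernelE x') radialC [X in _ * X]radialC.
Qed.

End radial_kernel.

Section mean_common_prob.
Context d (A : measurableType d) (R : realType) (U : probability A R).
Variables (H : A -> A -> R) (c : R).
Hypotheses (mH : measurable_fun setT (fun p : A * A => H p.1 p.2))
  (H01 : forall x y, 0 <= H x y <= 1) (Hsym : forall x y, H x y = H y x)
  (Hc : forall x, (\int[U]_y (H x y)%:E = c%:E)%E).

(** Given the common neighbour [y], the two points are independent and each is connected to [y] with
    probability [c]. *)
Lemma integral_common_prob :
  (\int[(U \x U)%E]_s (common_prob U H s)%:E = (c ^+ 2)%:E)%E.
Proof.
pose f (p : (A * A) * A) := (H p.1.1 p.2 * H p.1.2 p.2)%:E.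
have H0 x y : (0 <= (H x y)%:E)%E by rewrite lee_fin; have /andP[] := H01 x y.
have m1 : measurable_fun setT (fun p : (A * A) * A => H p.1.1 p.2).
  apply: (measurableT_comp mH (_ : measurable_fun setT (fun p : (A * A) * A => (p.1.1, p.2)))).
  apply/measurable_fun_pairP; split => /=; last exact: measurable_snd.
  exact: (measurableT_comp measurable_fst measurable_fst).
have m2 : measurable_fun setT (fun p : (A * A) * A => H p.1.2 p.2).
  apply: (measurableT_comp mH (_ : measurable_fun setT (fun p : (A * A) * A => (p.1.2, p.2)))).
  apply/measurable_fun_pairP; split => /=; last exact: measurable_snd.
  exact: (measurableT_comp measurable_snd measurable_fst).
have mf : measurable_fun setT f by apply/measurable_EFinP; exact: measurable_funM.
have f0 p : (0 <= f p)%E by rewrite /f EFinM mule_ge0.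
transitivity (\int[(U \x U)%E]_s \int[U]_y f (s, y))%E.
  by apply: eq_integral => s _; exact/esym/(common_probE U mH H01).
pose UU : probability (A * A)%type R := (U \x U)%E.
rewrite [LHS](@fubini_tonelli _ _ _ _ R UU U f mf f0)/= {}/UU.
have msec y : measurable_fun setT (fun x => (H x y)%:E).
  by apply/measurable_EFinP; exact: (measurableT_comp mH (pair2_measurable y)).
have Hc' y : (\int[U]_x (H x y)%:E = c%:E)%E.
  by rewrite -(Hc y); apply: eq_integral => x _; rewrite Hsym.
have c0 : (0 <= c%:E)%E by rewrite -(Hc point); exact: integral_ge0.
rewrite (eq_integral (fun=> (c ^+ 2)%:E)); last first.
  move=> y _; rewrite fubini_tonelli1//=; last first.
    exact: (measurableT_comp mf (pair2_measurable y)).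
  rewrite (eq_integral (fun x => (H x y)%:E * c%:E)%E); last first.
    move=> x _; rewrite /fubini_F /f /= -(Hc' y).
    by rewrite -ge0_integralZl//; apply: eq_integral => x' _; rewrite EFinM.
  by rewrite ge0_integralZr// Hc' -EFinM -expr2.
rewrite integral_cst// [X in (_ * X)%E](_ : _ = 1%E) ?mule1//.
exact: probability_setT.
Qed.
End mean_common_prob.

(** * Pairs of points that are close in both coordinates *)

Section near_pairs.
Context {R : realType}.
Local Notation plane := (measurableTypeR R * measurableTypeR R)%type.
Local Notation dz := circle_dist.
Variable tau : R.
Hypothesis tau0 : 0 < tau.

Definition near0 (t : R) : R := (dz t < tau)%R%:R.

Definition near_pair (s : plane * plane) : R :=
  near0 (s.1.1 - s.2.1) * near0 (s.1.2 - s.2.2).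

Lemma measurable_near0 : measurable_fun setT near0.
Proof.
have mstep : measurable_fun setT (fun x : R => (x < tau)%R%:R : R).
  apply: nonincreasing_measurable => // x y xy.
  by case: (ltP y tau) => // yt; rewrite (le_lt_trans xy yt).
exact: (measurableT_comp mstep measurable_circle_dist).
Qed.

Lemma integral_near0 : (\int[unif1]_u (near0 u)%:E <= (2 * tau)%:E)%E.
Proof.
rewrite ge0_integral_mrestr; last 2 first.
- by apply/measurable_EFinP; exact: measurable_near0.
- by move=> x; rewrite lee_fin.
apply: (@le_trans _ _ (\int[lebesgue_measure]_(x in period) (\1_(`[- tau, tau]%classic : set R) x)%:E)%E).
  apply: ge0_le_integral => //.
  - exact: measurable_period.
  - by move=> u _; rewrite lee_fin.
  - by apply: measurable_funTS; apply/measurable_EFinP; exact: measurable_near0.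
  - by apply: measurable_funTS; apply/measurable_EFinP; exact: measurable_indic.
  - move=> u; rewrite /period /= in_itv/= => /andP[u1 u2].
    rewrite lee_fin /near0 indicE.
    rewrite circle_dist_small; last by rewrite ler_norml u1 ltW.
    by case: ltP => //; rewrite ltr_norml => /andP[ut1 ut2]; rewrite mem_set//= in_itv/= !ltW.
rewrite integral_indic//; last exact: measurable_period.
apply: (@le_trans _ _ (lebesgue_measure (`[- tau, tau]%classic : set R))).
  apply: le_measure => //; rewrite inE//.
  by apply: measurableI => //; exact: measurable_period.
rewrite lebesgue_measure_itv/= lte_fin; case: ifP => _; last by rewrite lee_fin mulr_ge0 ?ltW.
by rewrite -EFinD lee_fin; lra.
Qed.

Lemma measurable_near_pair : measurable_fun setT near_pair.
Proof.
apply: measurable_funM; apply: (measurableT_comp measurable_near0); apply: measurable_funB.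
- exact: (measurableT_comp measurable_fst measurable_fst).
- exact: (measurableT_comp measurable_fst measurable_snd).
- exact: (measurableT_comp measurable_snd measurable_fst).
- exact: (measurableT_comp measurable_snd measurable_snd).
Qed.

Lemma integral_near_pair :
  (\int[(unif \x unif)%E]_s (near_pair s)%:E <= ((2 * tau) ^+ 2)%:E)%E.
Proof.
have n0 s : (0 <= (near_pair s)%:E)%E by rewrite lee_fin mulr_ge0.
have mn : measurable_fun setT (fun s => (near_pair s)%:E).
  by apply/measurable_EFinP; exact: measurable_near_pair.
have I0 : (0 <= \int[unif1]_u (near0 u)%:E)%E.
  by apply: integral_ge0 => u _; rewrite lee_fin.
have In (a : R) : (\int[unif1]_u (near0 (a - u))%:E <= (2 * tau)%:E)%E.
  rewrite (@integral_unif1_sub _ a (fun u => (near0 u)%:E)) ?integral_near0//.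
  - by move=> u; rewrite /near0 circle_dist1.
  - by apply/measurable_EFinP; exact: measurable_near0.
  - by move=> u; rewrite lee_fin.
have mna (a : R) : measurable_fun setT (fun u : R => (near0 (a - u))%:E).
  by apply/measurable_EFinP; apply: (measurableT_comp measurable_near0); exact: measurable_funB.
have In0 (a : R) : (0 <= \int[unif1]_u (near0 (a - u))%:E)%E.
  by apply: integral_ge0 => u _; rewrite lee_fin.
have inner x : (\int[unif]_y (near_pair (x, y))%:E <= ((2 * tau) ^+ 2)%:E)%E.
  rewrite integral_unif1//; last exact: (measurableT_comp mn (pair1_measurable x)).
  rewrite [leLHS](_ : _ = \int[unif1]_u ((near0 (x.1 - u)%R)%:E *
      \int[unif1]_v (near0 (x.2 - v)%R)%:E))%E; last first.
    apply: eq_integral => u _.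
    rewrite -ge0_integralZl ?lee_fin//; last by move=> v _; rewrite lee_fin.
    exact: mna.
  rewrite ge0_integralZr//; last by move=> v _; rewrite lee_fin.
  by rewrite expr2 EFinM; apply: lee_pmul.
  exact: mna.
rewrite [leLHS](@fubini_tonelli1 _ _ _ _ R unif unif (fun s => (near_pair s)%:E) mn n0).
apply: (@le_trans _ _ (\int[unif]_x ((2 * tau) ^+ 2)%:E)%E); last first.
  rewrite integral_cst// [X in (_ * X)%E](_ : _ = 1%E) ?mule1//.
  exact: probability_setT.
apply: ge0_le_integral => //.
- by move=> x _; exact: integral_ge0.
- exact: measurable_fun_fubini_tonelli_F.
- by move=> x _; exact: inner.
Qed.
End near_pairs.

(** * The second moment, split into near and far pairs *)

Section second_moment_bound.
Context {R : realType}.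
Local Notation plane := (measurableTypeR R * measurableTypeR R)%type.
Variables (g : R -> R) (r rho : R).
Hypotheses (rho_gt0 : 0 < rho) (r_gt0 : 0 < r)
  (g01 : forall x : R, 0 <= x -> 0 <= g x <= 1)
  (g_noninc : forall x y : R, 0 <= x -> x <= y -> g y <= g x).
Local Notation TK := (torus_kernel (fun x => g (x / r))).
Local Notation c := (degree g r).

(** Near pairs have small mass and are charged the maximal [expR (rho * c)]. For far pairs the
    overlap is at most [c - kappa], which is used in the exponential only: the factor [J] in front
    of it is kept and integrates to [c ^+ 2], whereas bounding it by [c] would lose a factor [c^-1],
    of order [rho / ln rho]. *)
Lemma second_moment_le tau kappa : 0 < tau ->
  kappa <= tau * (marginal g r (tau / 2) - marginal g r (4^-1)) ->
  second_moment unif rho TK <=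
  1 + rho * expR (rho * (c - kappa)) * c ^+ 2 + expR (rho * c) * (2 * tau) ^+ 2.
Proof.
move=> tau0 kappaE.
have mK := measurable_torus_kernel r_gt0 g_noninc.
have K01 := torus_kernel01 r_gt0 g01.
have Kc := integral_torus_kernel r_gt0 g01 g_noninc.
have J0 s : 0 <= common_prob unif TK s by exact: common_prob_ge0.
have mJ : measurable_fun setT (common_prob unif TK) by exact: measurable_common_prob.
pose B (s : plane * plane) := 1 + rho * expR (rho * (c - kappa)) * common_prob unif TK s +
   expR (rho * c) * near_pair tau s.
have np0 s : 0 <= near_pair tau s by rewrite mulr_ge0.
have a0 : 0 <= rho * expR (rho * (c - kappa)) by rewrite mulr_ge0 ?expR_ge0// ltW.
have le_expB s : expR (rho * common_prob unif TK s) <= B s.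
  rewrite /B; set J := common_prob unif TK s.
  have Jc : J <= c by exact: (common_prob_le mK K01 Kc s).
  have [/andP[n1 n2]|] := boolP ((circle_dist (s.1.1 - s.2.1) < tau) &&
      (circle_dist (s.1.2 - s.2.2) < tau)).
    rewrite /near_pair /near0 n1 n2 !mulr1.
    rewrite -[leLHS]add0r lerD//; first by rewrite addr_ge0// mulr_ge0// J0.
    by rewrite ler_expR ler_pM2l.
  rewrite negb_and -!leNgt => far.
  have := common_prob_far r_gt0 g01 g_noninc tau0 far; rewrite -/J => JE.
  have Jk : J <= c - kappa by move: JE kappaE; lra.
  rewrite -[leLHS]addr0 lerD ?mulr_ge0 ?expR_ge0//.
  (* This is [1 - y <= expR (- y)] multiplied by [expR y], for [y = rho * J]. *)
  apply: (@le_trans _ _ (1 + rho * J * expR (rho * J))).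
    have e0 := expR_gt0 (rho * J).
    have := expR_ge1Dx (- (rho * J)); rewrite expRN => h.
    have := ler_wpM2l (ltW e0) h; rewrite mulfV ?gt_eqF// mulrDr mulr1; lra.
  rewrite lerD2l -mulrA [J * _]mulrC mulrA ler_wpM2r ?J0// ler_pM2l// ler_expR.
  by rewrite ler_pM2l.
rewrite -lee_fin -(second_momentE rho_gt0 mK K01 Kc).
apply: (@le_trans _ _ (\int[(unif \x unif)%E]_s (B s)%:E)%E).
  apply: ge0_le_integral => //.
  - apply/measurable_EFinP; apply: measurableT_comp => //.
    exact: measurable_funM.
  - apply/measurable_EFinP; apply: measurable_funD; last first.
      by apply: measurable_funM => //; exact: measurable_near_pair.
    by apply: measurable_funD => //; exact: measurable_funM.
  - by move=> s _; rewrite lee_fin.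
have mJE : measurable_fun setT (fun s => (common_prob unif TK s)%:E).
  exact/measurable_EFinP.
have mnE : measurable_fun setT (fun s => (near_pair tau s)%:E).
  by apply/measurable_EFinP; exact: measurable_near_pair.
rewrite (eq_integral (fun s => 1 + (rho * expR (rho * (c - kappa)))%:E *
    (common_prob unif TK s)%:E + (expR (rho * c))%:E * (near_pair tau s)%:E)%E); last first.
  by move=> s _; rewrite /B !EFinD !EFinM.
have JE0 s : (0 <= (common_prob unif TK s)%:E)%E by rewrite lee_fin J0.
have nE0 s : (0 <= (near_pair tau s)%:E)%E by rewrite lee_fin.
have aE0 : (0 <= (rho * expR (rho * (c - kappa)))%:E)%E by rewrite lee_fin.
have eE0 : (0 <= (expR (rho * c))%:E)%E by rewrite lee_fin expR_ge0.
rewrite ge0_integralD//=; last 4 first.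
- by move=> s _; rewrite adde_ge0// mule_ge0.
- by apply: emeasurable_funD => //; exact: measurable_funeM.
- by move=> s _; rewrite mule_ge0.
- exact: measurable_funeM.
rewrite ge0_integralD//=; last 2 first.
- by move=> s _; rewrite mule_ge0.
- exact: measurable_funeM.
rewrite !ge0_integralZl// integral_one.
rewrite (integral_common_prob mK K01 (torus_kernel_sym g r) Kc).
rewrite EFinD; apply: leeD; first by rewrite !EFinD EFinM.
by rewrite (EFinM (expR _)); apply: lee_wpmul2l => //; exact: integral_near_pair.
Qed.
End second_moment_bound.

(** * Asymptotics of the degree and of the variance *)

Section radial_mass.
Context {R : realType}.
Local Notation plane := (measurableTypeR R * measurableTypeR R)%type.
Local Notation mu := (@lebesgue_measure R).
Variables (g : R -> R) (C : R).
Hypotheses (g01 : forall x : R, 0 <= x -> 0 <= g x <= 1)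
  (g_noninc : forall x y : R, 0 <= x -> x <= y -> g y <= g x)
  (CE : C%:E = (\int[leb2]_x (g (enorm x))%:E)%E) (C_gt0 : 0 < C).

(** Squares rather than disks, because the torus rescaled by [r] is the square with
    [L = (2 * r)^-1]. *)
Definition square (L : R) : set plane := `[- L, L[%classic `*` `[- L, L[%classic.

Lemma measurable_square L : measurable (square L).
Proof. by apply: measurableX; exact: measurable_itv. Qed.

Lemma leb2_square L : 0 <= L -> leb2 (square L) = ((2 * L) ^+ 2)%:E.
Proof.
move=> L0; rewrite [LHS](@product_measure1E _ _ _ _ R mu mu); try exact: measurable_itv.
rewrite /= !lebesgue_measure_itv/= !lte_fin; case: ifP => [_|/negbT].
  by rewrite -EFinD -EFinM; congr EFin; ring.
rewrite -leNgt => LL; have -> : L = 0 by lra.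
by rewrite mul0e mulr0 expr0n.
Qed.

Let enorm_ge0 (x : R * R) : 0 <= enorm x. Proof. exact: sqrtr_ge0. Qed.

Let f (x : plane) : \bar R := (g (enorm x))%:E.

Let f0 x : (0 <= f x)%E.
Proof. by rewrite lee_fin; have /andP[] := g01 (enorm_ge0 x). Qed.

Let mf : measurable_fun setT f.
Proof.
apply/measurable_EFinP.
have -> : (fun x : plane => g (enorm x)) = (fun x => radial g 1 x.1 x.2).
  by apply/funext => x; rewrite /radial divr1.
by apply: measurable_radial.
Qed.

Definition square_mass (L : R) : R := fine (\int[leb2]_(x in square L) f x)%E.

Lemma square_massE L : (\int[leb2]_(x in square L) f x = (square_mass L)%:E)%E.
Proof.
rewrite /square_mass fineK// ge0_fin_numE; last by apply: integral_ge0 => x _.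
apply: (@le_lt_trans _ _ C%:E); last by rewrite ltry.
rewrite CE; apply: ge0_subset_integral => //; exact: measurable_square.
Qed.

Lemma square_mass_le L : square_mass L <= C.
Proof.
rewrite -lee_fin -square_massE CE.
by apply: ge0_subset_integral => //; exact: measurable_square.
Qed.

Lemma enorm_ge_notin (s : R) (x : plane) : 0 <= s -> ~ square s x -> s <= enorm x.
Proof.
move=> s0 xs; rewrite /enorm leNgt; apply/negP => xlt; apply: xs.
have h (u v : R) : Num.sqrt (u ^+ 2 + v ^+ 2) < s -> - s <= u < s.
  move=> us; have : `|u| < s.
    by rewrite (le_lt_trans _ us)// -sqrtr_sqr ler_wsqrtr// lerDl sqr_ge0.
  by rewrite ltr_norml => /andP[/ltW -> ->].
split; rewrite /= in_itv/=; first exact: h xlt.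
by rewrite addrC in xlt; exact: h xlt.
Qed.

(** Outside the smaller square the function is at most [g s]; the area of the added region is
    bounded by that of the larger square, [16 * s ^+ 2]. *)
Lemma square_mass_double s : 0 <= s ->
  square_mass (2 * s) <= square_mass s + 16 * s ^+ 2 * g s.
Proof.
move=> s0; rewrite -lee_fin EFinD -!square_massE.
have mD : measurable (square (2 * s) `\` square s).
  by apply: measurableD; exact: measurable_square.
apply: (@le_trans _ _ (\int[leb2]_(x in square s `|` (square (2 * s) `\` square s)) f x)%E).
  apply: ge0_subset_integral => //.
  - exact: measurable_square.
  - by apply: measurableU => //; exact: measurable_square.
  - exact: measurable_funTS.
  - by move=> x x2; have [xs|xs] := pselect (square s x); [left|right].
rewrite ge0_integral_setU//; last 3 first.
- exact: measurable_square.
- exact: measurable_funTS.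
- by apply/disj_setPS => x [] xs [].
apply: leeD => //.
apply: (@le_trans _ _ (\int[leb2]_(x in square (2 * s) `\` square s) (g s)%:E)%E).
  apply: ge0_le_integral => //; first exact: measurable_funTS.
  by move=> x [_ xs]; rewrite lee_fin; apply: g_noninc => //; exact: enorm_ge_notin.
rewrite integral_cst//=.
rewrite [leRHS](_ : _ = (g s)%:E * (16 * s ^+ 2)%R%:E)%E; last by rewrite -EFinM mulrC.
apply: lee_wpmul2l.
  by rewrite lee_fin; have /andP[] := g01 s0.
apply: (@le_trans _ _ (leb2 (square (2 * s)))).
  by apply: le_measure; rewrite ?inE//; exact: measurable_square.
by rewrite leb2_square ?mulr_ge0// lee_fin !exprMn; lra.
Qed.

Lemma square_mass_sup (L x : R) : 0 < L ->
  (forall n, square_mass (2 ^+ n * L) <= x) -> C <= x.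
Proof.
move=> L0 Lx; have le2 (m n : nat) : (m <= n)%N -> 2 ^+ m * L <= 2 ^+ n * L.
  by move=> mn; rewrite ler_pM2r// ler_weXn2l// ler1n.
have nd : nondecreasing_seq (fun n => square (2 ^+ n * L)).
  move=> m n mn; apply/subsetPset => y [] /=; rewrite !in_itv/= => /andP[h1 h2] /andP[h3 h4].
  have := le2 _ _ mn; split; rewrite /= in_itv/=; apply/andP; split; lra.
have cover : \bigcup_n square (2 ^+ n * L) = setT.
  apply/seteqP; split => // y _.
  have [n yn] : exists n : nat, Num.max `|y.1| `|y.2| < 2 ^+ n * L.
    pose z := Num.max `|y.1| `|y.2| / L.
    have z0 : 0 <= z by rewrite divr_ge0 ?(ltW L0)// le_max normr_ge0.
    exists (Num.truncn z).+1; rewrite -ltr_pdivrMr//.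
    have /andP[_ zlt] := truncn_itv z0; apply: (lt_le_trans zlt).
    by rewrite -natrX ler_nat ltnW// ltn_expl.
  move: yn; rewrite gt_max !ltr_norml => /andP[/andP[h1 h2] /andP[h3 h4]].
  by exists n => //; split; rewrite /= in_itv/=; apply/andP; split=> //; exact: ltW.
have := @ge0_nondecreasing_set_cvg_integral _ _ R (fun n => square (2 ^+ n * L)) f leb2 nd
  (fun n => measurable_square _) (fun n => measurable_funTS mf) (fun n x _ => f0 x).
rewrite cover -CE => cvgC.
rewrite -lee_fin -(cvg_lim _ cvgC)//; apply: lime_le.
  by apply/cvg_ex; exists C%:E.
by apply: nearW => n; rewrite square_massE lee_fin.
Qed.

Lemma profile_gt0 : 0 < g (Num.sqrt C / 4).
Proof.
set a := Num.sqrt C / 4.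
have a0 : 0 < a by rewrite divr_gt0// sqrtr_gt0.
have /andP[ga0 _] := g01 (ltW a0); rewrite lt_neqAle ga0 andbT eq_sym.
apply/negP => /eqP ga.
have : (C%:E <= (C / 4)%:E)%E.
  rewrite CE.
  apply: (@le_trans _ _ (\int[leb2]_x (\1_(square a) x)%:E)%E).
    apply: ge0_le_integral => //.
    - by move=> x _; exact: f0.
    - by apply/measurable_EFinP; apply: measurable_indic; exact: measurable_square.
    move=> x _; rewrite lee_fin indicE; have [xa|xa] := pselect (square a x).
      by rewrite mem_set//; have /andP[] := g01 (enorm_ge0 x).
    by rewrite memNset// mulr0n -ga; apply: g_noninc; [exact: ltW|exact: enorm_ge_notin (ltW a0) xa].
  rewrite integral_indic//; last exact: measurable_square.
  rewrite setIT (leb2_square (ltW a0)) lee_fin /a.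
  have -> : (2 * (Num.sqrt C / 4)) ^+ 2 = Num.sqrt C ^+ 2 / 4 by field.
  by rewrite sqr_sqrtr// ltW.
by rewrite lee_fin; move: C_gt0; lra.
Qed.

End radial_mass.

(** * Rescaling of the degree and decay of the missing mass *)

Section degree_asymptotics.
Context {R : realType}.
Local Notation plane := (measurableTypeR R * measurableTypeR R)%type.
Local Notation mu := (@lebesgue_measure R).
Variables (g : R -> R) (C : R).
Hypotheses (g01 : forall x : R, 0 <= x -> 0 <= g x <= 1)
  (g_noninc : forall x y : R, 0 <= x -> x <= y -> g y <= g x)
  (CE : C%:E = (\int[leb2]_x (g (enorm x))%:E)%E) (C_gt0 : 0 < C).

Lemma ge0_integral_unif (f : plane -> \bar R) : measurable_fun setT f ->
  (forall x, 0 <= f x)%E ->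
  (\int[unif]_x f x = \int[leb2]_(x in (torus : set plane)) f x)%E.
Proof.
move=> mf f0; rewrite -(ge0_integral_mrestr leb2 measurable_torus mf f0).
by apply: eq_measure_integral => A mA _; exact: unifE.
Qed.

(** Seen from 0, [circle_dist] is the absolute value on the period, so the distance is Euclidean;
    what remains is a dilation by [r] in each coordinate. *)
Lemma degree_square_mass r : 0 < r ->
  degree g r = r ^+ 2 * square_mass g (2 * r)^-1.
Proof.
move=> r0; apply: EFin_inj.
have mK := measurable_torus_kernel r0 g_noninc.
have K01 := torus_kernel01 r0 g01.
pose TK0 (y : plane) := (torus_kernel (fun x => g (x / r)) 0 y)%:E.
have mTK0 : measurable_fun setT TK0.
  by apply/measurable_EFinP; exact: (measurableT_comp mK (pair1_measurable _)).
have TK00 y : (0 <= TK0 y)%E by rewrite lee_fin; have /andP[] := K01 0 y.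
rewrite -(integral_torus_kernel r0 g01 g_noninc 0) ge0_integral_unif//.
rewrite EFinM -(square_massE g01 g_noninc CE).
rewrite integral_mkcond [in RHS]integral_mkcond.
pose L := (2 * r)^-1.
pose k : plane -> \bar R := TK0 \_ torus.
pose f (x : plane) : \bar R := (g (enorm x))%:E.
have k0 x : (0 <= k x)%E by rewrite /k patchE; case: ifP.
have mk : measurable_fun setT k.
  by apply/(measurable_restrictT _ measurable_torus); exact: measurable_funTS.
have f0 x : (0 <= f x)%E.
  by rewrite lee_fin; have /andP[] := g01 (sqrtr_ge0 (x.1 ^+ 2 + x.2 ^+ 2)).
have mf : measurable_fun setT f.
  apply/measurable_EFinP.
  have -> : (fun x : plane => g (enorm x)) = (fun x => radial g 1 x.1 x.2).
    by apply/funext => x; rewrite /radial divr1.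
  exact: measurable_radial.
have kE u v : k (r * u + 0, r * v + 0) = (f \_ (square L)) (u, v).
  have itvE (x : R) : (`[- 2^-1, 2^-1[%classic (r * x + 0)) <-> (`[- L, L[%classic x).
    have rL : r * L = 2^-1 by rewrite /L; field; rewrite gt_eqF.
    by rewrite /= !in_itv/= addr0 -rL -mulrN ler_pM2l// ltr_pM2l.
  rewrite /k !patchE.
  have [[/= u1 v1]|nt] := pselect (torus (r * u + 0, r * v + 0)); last first.
    rewrite !memNset// => -[/= u1 v1]; apply: nt.
    by split; apply/itvE.
  rewrite !mem_set//; last by split; apply/itvE.
  rewrite /TK0 torus_kernelE /f /radial /=; congr (g _)%:E.
  have dzE (x : R) : `[- 2^-1, 2^-1[%classic x -> circle_dist (0 - x) ^+ 2 = x ^+ 2.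
    rewrite /= in_itv/= => /andP[x1 x2]; rewrite sub0r circle_distN circle_dist_small.
      by rewrite real_normK// num_real.
    by rewrite ler_norml x1 ltW.
  rewrite !dzE// !addr0 !exprMn -mulrDr sqrtrM ?sqr_ge0// sqrtr_sqr gtr0_norm//.
  by rewrite mulrC mulKf// gt_eqF.
transitivity (\int[mu]_u \int[mu]_v k (u, v))%E.
  exact: (@fubini_tonelli1 _ _ _ _ R mu mu k mk k0).
have mksec u : measurable_fun setT (fun v => k (u, v)).
  exact: (measurableT_comp mk (pair1_measurable u)).
have mkint : measurable_fun setT (fun u => \int[mu]_v k (u, v))%E.
  exact: (@measurable_fun_fubini_tonelli_F _ _ _ _ R mu k mk k0).
rewrite (ge0_integral_affine 0 r0)//; last by move=> u; exact: integral_ge0.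
rewrite preimage_setT.
have mfs : measurable_fun setT (f \_ (square L)).
  by apply/(measurable_restrictT _ (measurable_square L)); exact: measurable_funTS.
have fs0 x : (0 <= (f \_ (square L)) x)%E by rewrite patchE; case: ifP.
rewrite [X in (_ * X)%E](_ : _ = \int[mu]_u (r%:E * \int[mu]_v (f \_ (square L)) (u, v)))%E.
  rewrite ge0_integralZl//; last 3 first.
  - exact: (@measurable_fun_fubini_tonelli_F _ _ _ _ R mu _ mfs fs0).
  - by move=> u _; exact: integral_ge0.
  - by rewrite lee_fin ltW.
  rewrite muleA -EFinM -expr2; congr (_ * _)%E.
  exact/esym/(@fubini_tonelli1 _ _ _ _ R mu mu _ mfs fs0).
apply: eq_integral => u _; rewrite (ge0_integral_affine 0 r0)//; last exact: mksec.
by congr (_ * _)%E; apply: eq_integral => v _; rewrite kE.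
Qed.

(** Along the squares of half-side [2 ^+ n * L] the logarithm [x] grows in steps of [ln 2], and the
    decay of [g] bounds each increment of mass by [16 * e / x ^+ 2]. Such increments telescope to a
    multiple of [e / ln L]. *)
Lemma square_mass_tail (e L : R) : 0 < e -> 0 < L -> 1 <= ln L ->
  (forall x, L <= x -> g x <= e * (x ^+ 2 * ln x ^+ 2)^-1) ->
  ln L * (C - square_mass g L) <= 32 * e / ln 2.
Proof.
move=> e0 L0 L1 ge; set p := ln L in L1 *.
have q0 : 0 < ln 2 :> R by rewrite ln_gt0// ltr1n.
have q1 : ln 2 <= 1 :> R by have := @le_ln1Dx R 1; rewrite (_ : 1 + 1 = 2)//; apply; lra.
set q := ln 2 in q0 q1 *.
have p0 : 0 < p by lra.
have lnE n : ln (2 ^+ n * L) = n%:R * q + p.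
  by rewrite lnM ?posrE ?exprn_gt0// lnXn// mulr_natl.
have step n : square_mass g (2 ^+ n * L) <=
    square_mass g L + 32 * e / q * (p^-1 - (n%:R * q + p)^-1).
  elim: n => [|n IH]; first by rewrite expr0 mul1r mul0r add0r subrr mulr0 addr0.
  set s := 2 ^+ n * L in IH; set x := n%:R * q + p in IH.
  have s0 : 0 < s by rewrite mulr_gt0// exprn_gt0.
  have Ls : L <= s by rewrite /s ler_peMl ?(ltW L0)// exprn_ege1// ler1n.
  have x1 : 1 <= x by rewrite /x (le_trans L1)// lerDr mulr_ge0// ltW.
  have := square_mass_double g01 g_noninc CE (ltW s0).
  rewrite [2 * s]mulrA -exprS => dbl.
  have gs := ge s Ls; rewrite lnE -/x in gs.
  have -> : n.+1%:R * q + p = x + q by rewrite /x -natr1; ring.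
  have gs2 : 16 * s ^+ 2 * g s <= 16 * e / x ^+ 2.
    have := ler_wpM2l (_ : 0 <= 16 * s ^+ 2) gs.
    rewrite mulr_ge0 ?sqr_ge0// => /(_ isT) h; apply: (le_trans h).
    by rewrite le_eqVlt; apply/orP; left; apply/eqP; field; rewrite !gt_eqF//; lra.
  (* The factor 2 between 16 and 32 pays for [x + q <= 2 * x], true because [q <= 1 <= x]. *)
  have tele : 16 * e / x ^+ 2 <= 32 * e / q * (x^-1 - (x + q)^-1).
    have -> : 32 * e / q * (x^-1 - (x + q)^-1) = (16 * e / x ^+ 2) * (2 * x / (x + q)).
      by field; rewrite !gt_eqF//; lra.
    apply: ler_peMr; first by rewrite divr_ge0 ?sqr_ge0// mulr_ge0// ltW.
    by rewrite ler_pdivlMr ?mul1r; lra.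
  by move: IH dbl gs2 tele; rewrite !mulrBr; lra.
have : C <= square_mass g L + 32 * e / q * p^-1.
  apply: (square_mass_sup g01 g_noninc CE L0) => n; apply: (le_trans (step n)).
  rewrite lerD2l ler_wpM2l ?divr_ge0 ?mulr_ge0 ?(ltW e0) ?(ltW q0)//.
  by rewrite gerBl invr_ge0 addr_ge0 ?mulr_ge0// ltW.
rewrite -lerBlDl => /(ler_wpM2l (ltW p0)).
by rewrite [p * (_ / p)]mulrC divfK// gt_eqF.
Qed.

End degree_asymptotics.

Section marginal_lower_bound.
Context {R : realType}.
Local Notation mu := (@lebesgue_measure R).
Variable g : R -> R.
Hypotheses (g01 : forall x : R, 0 <= x -> 0 <= g x <= 1)
  (g_noninc : forall x y : R, 0 <= x -> x <= y -> g y <= g x).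

(** For [v] within [a * r / 2] of 0, both coordinates are at most [a * r / 2], so the distance is at
    most [a * r] and the kernel at least [g a]. The condition [a * r <= 1] keeps this interval
    inside the period. *)
Lemma marginal_ge r s a : 0 < r -> 0 < a -> 0 <= s -> s <= a * r / 2 ->
  a * r <= 1 -> a * r * g a <= marginal g r s.
Proof.
move=> r0 a0 s0 sar ar1; have ar0 : 0 < a * r by rewrite mulr_gt0.
rewrite -lee_fin -(marginalE r0 g01 g_noninc).
have rad0 v : (0 <= (radial g r s (circle_dist v))%:E)%E.
  by rewrite lee_fin; have /andP[] := radial01 r0 g01 s (circle_dist v).
have mrad : measurable_fun setT (fun v : measurableTypeR R => (radial g r s (circle_dist v))%:E).
  apply/measurable_EFinP; apply: measurable_radial => //; exact: measurable_circle_dist.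
pose I : set (measurableTypeR R) := `[- (a * r / 2), a * r / 2[%classic.
have mI : measurable I by exact: measurable_itv.
have mp : measurable (period : set (measurableTypeR R)) by exact: measurable_itv.
apply: (@le_trans _ _ (\int[mu]_(v in I) (radial g r s (circle_dist v))%:E)%E).
  have -> : ((a * r * g a)%:E = \int[mu]_(v in I) (g a)%:E)%E.
    rewrite integral_cst//= /I lebesgue_measure_itv/= lte_fin ifT; last by lra.
    by rewrite -EFinD -EFinM; congr (_%:E); field.
  apply: ge0_le_integral => //.
  - by move=> v _; rewrite lee_fin; have /andP[] := g01 (ltW a0).
  - exact: measurable_funTS.
  - move=> v; rewrite /I /= in_itv/= => /andP[v1 v2]; rewrite lee_fin.
    apply: g_noninc; first by rewrite divr_ge0 ?sqrtr_ge0// ltW.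
    rewrite ler_pdivrMr//.
    have vh : `|v| <= a * r / 2 by rewrite ler_norml v1 ltW.
    rewrite circle_dist_small; last by rewrite (le_trans vh)//; lra.
    rewrite real_normK ?num_real// -[leRHS]gtr0_norm// -sqrtr_sqr ler_wsqrtr//.
    have : s ^+ 2 <= (a * r / 2) ^+ 2 by rewrite ler_sqr ?nnegrE// ltW//; lra.
    have : v ^+ 2 <= (a * r / 2) ^+ 2.
      by rewrite -[v ^+ 2]real_normK ?num_real// ler_sqr ?nnegrE// ltW//; lra.
    by rewrite expr_div_n; have := sqr_ge0 (a * r); lra.
rewrite ge0_integral_mrestr//.
apply: ge0_subset_integral => //; first exact: measurable_funTS.
move=> v; rewrite /I /period /= !in_itv/=; lra.
Qed.

End marginal_lower_bound.

(** * The rate and the variance as the density grows *)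

Section asymptotics.
Context {R : realType}.
Variables (g : R -> R) (C b : R).
Hypotheses (g01 : forall x : R, 0 <= x -> 0 <= g x <= 1)
  (g_noninc : forall x y : R, 0 <= x -> x <= y -> g y <= g x)
  (CE : C%:E = (\int[leb2]_x (g (enorm x))%:E)%E) (C_gt0 : 0 < C)
  (g_small : forall e : R, 0 < e ->
    \forall x \near +oo, g x <= e * (x ^+ 2 * ln x ^+ 2)^-1).

Local Notation ell rho := (ln rho + b).

Definition conn_radius rho := Num.sqrt (ell rho / (C * rho)).

Lemma conn_radius_gt0 rho : 0 < rho -> 0 < ell rho -> 0 < conn_radius rho.
Proof. by move=> rho0 l0; rewrite sqrtr_gt0 divr_gt0// mulr_gt0. Qed.

Lemma conn_radius_sqr rho : 0 < rho -> 0 < ell rho ->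
  rho * conn_radius rho ^+ 2 = ell rho / C.
Proof.
move=> rho0 l0; rewrite sqr_sqrtr; last by rewrite divr_ge0 ?mulr_ge0// ltW.
by field; rewrite !gt_eqF.
Qed.

(** Twice the right side is [ln C + ln rho - ln 8 - ln (ell / 2)], where [ell] is [ln rho + b].
    Since [ln (ell / 2) < ell / 2], it exceeds [ell / 2] minus a constant, and by hypothesis this
    constant is at most [ell / 4]. *)
Lemma ln_inv_conn_radius rho : 0 < rho -> 0 < ell rho ->
  4 * (ln 8 + b - ln C) <= ell rho -> ell rho / 8 <= ln (2 * conn_radius rho)^-1.
Proof.
move=> rho0 l0 lK; have r0 := conn_radius_gt0 rho0 l0.
have L0 : 0 < (2 * conn_radius rho)^-1 by rewrite invr_gt0 mulr_gt0.
have : ln ((2 * conn_radius rho)^-1 ^+ 2) = ln C + ln rho - (ln 8 + ln (ell rho / 2)).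
  rewrite -lnM ?posrE// -[ln 8 + _]lnM ?posrE ?divr_gt0// -ln_div ?posrE ?mulr_gt0 ?divr_gt0//.
  congr ln; have := conn_radius_sqr rho0 l0 => /(congr1 (fun x => x / rho)).
  rewrite mulrC mulKf ?gt_eqF// => h; rewrite exprVn exprMn h.
  by field; rewrite !gt_eqF.
rewrite lnXn//.
have := @ln_sublinear R (ell rho / 2); rewrite divr_gt0// => /(_ isT).
lra.
Qed.

Lemma near_ell K : \forall rho \near +oo, 0 < rho /\ K <= ell rho.
Proof.
have E0 : 0 < expR (K - b) := expR_gt0 _.
have : \forall rho \near +oo, expR (K - b) <= rho by apply: nbhs_pinfty_ge; rewrite num_real.
apply: filterS => rho h; have rho0 := lt_le_trans E0 h; split => //.
by rewrite -lerBlDr -[K - b]expRK ler_ln ?posrE.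
Qed.

Lemma near_window K : \forall rho \near +oo,
  [/\ 0 < rho, 0 < ell rho, ell rho / 8 <= ln (2 * conn_radius rho)^-1 & K <= ell rho].
Proof.
apply: filterS3 (near_ell (4 * (ln 8 + b - ln C))) (near_ell K) (near_ell 1).
move=> rho [rho0 h1] [_ h2] [_ h3]; have l0 : 0 < ell rho by lra.
by split => //; exact: ln_inv_conn_radius.
Qed.

Definition isolation_rate rho := rho * expR (- rho * degree g (conn_radius rho)).

Lemma isolation_rateE rho : 0 < rho -> 0 < ell rho ->
  isolation_rate rho =
  expR (- b + ell rho * (C - square_mass g (2 * conn_radius rho)^-1) / C).
Proof.
move=> rho0 l0; rewrite /isolation_rate -{1}(lnK rho0) -expRD; congr expR.
rewrite (degree_square_mass g01 g_noninc CE)//; last exact: conn_radius_gt0.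
rewrite mulrA mulNr conn_radius_sqr//; field; by rewrite gt_eqF.
Qed.

(** The rate approaches its limit from above, because the rescaled torus captures at most the mass
    [C]. The missing mass beyond [L] is small compared with [(ln L)^-1], and [ln L] is at least
    [ell / 8]. *)
Lemma near_isolation_rate eps : 0 < eps ->
  \forall rho \near +oo, expR (- b) <= isolation_rate rho <= expR (- b) + eps.
Proof.
move=> eps0; have mu0 : 0 < expR (- b) := expR_gt0 _.
pose del := ln (expR (- b) + eps) + b.
have del0 : 0 < del.
  have : ln (expR (- b)) < ln (expR (- b) + eps).
    by rewrite ltr_ln ?posrE ?ltrDl// addr_gt0.
  by rewrite expRK /del; lra.
have q0 : 0 < ln 2 :> R by rewrite ln_gt0// ltr1n.
(* The 256 is 8 times 32: 8 from comparing [ln rho + b] with [ln L], 32 from [square_mass_tail]. *)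
pose e := del * C * ln 2 / 256.
have e0 : 0 < e by rewrite /e divr_gt0// !mulr_gt0.
have [X [_ /= gX]] := g_small e0.
(* The threshold gives [ln L >= |X| + 1], hence both [L > X] and [ln L >= 1]. *)
apply: filterS (near_window (8 * (`|X| + 1))) => rho [rho0 l0 lL lK].
rewrite isolation_rateE//; set L := (2 * conn_radius rho)^-1 in lL *.
have L0 : 0 < L by rewrite invr_gt0 mulr_gt0// conn_radius_gt0.
have lnL := ln_sublinear L0.
have X0 := normr_ge0 X; have XX := ler_norm X.
have T0 : 0 <= C - square_mass g L by rewrite subr_ge0 (square_mass_le g01 g_noninc CE).
rewrite ler_expR lerDl divr_ge0 ?mulr_ge0 ?(ltW l0) ?(ltW C_gt0)//=.
rewrite -[leRHS]lnK ?posrE ?addr_gt0// ler_expR.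
suff : ell rho * (C - square_mass g L) / C <= del by rewrite /del; lra.
have tail : ln L * (C - square_mass g L) <= 32 * e / ln 2.
  apply: (square_mass_tail g01 g_noninc CE) => //; first by lra.
  by move=> x Lx; apply: gX; lra.
rewrite ler_pdivrMr//.
have -> : del * C = 8 * (32 * e / ln 2) by rewrite /e; field; rewrite gt_eqF.
by have := ler_wpM2r T0 lL; lra.
Qed.

Definition isolation_variance rho := isolation_rate rho ^+ 2 *
  (second_moment unif rho (torus_kernel (fun x => g (x / conn_radius rho))) - 1).

(* The pairs of points closer than [m^-3 r] have negligible mass; for the others,
   the excess area not covered by both disks is of order [m / rho], where
   [m ^ 4 = ln rho + b]. *)
Lemma isolation_variance_le rho m (a := Num.sqrt C / 4) :
  0 < rho -> 1 <= m -> ell rho = m ^+ 4 -> a^-1 <= m ->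
  a * conn_radius rho <= 1 -> 32 * conn_radius rho <= a * g a ->
  g (4 * conn_radius rho)^-1 <= 16 * conn_radius rho ^+ 2 ->
  isolation_variance rho <=
    isolation_rate rho * (9`!%:R * (a * g a / (2 * C)) ^- 9 + 4 / C) / m.
Proof.
move=> rho0 m1 lm am ar r32 gr.
have m0 : 0 < m by lra.
have l0 : 0 < ell rho by rewrite lm exprn_gt0.
set r := conn_radius rho in ar r32 gr *.
have r0 : 0 < r := conn_radius_gt0 rho0 l0.
have rhor : rho * r ^+ 2 = m ^+ 4 / C by rewrite /r conn_radius_sqr// lm.
have a0 : 0 < a by rewrite divr_gt0// sqrtr_gt0.
have ga0 : 0 < g a := profile_gt0 g01 g_noninc CE C_gt0.
clearbody a; set c1 := a * g a / (2 * C).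
have c10 : 0 < c1 by rewrite divr_gt0// mulr_gt0.
pose s := m ^- 3.
have s0 : 0 < s by rewrite invr_gt0 exprn_gt0.
pose tau := s * r.
have tau0 : 0 < tau by rewrite mulr_gt0.
(* The marginal near 0 is at least [a * r * g a]. One half of it is kept, the other half pays for
   the marginal at distance 1/4, which is of order [r ^+ 2]. *)
pose kappa := tau * (a * r * g a / 2).
set c := degree g r.
have kappa_le : kappa <= tau * (marginal g r (tau / 2) - marginal g r 4^-1).
  rewrite /kappa ler_pM2l//.
  have h1 : a * r * g a <= marginal g r (tau / 2).
    apply: marginal_ge => //; first by rewrite divr_ge0 ?ltW.
    rewrite ler_pM2r ?invr_gt0// /tau ler_pM2r//.
    have m3 : m <= m ^+ 3 by rewrite ler_eXnr.
    rewrite /s invf_ple ?posrE ?exprn_gt0//; lra.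
  have h2 : marginal g r 4^-1 <= 16 * r ^+ 2.
    apply: le_trans gr; rewrite -lee_fin -(marginalE r0 g01 g_noninc).
    have -> : ((g (4 * r)^-1)%:E = \int[@unif1 R]_v (g (4 * r)^-1)%:E)%E.
      by rewrite integral_cst//= [X in (_ * X)%E](_ : _ = 1%E) ?mule1//; exact: probability_setT.
    apply: ge0_le_integral => //.
    - by move=> v _; rewrite lee_fin; have /andP[] := radial01 r0 g01 4^-1 (circle_dist v).
    - by apply/measurable_EFinP; apply: measurable_radial => //; exact: measurable_circle_dist.
    - move=> v _; rewrite lee_fin; apply: g_noninc; first by rewrite invr_ge0 mulr_ge0// ltW.
      rewrite invfM ler_pM2r ?invr_gt0// -[leLHS]gtr0_norm// -sqrtr_sqr ler_wsqrtr//.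
      by rewrite lerDl sqr_ge0.
  have : 16 * r ^+ 2 <= r * (a * g a / 2).
    by rewrite [16 * _](_ : _ = r * (16 * r)) ?ler_pM2l//; [lra | ring].
  lra.
have := second_moment_le rho0 r0 g01 g_noninc tau0 kappa_le; rewrite -/c => sm.
rewrite /isolation_variance -/r.
have lamE : isolation_rate rho = rho * expR (- rho * c) by [].
set lam := isolation_rate rho in lamE *.
have lam0 : 0 < lam by rewrite lamE mulr_gt0 ?expR_gt0.
(* One of the two factors [lam] of the variance absorbs the large exponential. *)
have lame : lam * expR (rho * c) = rho.
  by rewrite lamE -mulrA -expRD mulNr addNr expR0 mulr1.
have c0 : 0 <= c by exact: degree_ge0.
have rc : rho * c <= m ^+ 4.
  rewrite /c (degree_square_mass g01 g_noninc CE)// mulrA rhor.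
  rewrite -mulrA ler_piMr ?exprn_ge0 ?(ltW m0)// mulrC ler_pdivrMr// mul1r.
  exact: (square_mass_le g01 g_noninc CE).
have rk : rho * kappa = c1 * m.
  rewrite /kappa /tau /s (_ : _ * _ = rho * r ^+ 2 * (m ^- 3 * a * g a / 2)); last by ring.
  by rewrite rhor /c1; field; rewrite !gt_eqF.
(* The power 9 exceeds by one the power in [(rho * c) ^+ 2 <= m ^+ 8], which leaves the factor
   [m^-1] of the bound. *)
have exp_le : expR (- (c1 * m)) <= 9`!%:R * (c1 * m) ^- 9.
  have y0 : 0 < 9`!%:R * (c1 * m) ^- 9.
    by apply: mulr_gt0; rewrite ?ltr0n ?fact_gt0// invr_gt0 exprn_gt0// mulr_gt0.
  rewrite expRN invf_ple ?posrE ?expR_gt0// invfM invrK mulrC.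
  have := @expR_ge1Dxn R (c1 * m) 8; rewrite mulr_ge0 ?(ltW c10) ?(ltW m0)// => /(_ isT); lra.
apply: (@le_trans _ _ (lam * ((rho * c) ^+ 2 * expR (- (c1 * m)) + 4 * (m ^+ 4 / C) * s ^+ 2))).
  apply: (@le_trans _ _ (lam ^+ 2 * (rho * expR (rho * (c - kappa)) * c ^+ 2 +
      expR (rho * c) * (2 * tau) ^+ 2))).
    by rewrite ler_pM2l ?exprn_gt0//; lra.
  rewrite mulrBr expRD rk -rhor /tau le_eqVlt; apply/orP; left; apply/eqP.
  transitivity (lam * (lam * expR (rho * c)) *
      (rho * c ^+ 2 * expR (- (c1 * m)) + (2 * (s * r)) ^+ 2)); first by ring.
  by rewrite lame; ring.
rewrite -[leRHS]mulrA ler_pM2l// [leRHS]mulrDl; apply: lerD.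
  apply: (@le_trans _ _ ((m ^+ 4) ^+ 2 * (9`!%:R * (c1 * m) ^- 9))).
    apply: ler_pM; [exact: sqr_ge0|exact: expR_ge0| |exact: exp_le].
    by rewrite ler_sqr ?nnegrE ?exprn_ge0 ?mulr_ge0 ?(ltW m0) ?(ltW rho0).
  rewrite le_eqVlt; apply/orP; left; apply/eqP; field.
  by rewrite !gt_eqF.
rewrite (_ : 4 * _ * _ = 4 / C * m ^- 2); last by rewrite /s; field; rewrite !gt_eqF.
rewrite ler_pM2l ?divr_gt0// lef_pV2 ?posrE ?exprn_gt0//.
by rewrite ler_eXnr.
Qed.

Lemma near_isolation_variance eps : 0 < eps ->
  \forall rho \near +oo, isolation_variance rho <= eps.
Proof.
move=> eps0; pose a := Num.sqrt C / 4.
have a0 : 0 < a by rewrite divr_gt0// sqrtr_gt0.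
have ga0 : 0 < g a := profile_gt0 g01 g_noninc CE C_gt0.
pose K := 9`!%:R * (a * g a / (2 * C)) ^- 9 + 4 / C.
have K0 : 0 < K.
  apply: addr_gt0; last by rewrite divr_gt0.
  apply: mulr_gt0; rewrite ?ltr0n ?fact_gt0// invr_gt0 exprn_gt0//.
  by rewrite divr_gt0// mulr_gt0.
(* The summands are the lower bounds required of [m]; the last one makes the final bound at most
   [eps], with the rate bounded by [expR (- b) + 1]. *)
pose M := 1 + a^-1 + (expR (- b) + 1) * K / eps.
have ainv : 0 < a^-1 by rewrite invr_gt0.
have Ke0 : 0 < (expR (- b) + 1) * K / eps.
  by rewrite divr_gt0// mulr_gt0// addr_gt0// expR_gt0.
have M0 : 1 <= M by rewrite /M; lra.
have [X [_ /= gX]] := g_small ltr01.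
(* With [2 * Y <= ln L], each summand secures a side condition: [|X|] and 3 give [X < L / 2] and
   [ln (L / 2) >= 1], [a] gives [a * r <= 1], and the last gives [32 * r <= a * g a]. *)
pose Y := `|X| + 3 + a + (a * g a)^-1 * 16.
have aga : 0 < (a * g a)^-1 by rewrite invr_gt0 mulr_gt0.
apply: filterS3 (near_window (8 * (2 * Y))) (near_window (M ^+ 4)) (near_isolation_rate ltr01).
move=> rho [rho0 l0 lL lY] [_ _ _ lM] /andP[_ lam1].
set r := conn_radius rho in lL.
have r0 : 0 < r := conn_radius_gt0 rho0 l0.
set L := (2 * r)^-1 in lL.
have L0 : 0 < L by rewrite invr_gt0 mulr_gt0.
have rE : r = (2 * L)^-1 by rewrite /L; field; rewrite gt_eqF.
have lnL := ln_sublinear L0.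
have X0 := normr_ge0 X; have XX := ler_norm X.
have YL : 2 * Y <= L by lra.
pose m := Num.sqrt (Num.sqrt (ell rho)).
have mE : ell rho = m ^+ 4.
  by rewrite (exprM m 2 2) !sqr_sqrtr// ?sqrtr_ge0// ltW.
have Mm : M <= m.
  have m0 : 0 <= m by exact: sqrtr_ge0.
  by move: lM; rewrite mE ler_pXn2r ?nnegrE//; lra.
have lam0 : 0 < isolation_rate rho by rewrite mulr_gt0 ?expR_gt0.
have V := @isolation_variance_le rho m rho0.
have Vm : isolation_variance rho <= isolation_rate rho * K / m.
  apply: V => //.
  - by move: Mm; lra.
  - by rewrite -/a; move: Mm; rewrite /M; lra.
  - rewrite -/a -/r rE ler_pdivrMr ?mulr_gt0// mul1r /Y in YL *; lra.
  - rewrite -/a -/r rE ler_pdivrMr ?mulr_gt0//.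
    have : (a * g a)^-1 * 16 <= L by move: YL; rewrite /Y; lra.
    rewrite ler_pdivrMl; last exact: mulr_gt0.
    lra.
  - rewrite -/r (_ : (4 * r)^-1 = L / 2); last by rewrite rE; field; rewrite gt_eqF.
    have XL : X < L / 2 by move: YL; rewrite /Y; lra.
    apply: (le_trans (gX _ XL)); rewrite mul1r.
    have lnL2 : 1 <= ln (L / 2).
      rewrite ln_div ?posrE//.
      have := @le_ln1Dx R 1; rewrite (_ : 1 + 1 = 2)// => /(_ ltac:(lra)).
      move: lL lY; rewrite /Y; lra.
    have -> : 16 * r ^+ 2 = ((L / 2) ^+ 2)^-1 by rewrite rE; field; rewrite gt_eqF.
    have lnL0 : 0 < ln (L / 2) by lra.
    rewrite lef_pV2 ?posrE ?mulr_gt0 ?exprn_gt0 ?divr_gt0//.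
    by rewrite ler_peMr ?sqr_ge0// exprn_ege1.
apply: (le_trans Vm); rewrite ler_pdivrMr; last by lra.
apply: (@le_trans _ _ ((expR (- b) + 1) * K)); first by rewrite ler_pM2r.
by rewrite [leRHS]mulrC -ler_pdivrMr//; move: Mm; rewrite /M; lra.
Qed.

End asymptotics.

(** * The Poisson limit *)

(* An approximate Stein recursion [(k + 1) p_(k+1) = mu p_k] determines the ratios
   [p_k / p_0] in the limit; the tail bound then prevents the loss of mass. *)
Section approximate_poisson.
Context {R : realType} {I : Type} {F : set_system I}.
Context {FF : Filter F}.
Variables (mu : R) (p : I -> nat -> R).
Hypotheses (mu_gt0 : 0 < mu)
  (p_ge0 : \forall i \near F, forall k, 0 <= p i k)
  (p_le1 : \forall i \near F, forall N, \sum_(k < N) p i k <= 1)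
  (p_stein : forall k, k.+1%:R * p i k.+1 - mu * p i k @[i --> F] --> 0)
  (p_tail : \forall i \near F, forall N,
    1 - \sum_(k < N.+1) p i k <= (mu + 1) / N.+1%:R).

Let w k : R := exp_coeff mu k.

Lemma stein_ratio k : p i k - p i 0%N * w k @[i --> F] --> 0.
Proof.
elim: k => [|k IH].
  have -> : (fun i => p i 0%N - p i 0%N * w 0%N) = cst 0.
    by apply/funext => i; rewrite /w /exp_coeff /= expr0 fact0 divr1 mulr1 subrr.
  exact: cvg_cst.
have k0 : k.+1%:R != 0 :> R by rewrite pnatr_eq0.
have -> : (fun i => p i k.+1 - p i 0%N * w k.+1) =
    (fun i => k.+1%:R^-1 * (k.+1%:R * p i k.+1 - mu * p i k) +
              (k.+1%:R^-1 * mu) * (p i k - p i 0%N * w k)).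
  apply/funext => i; have -> : w k.+1 = w k * mu / k.+1%:R.
    by rewrite /w /exp_coeff /= exprSr factS natrM invfM; ring.
  by rewrite !mulrBr mulKf//; ring.
rewrite -[0](_ : k.+1%:R^-1 * 0 + (k.+1%:R^-1 * mu) * 0 = 0); last by rewrite !mulr0 addr0.
apply: cvgD; apply: cvgM; [exact: cvg_cst|exact: p_stein|exact: cvg_cst|exact: IH].
Qed.

Let wsum_cvg : series w @ \oo --> expR mu.
Proof. exact: (is_cvg_series_exp_coeff mu). Qed.

Let wsum_le n : series w n <= expR mu.
Proof.
apply: nondecreasing_cvgn_le; last exact: is_cvg_series_exp_coeff.
apply: nondecreasing_series => k _ _; exact/exp_coeff_ge0/ltW.
Qed.

(** A partial sum of the [p i k] is close to [p i 0] times a partial sum of the exponential series,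
    and up to the tail it equals 1; this fixes the normalization. *)
Lemma stein_zero : p i 0%N @[i --> F] --> expR (- mu).
Proof.
have sum_ratio N : \sum_(k < N) p i k - p i 0%N * series w N @[i --> F] --> 0.
  elim: N => [|N IH].
    have -> : (fun i => \sum_(k < 0) p i k - p i 0%N * series w 0%N) = cst 0.
      by apply/funext => i; rewrite big_ord0 /series /= big_geq// mulr0 subrr.
    exact: cvg_cst.
  have -> : (fun i => \sum_(k < N.+1) p i k - p i 0%N * series w N.+1) =
     (fun i => (\sum_(k < N) p i k - p i 0%N * series w N) + (p i N - p i 0%N * w N)).
    apply/funext => i; rewrite big_ord_recr /= seriesSr; ring.
  by have := cvgD IH (stein_ratio N); rewrite addr0; exact.
have E0 : 0 < expR mu := expR_gt0 mu.
suff h : p i 0%N * expR mu @[i --> F] --> (1 : R).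
  have -> : (fun i => p i 0%N) = (fun i => p i 0%N * expR mu * expR (- mu)).
    by apply/funext => i; rewrite -mulrA -expRD subrr expR0 mulr1.
  by have := cvgM h (cvg_cst (expR (- mu))); rewrite mul1r; exact.
apply/cvgrPdist_le => e e0.
have e3 : 0 < e / 3 by lra.
have /cvgrPdist_le/(_ _ e3)[N1 _ /= hN1] := wsum_cvg.
(* The length [N] is fixed before [i]: it makes the remainder of the exponential series and the mass
   beyond [N] at most [e / 3] each. *)
pose N := (N1 + Num.truncn (3 * (mu + 1) / e)).+1.
have hN : expR mu - series w N <= e / 3.
  have := hN1 N; rewrite /= leqW ?leq_addr// => /(_ isT).
  by rewrite ger0_norm// subr_ge0.
have tN : (mu + 1) / N%:R <= e / 3.
  have : 3 * (mu + 1) / e < N%:R.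
    have := truncnS_gt (3 * (mu + 1) / e) => /lt_le_trans; apply.
    by rewrite ler_nat ltnS leq_addl.
  rewrite ltr_pdivrMr// => h; rewrite ler_pdivrMr ?ltr0n//; lra.
have /cvgrPdist_le/(_ _ e3) sN := sum_ratio N.
apply: filterS3 sN (filterI p_ge0 p_le1) p_tail => i; rewrite sub0r normrN => h1 [h2 h3] h4.
have q0 := h2 0%N.
have q1 : p i 0%N <= 1 by have := h3 1%N; rewrite big_ord1.
have s1 := h3 N.
have s2 : 1 - \sum_(k < N) p i k <= (mu + 1) / N%:R := h4 _.
have W0 : 0 <= expR mu - series w N by rewrite subr_ge0.
have qW : p i 0%N * (expR mu - series w N) <= e / 3.
  by apply: le_trans hN; rewrite ler_piMl.
have qW0 : 0 <= p i 0%N * (expR mu - series w N) by rewrite mulr_ge0.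
move: h1; rewrite !ler_norml => /andP[h5 h6]; apply/andP; split; lra.
Qed.

Lemma stein_poisson k : p i k @[i --> F] --> poisson_pmf mu k.
Proof.
have -> : (fun i => p i k) = (fun i => (p i k - p i 0%N * w k) + p i 0%N * w k).
  by apply/funext => i; ring.
rewrite /poisson_pmf mu_gt0 -[_ * expR _]add0r; apply: cvgD; first exact: stein_ratio.
by rewrite mulrC; apply: cvgM; [exact: stein_zero|exact: cvg_cst].
Qed.

End approximate_poisson.

Lemma poisson_prob_lt {R : realType} (mu : R) (N : nat) : 0 < mu ->
  poisson_prob mu 0%N `I_N = (\sum_(k < N) poisson_pmf mu k)%:E.
Proof.
move=> mu0; rewrite /poisson_prob mu0 esum_fset; last 2 first.
- exact: finite_II.
- by move=> k _; rewrite lee_fin poisson_pmf_ge0.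
by rewrite -fsbig_ord sumEFin.
Qed.

Theorem theorem2 (R : realType) (b C : R) (g : R -> R)
  (g01 : forall x : R, 0 <= x -> 0 <= g x <= 1)
  (g_noninc : forall x y : R, 0 <= x -> x <= y -> g y <= g x)
  (CE : C%:E = (\int[leb2]_x (g (enorm x))%:E)%E)
  (C_gt0 : 0 < C)
  (g_o : (g : R -> R^o) =o_ (pinfty_nbhs R) (fun x => (x ^+ 2 * ln x ^+ 2)^-1 : R^o))
  (d : R -> measure_display) (T : forall rho : R, measurableType (d rho))
  (P : forall rho : R, probability (T rho) R)
  (G : forall rho : R, random_graph R (T rho))
  (GE : forall rho : R, 0 < rho -> 0 < ln rho + b ->
    let r := Num.sqrt ((ln rho + b) / (C * rho)) in
    is_random_connection_network (P rho) rho (fun x => g (x / r)) (G rho)) :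
  cvg_in_distribution +oo%R
    (fun rho => pushforward (P rho) (fun w => (nb_isolated (G rho) w)%:R : R))
    (pushforward (poisson_prob (expR (- b)) 0%N) (fun k : nat => k%:R : R)).
Proof.
have g_small e : 0 < e -> \forall x \near +oo, g x <= e * (x ^+ 2 * ln x ^+ 2)^-1.
  move=> e0; have /eqoP/(_ e e0) := g_o; apply: filterS => x.
  rewrite [leRHS](_ : _ = e * (x ^+ 2 * ln x ^+ 2)^-1).
    exact/le_trans/ler_norm.
  by congr (_ * _); rewrite ger0_norm// invr_ge0 mulr_ge0 ?sqr_ge0.
pose mu := expR (- b); have mu0 : 0 < mu := expR_gt0 _.
pose p rho k := isolated_law (P rho) (G rho) k.
have nearRCN : \forall rho \near +oo, 0 < rho /\ 0 < conn_radius C b rho /\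
    is_random_connection_network (P rho) rho (fun x => g (x / conn_radius C b rho)) (G rho).
  apply: filterS (near_ell b 1) => rho [rho0 l1]; have l0 : 0 < ln rho + b by lra.
  by split=> //; split; [exact: conn_radius_gt0|exact: GE].
have p_ge0 : \forall rho \near +oo, forall k, 0 <= p rho k.
  apply: filterS nearRCN => rho [rho0 [r0 PG]] k; exact: isolated_law_ge0.
have p_le1 : \forall rho \near +oo, forall N, \sum_(k < N) p rho k <= 1.
  apply: filterS nearRCN => rho [rho0 [r0 PG]] N; exact: (sum_isolated_law_le1 PG).
have p_stein k : k.+1%:R * p rho k.+1 - mu * p rho k @[rho --> +oo] --> 0.
  apply/cvgrPdist_le => e e0; have e3 : 0 < e / 3 by lra.
  (* With the variance at most [(e / 3) ^+ 2], the Stein bound taken at [e / 3] is at most two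
     thirds of [e]; the last third pays for replacing the rate by its limit [mu]. *)
  apply: filterS3 (near_isolation_variance b g01 g_noninc CE C_gt0 g_small (exprn_gt0 2 e3))
    (near_isolation_rate b g01 g_noninc CE C_gt0 g_small e3)
    (filterI nearRCN (filterI p_ge0 p_le1)).
  move=> rho V /andP[lam1 lam2] [[rho0 [r0 PG]] [q0 q1]].
  have := isolated_law_stein rho0 PG (measurable_torus_kernel r0 g_noninc)
    (torus_kernel01 r0 g01) (torus_kernel_sym g _)
    (integral_torus_kernel r0 g01 g_noninc) k e3.
  rewrite -/(isolation_rate g C b rho) -/(isolation_variance g C b rho) -/(p rho k) -/(p rho k.+1).
  have Ve : isolation_variance g C b rho / (e / 3) <= e / 3.
    by rewrite ler_pdivrMr// -expr2.
  have pk1 : p rho k <= 1.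
    apply: le_trans (q1 k.+1); rewrite big_ord_recr/= lerDr; apply: sumr_ge0 => i _; exact: q0.
  have lamp : 0 <= (isolation_rate g C b rho - mu) * p rho k <= e / 3.
    rewrite mulr_ge0 ?subr_ge0//=; apply: (@le_trans _ _ (isolation_rate g C b rho - mu)).
      by rewrite ler_piMr// subr_ge0.
    by rewrite lerBlDl.
  move: lamp; rewrite mulrBl sub0r normrN !ler_norml => /andP[h1 h2] /andP[h3 h4].
  by apply/andP; split; lra.
have p_tail : \forall rho \near +oo, forall N,
    1 - \sum_(k < N.+1) p rho k <= (mu + 1) / N.+1%:R.
  apply: filterS2 (near_isolation_rate b g01 g_noninc CE C_gt0 g_small ltr01) nearRCN.
  move=> rho /andP[_ lam1] [rho0 [r0 PG]] N.
  have := isolated_law_tail rho0 PG (measurable_torus_kernel r0 g_noninc)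
    (torus_kernel01 r0 g01) (torus_kernel_sym g _)
    (integral_torus_kernel r0 g01 g_noninc) N.
  by move/le_trans; apply; rewrite ler_pM2r ?invr_gt0.
(* Both laws live on the natural numbers. For negative [x] both distribution functions vanish;
   otherwise they are sums over the [k] below [Num.truncn x + 1]. *)
move=> x _; have [x0|x0] := ltP x 0.
  have empty (n : nat) : (n%:R : R) <= x -> False.
    by move=> nx; have := ler0n R n; lra.
  rewrite [X in _ --> X](_ : _ = 0%E); last first.
    rewrite /pushforward [X in poisson_prob _ _ X](_ : _ = `I_0); last first.
      by apply/seteqP; split => n //=; rewrite in_itv/= => /empty.
    by rewrite poisson_prob_lt// big_ord0.
  rewrite [X in X @ _](_ : _ = cst 0%E); first exact: cvg_cst.
  apply/funext => rho; rewrite /pushforward [X in P rho X](_ : _ = set0) ?measure0//.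
  by apply/seteqP; split => w //=; rewrite in_itv/= => /empty.
pose N := (Num.truncn x).+1.
have NE (n : nat) : (n%:R : R) \in `]-oo, x] = (n < N)%N.
  by rewrite in_itv/= ltnS truncn_ge_nat.
rewrite [X in _ --> X](_ : _ = (\sum_(k < N) poisson_pmf mu k)%:E); last first.
  rewrite /pushforward -poisson_prob_lt//; congr (poisson_prob _ _ _).
  by apply/seteqP; split => n /=; rewrite NE.
have cvN : \sum_(k < N) p rho k @[rho --> +oo] --> \sum_(k < N) poisson_pmf mu k.
  elim: N {NE} => [|M IH]; first by under eq_fun do rewrite big_ord0; rewrite big_ord0; exact: cvg_cst.
  under eq_fun do rewrite big_ord_recr; rewrite big_ord_recr /=.
  by apply: cvgD => //; exact: (stein_poisson mu0 p_ge0 p_le1 p_stein p_tail).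
have : (\sum_(k < N) p rho k)%:E @[rho --> +oo] --> (\sum_(k < N) poisson_pmf mu k)%:E.
  by apply: cvg_EFin => //; exact: nearW.
apply: cvg_trans; apply: near_eq_cvg.
apply: filterS nearRCN => rho [rho0 [r0 PG]].
rewrite -(prob_nb_isolated_lt PG) /pushforward; congr (P rho _).
by apply/seteqP; split => w /=; rewrite NE.
Qed.
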